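(* Let $\mathcal{JS}^{2,2}$ be the variety of complex $4$-dimensional Jordan superalgebras of type $(2,2)$ (even part with basis $e_1,e_2$, odd part with basis $f_1,f_2$). Then $\mathcal{JS}^{2,2}$ has dimension $13$, and it has exactly $25$ irreducible components: $24$ of them are the Zariski closures $\overline{O(\mathcal J)}$ of the orbits of the $24$ superalgebras listed below other than $\mathcal J_{16}^t$ (in particular these $24$ superalgebras are rigid), and one is the Zariski closure $\overline{\bigcup_{t\in\mathbb C}O(\mathcal J_{16}^t)}$ of the union of orbits of the one-parameter family $\mathcal J_{16}^t$. In particular $\mathcal{JS}^{2,2}$ is the closure of the union of all these orbits. The superalgebras are: $\mathcal J_{1}$: $e_1^2=e_1,\ e_2^2=e_2$; $\mathcal J_{2}$: $e_1^2=e_1,\ e_2^2=e_2,\ e_2f_2=f_2$; $\mathcal J_{3}$: $e_1^2=e_1,\ e_2^2=e_2,\ e_2f_2=\frac12f_2$; $\mathcal J_{5}$: $e_1^2=e_1,\ e_2^2=e_2,\ e_2f_1=f_1,\ e_2f_2=\frac12f_2$; $\mathcal J_{6}$: $e_1^2=e_1,\ e_2^2=e_2,\ e_2f_1=f_1,\ e_2f_2=f_2,\ f_1f_2=e_2$; $\mathcal J_{8}$: $e_1^2=e_1,\ e_2^2=e_2,\ e_2f_1=\frac12f_1,\ e_2f_2=\frac12f_2,\ f_1f_2=e_2$; $\mathcal J_{9}$: $e_1^2=e_1,\ e_2^2=e_2,\ e_1f_2=\frac12f_2,\ e_2f_2=\frac12f_2$; $\mathcal J_{10}$: $e_1^2=e_1,\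 e_2^2=e_2,\ e_1f_2=\frac12f_2,\ e_2f_1=f_1$; $\mathcal J_{11}$: $e_1^2=e_1,\ e_2^2=e_2,\ e_1f_2=\frac12f_2,\ e_2f_1=f_1,\ e_2f_2=\frac12f_2$; $\mathcal J_{12}$: $e_1^2=e_1,\ e_2^2=e_2,\ e_1f_2=\frac12f_2,\ e_2f_1=\frac12f_1$; $\mathcal J_{13}$: $e_1^2=e_1,\ e_2^2=e_2,\ e_1f_2=\frac12f_2,\ e_2f_1=\frac12f_1,\ e_2f_2=\frac12f_2$; $\mathcal J_{14}$: $e_1^2=e_1,\ e_2^2=e_2,\ e_1f_2=f_2,\ e_2f_1=f_1$; $\mathcal J_{16}^t$ ($t\in\mathbb C$): $e_1^2=e_1,\ e_2^2=e_2,\ e_1f_1=\frac12f_1,\ e_1f_2=\frac12f_2,\ e_2f_1=\frac12f_1,\ e_2f_2=\frac12f_2,\ f_1f_2=e_1+te_2$; $\mathcal J_{24}$: $e_1^2=e_1,\ e_2f_1=f_2,\ f_1f_2=e_2$; $\mathcal J_{32}$: $e_1^2=e_1,\ e_1f_1=\frac12f_1,\ e_1f_2=\frac12f_2,\ e_2f_1=f_2,\ f_1f_2=e_2$; $\mathcal J_{42}$: $e_1^2=e_1,\ e_1e_2=e_2,\ e_1f_1=\frac12f_1,\ e_1f_2=\frac12f_2,\ e_2f_1=f_2,\ f_1f_2=e_2$; $\mathcal J_{49}$: $e_1^2=e_1,\ e_1e_2=e_2,\ e_1f_1=f_1,\ e_1f_2=f_2,\ e_2f_1=f_2,\ f_1f_2=e_2$;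 $\mathcal J_{50}$: $e_1^2=e_1,\ e_1e_2=\frac12e_2$; $\mathcal J_{54}$: $e_1^2=e_1,\ e_1e_2=\frac12e_2,\ e_1f_2=\frac12f_2,\ e_2f_2=f_1,\ f_1f_2=e_2$; $\mathcal J_{56}$: $e_1^2=e_1,\ e_1e_2=\frac12e_2,\ e_1f_2=\frac12f_2,\ e_2f_1=f_2,\ f_1f_2=e_2$; $\mathcal J_{57}$: $e_1^2=e_1,\ e_1e_2=\frac12e_2,\ e_1f_2=f_2$; $\mathcal J_{58}$: $e_1^2=e_1,\ e_1e_2=\frac12e_2,\ e_1f_1=\frac12f_1,\ e_1f_2=\frac12f_2$; $\mathcal J_{62}$: $e_1^2=e_1,\ e_1e_2=\frac12e_2,\ e_1f_1=\frac12f_1,\ e_1f_2=f_2,\ e_2f_2=f_1,\ f_1f_2=e_2$; $\mathcal J_{64}$: $e_1^2=e_1,\ e_1e_2=\frac12e_2,\ e_1f_1=\frac12f_1,\ e_1f_2=f_2,\ e_2f_1=f_2,\ f_1f_2=e_2$; $\mathcal J_{65}$: $e_1^2=e_1,\ e_1e_2=\frac12e_2,\ e_1f_1=f_1,\ e_1f_2=f_2$.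
   Context: All vector spaces are over $\mathbb C$. A superalgebra is a $\mathbb Z_2$-graded algebra $\mathfrak J=\mathfrak J_0\oplus\mathfrak J_1$ with $\mathfrak J_i\mathfrak J_j\subseteq\mathfrak J_{i+j}$; its type is $(\dim\mathfrak J_0,\dim\mathfrak J_1)$; $|x|=i$ for $x\in\mathfrak J_i$. It is a Jordan superalgebra if for all homogeneous $x,y,z,t$: $xy=(-1)^{|x||y|}yx$ and $$((xy)z)t+(-1)^{|y||z|+|y||t|+|z||t|}((xt)z)y+(-1)^{|x||y|+|x||z|+|x||t|+|z||t|}((yt)z)x=(xy)(zt)+(-1)^{|t|(|y|+|z|)}(xt)(yz)+(-1)^{|y||z|}(xz)(yt).$$ Multiplication tables list only nonzero products of basis vectors, up to supercommutativity ($e_i$, $e$ denote even and $f_j$, $f$ odd basis vectors; so $e_if_j=f_je_i$, $e_ie_j=e_je_i$, $f_if_j=-f_jf_i$); all unlisted products are zero. Variety: fix a superspace $V=V_0\oplus V_1$ with $\dim V_0=m$, $\dim V_1=n$. The set $\mathcal{JS}^{m,n}$ of all grading-preserving multiplications $\mu:V\otimes V\to V$ that make $V$ a Jordan superalgebra is a Zariski-closed subset of the affine space (of dimension $m^3+3mn^2$) of structure constants of grading-preserving bilinear multiplications. The group $G=GL(V_0)\times GL(V_1)$ of grading-preserving linear automorphisms acts by $(g*\mu)(x\otimes y)=g\mu(g^{-1}x\otimes g^{-1}y)$; orbits correspond to isomorphism classes. $O(\mathcal J)$ denotes the orbit of a multiplication representing $\mathcal J$ and $\overline{O(\mathcal J)}$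 its Zariski closure. $\mathcal J$ is rigid if $O(\mathcal J)$ is open in $\mathcal{JS}^{m,n}$. An irreducible component is a maximal irreducible closed subset. Dimension convention of the paper: the dimension of an orbit is taken to be $\dim O(\mathcal J)=(m+n)^2-\dim \mathfrak{Der}(\mathcal J)$, where $\mathfrak{Der}(\mathcal J)$ is the span of all even and odd superderivations, i.e. homogeneous linear maps $D$ with $D(xy)=D(x)y+(-1)^{|D||x|}xD(y)$; the dimension of the variety is the maximum of the dimensions of its components computed from these orbit dimensions (a component given by a one-parameter family having dimension one more than that of its generic orbit). *)

(* Defs.v *)
(* The field of complex numbers is R[i], for R : realType. *)
From HB Require Import structures.
From mathcomp Require Import all_boot all_order all_algebra.
From mathcomp Require Import boolp classical_sets cardinality reals.
From mathcomp Require Import topology_structure.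
From mathcomp Require Import complex mpoly.
Set Implicit Arguments.
Unset Strict Implicit.
Unset Printing Implicit Defensive.
Import GRing.Theory.
Local Open Scope classical_set_scope.
Local Open Scope ring_scope.

Definition affine (K : fieldType) (I : finType) : Type := {ffun I -> K}.

HB.instance Definition _ (K : fieldType) (I : finType) :=
  Choice.on (affine K I).

Section Zariski.
Variables (K : fieldType) (I : finType).
Implicit Types (x : affine K I) (A B : set (affine K I)).

Definition zeval (p : {mpoly K[#|I|]}) x : K := p.@[fun k => x (enum_val k)].

Definition zeros (S : set {mpoly K[#|I|]}) : set (affine K I) :=
  [set x | forall p, S p -> zeval p x = 0].

Definition zopen : set_system (affine K I) :=
  [set A | exists S, ~` A = zeros S].

Lemma zopenT : zopen setT.
Proof.
exists setT; rewrite setCT; apply/seteqP; split=> x //= /(_ 1 Logic.I).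
by rewrite /zeval meval1 => /eqP; rewrite oner_eq0.
Qed.

Lemma zopenI : setI_closed zopen.
Proof.
move=> A B [S AS] [T BT].
exists [set p | exists p1 p2, [/\ S p1, T p2 & p = p1 * p2]].
rewrite setCI AS BT; apply/seteqP; split=> x /=.
  move=> xST _ [p1 [p2 [Sp1 Tp2 ->]]]; rewrite /zeval mevalM.
  by case: xST => [/(_ _ Sp1)|/(_ _ Tp2)]; rewrite /zeval => ->;
     rewrite ?mul0r ?mulr0.
move=> xST; have [Sx|] := pselect (zeros S x); [by left|right=> p2 Tp2].
have [p1 /not_implyP[Sp1 /eqP p1x]] : exists p, ~ (S p -> zeval p x = 0).
  exact/existsNP.
have /xST : exists q1 q2, [/\ S q1, T q2 & p1 * p2 = q1 * q2].
  by exists p1, p2.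
by rewrite /zeval mevalM => /eqP; rewrite mulf_eq0 (negbTE p1x) => /eqP.
Qed.

Lemma zopen_bigU (J : Type) (f : J -> set (affine K I)) :
  (forall j, zopen (f j)) -> zopen (\bigcup_j f j).
Proof.
move=> /choice[S fS]; exists (\bigcup_j S j).
rewrite setC_bigcup; apply/seteqP; split=> x xS.
  by move=> p [j _ Sp]; have := xS j Logic.I; rewrite fS; apply.
by move=> j _; rewrite fS => p Sp; apply: xS; exists j.
Qed.

HB.instance Definition _ :=
  isOpenTopological.Build (affine K I) zopenT zopenI zopen_bigU.

Lemma zariski_closedE A : closed A <-> exists S, A = zeros S.
Proof.
by rewrite -openC; split=> -[S]; rewrite ?setCK => AS; exists S; rewrite ?setCK.
Qed.

End Zariski.

Definition irreducible (T : topologicalType) (Z : set T) : Prop :=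
  Z !=set0 /\
  forall A B, closed A -> closed B -> Z `<=` A `|` B -> Z `<=` A \/ Z `<=` B.

(* For closed X: the maximal irreducible closed subsets of X. *)
Definition irreducible_component (T : topologicalType) (X Z : set T) : Prop :=
  [/\ Z `<=` X, closed Z, irreducible Z &
      forall Y, Y `<=` X -> closed Y -> irreducible Y -> Z `<=` Y -> Y = Z].

Definition span_of (K : fieldType) (V : vectType K) (S : set V) : {vspace V} :=
  xget 0%VS [set U | forall W : {vspace V},
                       (U <= W)%VS <-> forall v, S v -> v \in W].

Lemma span_ofP (K : fieldType) (V : vectType K) (S : set V) (W : {vspace V}) :
  (span_of S <= W)%VS <-> forall v, S v -> v \in W.
Proof.
move: W; rewrite /span_of; case: xgetP => [U _ //|/= noU].
pose P k := `[< exists2 s : seq V,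
                  forall v, v \in s -> S v & \dim <<s>>%VS = k >].
have exP : exists k, P k.
  by exists (\dim <<[::] : seq V>>%VS); apply/asboolP; exists [::].
have ubP k : P k -> (k <= \dim {:V})%N.
  by move=> /asboolP[s _ <-]; exact: dimvS (subvf _).
case: (ex_maxnP exP ubP) => k /asboolP[s sS <-] smax.
exfalso; apply: (noU <<s>>%VS) => W; split=> [sW v Sv|SW]; last first.
  by apply/span_subvP => v /sS /SW.
apply: (subvP sW).
have le_s : (<<s>> <= <<v :: s>>)%VS by rewrite span_cons addvSr.
have : (\dim <<v :: s>> <= \dim <<s>>)%N.
  apply: smax; apply/asboolP; exists (v :: s) => // w.
  by rewrite inE => /predU1P[->|/sS].
rewrite (geq_leqif (dimv_leqif_eq le_s)) => /eqP ->.
by rewrite memv_span // mem_head.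
Qed.

(* The superspace is the space of columns of height m + n; the first m basis
   vectors span the even part, the last n ones the odd part. *)
Definition par (m n : nat) (k : 'I_(m + n)) : bool := (m <= k)%N.

(* The triples (i, j, k) such that e_k may occur in e_i e_j. *)
Definition gidx (m n : nat) : finType :=
  {t : 'I_(m + n) * 'I_(m + n) * 'I_(m + n) |
     par t.1.1 (+) par t.1.2 == par t.2}.

Section Superalgebra.
Variables (R : realType) (m n : nat).

Local Notation C := R[i].
Local Notation V := 'cV[C]_(m + n).

Definition homogeneous (a : bool) (x : V) : Prop :=
  forall k, par k != a -> x k 0 = 0.

Definition bvec (k : 'I_(m + n)) : V := delta_mx k 0.

(* Structure constants of the grading-preserving multiplications. *)
Definition sconst : topologicalType := affine C (gidx m n).

Definition smul (c : sconst) (x y : V) : V :=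
  \sum_(t : gidx m n)
    (c t * x (val t).1.1 0 * y (val t).1.2 0) *: bvec (val t).2.

Definition sconst_of (mu : V -> V -> V) : sconst :=
  [ffun t : gidx m n =>
     mu (bvec (val t).1.1) (bvec (val t).1.2) (val t).2 0].

Lemma smulK (c : sconst) : sconst_of (smul c) = c.
Proof.
apply/ffunP => t; rewrite ffunE /smul summxE (bigD1 t) //= big1 ?addr0.
  by rewrite /bvec !mxE !eqxx /= !mulr1.
case: t => [[[a b] d] pt] [[[a' b'] d'] pu] Nu; rewrite /bvec !mxE /= !andbT.
have {}Nu : (a', b', d') != (a, b, d).
  by apply: contra Nu => /eqP E; apply/eqP/val_inj.
have [E1|N] := eqVneq a' a; last by rewrite mulr0 !mul0r.
have [E2|N] := eqVneq b' b; last by rewrite mulr0 !mul0r.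
have [E3|N] := eqVneq d d'; last by rewrite mulr0.
by rewrite E1 E2 E3 eqxx in Nu.
Qed.

Definition jordan (c : sconst) : Prop :=
  let mu := smul c in
  (forall (a b : bool) (x y : V), homogeneous a x -> homogeneous b y ->
     mu x y = (-1) ^+ (a * b) *: mu y x) /\
  (forall (a b g d : bool) (x y z t : V),
     homogeneous a x -> homogeneous b y -> homogeneous g z -> homogeneous d t ->
     mu (mu (mu x y) z) t
     + (-1) ^+ (b * g + b * d + g * d) *: mu (mu (mu x t) z) y
     + (-1) ^+ (a * b + a * g + a * d + g * d) *: mu (mu (mu y t) z) x
     = mu (mu x y) (mu z t)
       + (-1) ^+ (d * (b + g)) *: mu (mu x t) (mu y z)
       + (-1) ^+ (b * g) *: mu (mu x z) (mu y t)).

Definition JS : set sconst := [set c | jordan c].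

Definition Gact (g : 'M[C]_(m + n)) (c : sconst) : sconst :=
  sconst_of (fun x y => g *m smul c (invmx g *m x) (invmx g *m y)).

Definition Gorbit (c : sconst) : set sconst :=
  [set c' | exists (g0 : 'M[C]_m) (g1 : 'M[C]_n),
     [/\ g0 \in unitmx, g1 \in unitmx & c' = Gact (block_mx g0 0 0 g1) c]].

(* The orbit is open in the topology induced on JS. *)
Definition rigid (c : sconst) : Prop :=
  exists2 U : set sconst, open U & Gorbit c = JS `&` U.

Definition superderivation (c : sconst) (a : bool) (D : 'M[C]_(m + n)) : Prop :=
  (forall b x, homogeneous b x -> homogeneous (a (+) b) (D *m x)) /\
  (forall (b : bool) x y, homogeneous b x ->
     D *m smul c x y =
     smul c (D *m x) y + (-1) ^+ (a * b) *: smul c x (D *m y)).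

Definition Der (c : sconst) : {vspace 'M[C]_(m + n)} :=
  span_of [set D | exists a, superderivation c a D].

(* This is not the dimension of the orbit as a variety: the subtracted
   dimension includes the odd superderivations. *)
Definition orbit_dim (c : sconst) : nat := ((m + n) ^ 2 - \dim (Der c))%N.

Definition poly_family (p : gidx m n -> {poly C}) (t : C) : sconst :=
  [ffun i => (p i).[t]].

(* Either Z is the closure of an orbit, and has the dimension of that orbit,
   or Z is only the closure of a one-parameter algebraic family of orbits, and
   has one more than the dimension of the orbit of a generic member. *)
Definition component_dim (Z : set sconst) (d : nat) : Prop :=
  (exists2 c, Z = closure (Gorbit c) & orbit_dim c = d) \/
  (~ (exists c, Z = closure (Gorbit c)) /\
   exists2 p, Z = closure (\bigcup_t Gorbit (poly_family p t)) &
     finite_set [set t | (orbit_dim (poly_family p t)).+1 <> d]).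

(* d is the maximum of the dimensions of the components of X. *)
Definition variety_dim (X : set sconst) (d : nat) : Prop :=
  [/\ forall Z, irreducible_component X Z -> exists e, component_dim Z e,
      exists2 Z, irreducible_component X Z & component_dim Z d &
      forall Z e, irreducible_component X Z -> component_dim Z e -> (e <= d)%N].

(* Completes a list of products e_i e_j = v by supercommutativity, the
   unlisted products being zero; i and j are not to be listed in both orders. *)
Definition table (s : seq ('I_(m + n) * 'I_(m + n) * V)) : sconst :=
  [ffun t : gidx m n => let: (i, j, k) := val t in
     (\sum_(p <- s | p.1 == (i, j)) p.2
      + \sum_(p <- s | (i != j) && (p.1 == (j, i)))
          (-1) ^+ (par i * par j) *: p.2) k 0].

End Superalgebra.

Arguments JS : clear implicits.

Section Tables.
Variable R : realType.

Local Notation e1 := (lshift 2 (0 : 'I_2)).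
Local Notation e2 := (lshift 2 (1 : 'I_2)).
Local Notation f1 := (rshift 2 (0 : 'I_2)).
Local Notation f2 := (rshift 2 (1 : 'I_2)).
Local Notation v := (@bvec R 2 2).
Local Notation h k := (2^-1 *: v k).

Local Notation "x ** y ~> w" := (x, y, w) (at level 70, y at next level).

Definition J1 := table [:: e1 ** e1 ~> v e1; e2 ** e2 ~> v e2].
Definition J2 := table [:: e1 ** e1 ~> v e1; e2 ** e2 ~> v e2;
  e2 ** f2 ~> v f2].
Definition J3 := table [:: e1 ** e1 ~> v e1; e2 ** e2 ~> v e2;
  e2 ** f2 ~> h f2].
Definition J5 := table [:: e1 ** e1 ~> v e1; e2 ** e2 ~> v e2;
  e2 ** f1 ~> v f1; e2 ** f2 ~> h f2].
Definition J6 := table [:: e1 ** e1 ~> v e1; e2 ** e2 ~> v e2;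
  e2 ** f1 ~> v f1; e2 ** f2 ~> v f2; f1 ** f2 ~> v e2].
Definition J8 := table [:: e1 ** e1 ~> v e1; e2 ** e2 ~> v e2;
  e2 ** f1 ~> h f1; e2 ** f2 ~> h f2; f1 ** f2 ~> v e2].
Definition J9 := table [:: e1 ** e1 ~> v e1; e2 ** e2 ~> v e2;
  e1 ** f2 ~> h f2; e2 ** f2 ~> h f2].
Definition J10 := table [:: e1 ** e1 ~> v e1; e2 ** e2 ~> v e2;
  e1 ** f2 ~> h f2; e2 ** f1 ~> v f1].
Definition J11 := table [:: e1 ** e1 ~> v e1; e2 ** e2 ~> v e2;
  e1 ** f2 ~> h f2; e2 ** f1 ~> v f1; e2 ** f2 ~> h f2].
Definition J12 := table [:: e1 ** e1 ~> v e1; e2 ** e2 ~> v e2;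
  e1 ** f2 ~> h f2; e2 ** f1 ~> h f1].
Definition J13 := table [:: e1 ** e1 ~> v e1; e2 ** e2 ~> v e2;
  e1 ** f2 ~> h f2; e2 ** f1 ~> h f1; e2 ** f2 ~> h f2].
Definition J14 := table [:: e1 ** e1 ~> v e1; e2 ** e2 ~> v e2;
  e1 ** f2 ~> v f2; e2 ** f1 ~> v f1].
Definition J16 (t : R[i]) := table [:: e1 ** e1 ~> v e1; e2 ** e2 ~> v e2;
  e1 ** f1 ~> h f1; e1 ** f2 ~> h f2; e2 ** f1 ~> h f1; e2 ** f2 ~> h f2;
  f1 ** f2 ~> v e1 + t *: v e2].
Definition J24 := table [:: e1 ** e1 ~> v e1;
  e2 ** f1 ~> v f2; f1 ** f2 ~> v e2].
Definition J32 := table [:: e1 ** e1 ~> v e1;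
  e1 ** f1 ~> h f1; e1 ** f2 ~> h f2; e2 ** f1 ~> v f2; f1 ** f2 ~> v e2].
Definition J42 := table [:: e1 ** e1 ~> v e1; e1 ** e2 ~> v e2;
  e1 ** f1 ~> h f1; e1 ** f2 ~> h f2; e2 ** f1 ~> v f2; f1 ** f2 ~> v e2].
Definition J49 := table [:: e1 ** e1 ~> v e1; e1 ** e2 ~> v e2;
  e1 ** f1 ~> v f1; e1 ** f2 ~> v f2; e2 ** f1 ~> v f2; f1 ** f2 ~> v e2].
Definition J50 := table [:: e1 ** e1 ~> v e1; e1 ** e2 ~> h e2].
Definition J54 := table [:: e1 ** e1 ~> v e1; e1 ** e2 ~> h e2;
  e1 ** f2 ~> h f2; e2 ** f2 ~> v f1; f1 ** f2 ~> v e2].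
Definition J56 := table [:: e1 ** e1 ~> v e1; e1 ** e2 ~> h e2;
  e1 ** f2 ~> h f2; e2 ** f1 ~> v f2; f1 ** f2 ~> v e2].
Definition J57 := table [:: e1 ** e1 ~> v e1; e1 ** e2 ~> h e2;
  e1 ** f2 ~> v f2].
Definition J58 := table [:: e1 ** e1 ~> v e1; e1 ** e2 ~> h e2;
  e1 ** f1 ~> h f1; e1 ** f2 ~> h f2].
Definition J62 := table [:: e1 ** e1 ~> v e1; e1 ** e2 ~> h e2;
  e1 ** f1 ~> h f1; e1 ** f2 ~> v f2; e2 ** f2 ~> v f1; f1 ** f2 ~> v e2].
Definition J64 := table [:: e1 ** e1 ~> v e1; e1 ** e2 ~> h e2;
  e1 ** f1 ~> h f1; e1 ** f2 ~> v f2; e2 ** f1 ~> v f2; f1 ** f2 ~> v e2].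
Definition J65 := table [:: e1 ** e1 ~> v e1; e1 ** e2 ~> h e2;
  e1 ** f1 ~> v f1; e1 ** f2 ~> v f2].

Definition rigid_list : seq (sconst R 2 2) :=
  [:: J1; J2; J3; J5; J6; J8; J9; J10; J11; J12; J13; J14; J24; J32; J42; J49;
      J50; J54; J56; J57; J58; J62; J64; J65].

End Tables.

(* Main.v *)
Require Import Defs.
From HB Require Import structures.
From mathcomp Require Import all_boot all_order all_algebra.
From mathcomp Require Import boolp classical_sets cardinality reals.
From mathcomp Require Import topology_structure complex.
From mathcomp Require Import mpoly ring.
Set Implicit Arguments.
Unset Strict Implicit.
Unset Printing Implicit Defensive.
Import GRing.Theory.
Import Num.Theory.
Local Open Scope ring_scope.

(* In coordinates, a supercommutative multiplication on C^(2|2) is a table of 16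
   scalars. To each listed superalgebra J_i (the family J_16 counting for one) we
   attach a G-invariant Zariski open set U_i, given by the non-vanishing of
   polynomial invariants (traces of products of multiplication operators), which
   contains J_i and none of the other listed superalgebras. Reducing the even part
   to one of its six normal forms and then diagonalizing or triangularizing its
   action on the odd part, one checks that every Jordan table is a limit along
   polynomial curves of listed ones, and that it lies in U_i only if it is
   isomorphic to J_i. Hence the orbit of J_i is the intersection of JS with U_i,
   and the closures of these irreducible pairwise disjoint relatively open sets,
   which cover JS, are its components. As for dimensions, each J_i has at least
   three independent superderivations, J_2 has exactly three, and J_16^t has five
   for all t. *)

(** * Tables of supercommutative multiplications *)

(** Jordan tables are never classified up to isomorphism; only the listed ones are recognised. The
    reduction carries one property, [good], stable under change of basis, which combines being a
    limit of listed tables with satisfying an open condition only inside the matching stratum. On a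
    degenerate table every open condition fails, so a curve ending there is all that is required,
    whatever the isomorphism class. The invariants are only relative, scaling with the change of
    basis, so the conditions compare ratios; asking a ratio to avoid the values of the other strata,
    instead of having a given value, is what makes them open. Since the tables have entries 0, 1/2
    and 1, doubling makes them integral: the Jordan identities and the required superderivations are
    then verified by evaluation. [component_dim] is a relation, so the bound 13 has to hold for
    every orbit or family with the given closure; openness of the strata forces such an orbit or
    family to enter the right stratum. Whether the closure of the family of [J16] is also the
    closure of one orbit is left undecided, both answers giving less than 13. *)

(* e_0, e_1 are even and f_0, f_1 odd: ca, cb, cc are the coordinates of
   e_0^2, e_0 e_1, e_1^2, cx and cy the matrices of e_0 and e_1 on the odd part,
   and cp the coordinates of f_0 f_1. *)
Record tab (K : Type) := Tab {
  ca0 : K; ca1 : K; cb0 : K; cb1 : K; cc0 : K; cc1 : K;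
  cx00 : K; cx01 : K; cx10 : K; cx11 : K;
  cy00 : K; cy01 : K; cy10 : K; cy11 : K;
  cp0 : K; cp1 : K }.

Record vec (K : Type) := V4 { v0 : K; v1 : K; v2 : K; v3 : K }.
Record mat (K : Type) := M2 { m00 : K; m01 : K; m10 : K; m11 : K }.

Lemma V4_eq K (a b c d a' b' c' d' : K) :
  a = a' -> b = b' -> c = c' -> d = d' -> V4 a b c d = V4 a' b' c' d'.
Proof. by move=> -> -> -> ->. Qed.

Lemma M2_eq K (a b c d a' b' c' d' : K) :
  a = a' -> b = b' -> c = c' -> d = d' -> M2 a b c d = M2 a' b' c' d'.
Proof. by move=> -> -> -> ->. Qed.

Section Multiplication.
Variable K : comPzRingType.
Implicit Types (w : tab K) (x y : vec K) (A B G H : mat K).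

Definition ev0 w r0 r1 s0 s1 :=
  ca0 w * (r0 * s0) + cb0 w * (r0 * s1 + r1 * s0) + cc0 w * (r1 * s1).
Definition ev1 w r0 r1 s0 s1 :=
  ca1 w * (r0 * s0) + cb1 w * (r0 * s1 + r1 * s0) + cc1 w * (r1 * s1).
Definition od0 w r0 r1 s2 s3 :=
  cx00 w * (r0 * s2) + cx01 w * (r0 * s3) + cy00 w * (r1 * s2)
  + cy01 w * (r1 * s3).
Definition od1 w r0 r1 s2 s3 :=
  cx10 w * (r0 * s2) + cx11 w * (r0 * s3) + cy10 w * (r1 * s2)
  + cy11 w * (r1 * s3).

Definition mul w x y : vec K :=
  let: V4 r0 r1 r2 r3 := x in let: V4 s0 s1 s2 s3 := y in
  V4 (ev0 w r0 r1 s0 s1 + cp0 w * (r2 * s3 - r3 * s2))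
     (ev1 w r0 r1 s0 s1 + cp1 w * (r2 * s3 - r3 * s2))
     (od0 w r0 r1 s2 s3 + od0 w s0 s1 r2 r3)
     (od1 w r0 r1 s2 s3 + od1 w s0 s1 r2 r3).

Definition vadd x y :=
  let: V4 r0 r1 r2 r3 := x in let: V4 s0 s1 s2 s3 := y in
  V4 (r0 + s0) (r1 + s1) (r2 + s2) (r3 + s3).
Definition vscale k x :=
  let: V4 r0 r1 r2 r3 := x in V4 (k * r0) (k * r1) (k * r2) (k * r3).
Definition vhom (a : bool) (r s : K) := if a then V4 0 0 r s else V4 r s 0 0.

Definition jordan_lhs w (a b g d : bool) x y z t :=
  let m := mul w in
  vadd (vadd (m (m (m x y) z) t)
    (vscale ((-1) ^+ (b * g + b * d + g * d)) (m (m (m x t) z) y)))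
    (vscale ((-1) ^+ (a * b + a * g + a * d + g * d)) (m (m (m y t) z) x)).

Definition jordan_rhs w (a b g d : bool) x y z t :=
  let m := mul w in
  vadd (vadd (m (m x y) (m z t))
    (vscale ((-1) ^+ (d * (b + g))) (m (m x t) (m y z))))
    (vscale ((-1) ^+ (b * g)) (m (m x z) (m y t))).

Definition qjordan w :=
  forall (a b g d : bool) r0 s0 r1 s1 r2 s2 r3 s3,
  let x := vhom a r0 s0 in let y := vhom b r1 s1 in
  let z := vhom g r2 s2 in let t := vhom d r3 s3 in
  jordan_lhs w a b g d x y z t = jordan_rhs w a b g d x y z t.

Definition mmul A B :=
  let: M2 a b c d := A in let: M2 a' b' c' d' := B in
  M2 (a * a' + b * c') (a * b' + b * d') (c * a' + d * c') (c * b' + d * d').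
Definition mdet A := let: M2 a b c d := A in a * d - b * c.
Definition mtr A := let: M2 a b c d := A in a + d.
Definition madd A B :=
  let: M2 a b c d := A in let: M2 a' b' c' d' := B in
  M2 (a + a') (b + b') (c + c') (d + d').
Definition mscale k A := let: M2 a b c d := A in M2 (k * a) (k * b) (k * c) (k * d).

Definition ap G H x :=
  let: V4 r0 r1 r2 r3 := x in
  V4 (m00 G * r0 + m01 G * r1) (m10 G * r0 + m11 G * r1)
     (m00 H * r2 + m01 H * r3) (m10 H * r2 + m11 H * r3).

Lemma ap_mmul G H G' H' x : ap G H (ap G' H' x) = ap (mmul G G') (mmul H H') x.
Proof.
by case: G G' H H' x => ? ? ? ? [? ? ? ?] [? ? ? ?] [? ? ? ?] [? ? ? ?];
  apply: V4_eq => /=; ring.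
Qed.

Lemma mdetM A B : mdet (mmul A B) = mdet A * mdet B.
Proof. by case: A B => ? ? ? ? [? ? ? ?] /=; ring. Qed.

End Multiplication.

Section Isomorphism.
Variable K : fieldType.
Implicit Types (w : tab K) (x y : vec K) (A B G H : mat K).

(* w' is the table of w in the basis given by the columns of G and H. *)
Definition iso w w' := exists G H,
  [/\ mdet G != 0, mdet H != 0 &
      forall x y, mul w (ap G H x) (ap G H y) = ap G H (mul w' x y)].

Lemma iso_refl w : iso w w.
Proof.
have ap1 x : ap (M2 1 0 0 1) (M2 1 0 0 1) x = x.
  by case: x => *; apply: V4_eq => /=; ring.
exists (M2 1 0 0 1), (M2 1 0 0 1); rewrite /= !mulr1 mulr0 subr0 oner_eq0.
by split=> // x y; rewrite !ap1.
Qed.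

Lemma iso_trans w w' w'' : iso w w' -> iso w' w'' -> iso w w''.
Proof.
move=> [G [H [G0 H0 GH]]] [G' [H' [G'0 H'0 GH']]].
exists (mmul G G'), (mmul H H'); rewrite !mdetM !mulf_neq0 //; split=> // x y.
by rewrite -!ap_mmul GH GH'.
Qed.

Definition iso_eqs w w' G H :=
  let: M2 g00 g01 g10 g11 := G in let: M2 h00 h01 h10 h11 := H in
  [/\ (ev0 w g00 g10 g00 g10 = g00 * ca0 w' + g01 * ca1 w') /\
      (ev1 w g00 g10 g00 g10 = g10 * ca0 w' + g11 * ca1 w'),
      (ev0 w g00 g10 g01 g11 = g00 * cb0 w' + g01 * cb1 w') /\
      (ev1 w g00 g10 g01 g11 = g10 * cb0 w' + g11 * cb1 w') &
      (ev0 w g01 g11 g01 g11 = g00 * cc0 w' + g01 * cc1 w') /\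
      (ev1 w g01 g11 g01 g11 = g10 * cc0 w' + g11 * cc1 w')] /\
  [/\ (od0 w g00 g10 h00 h10 = h00 * cx00 w' + h01 * cx10 w') /\
      (od1 w g00 g10 h00 h10 = h10 * cx00 w' + h11 * cx10 w'),
      (od0 w g00 g10 h01 h11 = h00 * cx01 w' + h01 * cx11 w') /\
      (od1 w g00 g10 h01 h11 = h10 * cx01 w' + h11 * cx11 w'),
      (od0 w g01 g11 h00 h10 = h00 * cy00 w' + h01 * cy10 w') /\
      (od1 w g01 g11 h00 h10 = h10 * cy00 w' + h11 * cy10 w'),
      (od0 w g01 g11 h01 h11 = h00 * cy01 w' + h01 * cy11 w') /\
      (od1 w g01 g11 h01 h11 = h10 * cy01 w' + h11 * cy11 w') &
      (cp0 w * (h00 * h11 - h10 * h01) = g00 * cp0 w' + g01 * cp1 w') /\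
      (cp1 w * (h00 * h11 - h10 * h01) = g10 * cp0 w' + g11 * cp1 w')].

Lemma ev0_bilinear w g00 g01 g10 g11 r0 r1 s0 s1 :
  ev0 w (g00 * r0 + g01 * r1) (g10 * r0 + g11 * r1)
        (g00 * s0 + g01 * s1) (g10 * s0 + g11 * s1)
  = r0 * s0 * ev0 w g00 g10 g00 g10 + (r0 * s1 + r1 * s0) * ev0 w g00 g10 g01 g11
    + r1 * s1 * ev0 w g01 g11 g01 g11.
Proof. by rewrite /ev0; ring. Qed.

Lemma ev1_bilinear w g00 g01 g10 g11 r0 r1 s0 s1 :
  ev1 w (g00 * r0 + g01 * r1) (g10 * r0 + g11 * r1)
        (g00 * s0 + g01 * s1) (g10 * s0 + g11 * s1)
  = r0 * s0 * ev1 w g00 g10 g00 g10 + (r0 * s1 + r1 * s0) * ev1 w g00 g10 g01 g11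
    + r1 * s1 * ev1 w g01 g11 g01 g11.
Proof. by rewrite /ev1; ring. Qed.

Lemma od0_bilinear w g00 g01 g10 g11 h00 h01 h10 h11 r0 r1 s2 s3 :
  od0 w (g00 * r0 + g01 * r1) (g10 * r0 + g11 * r1)
        (h00 * s2 + h01 * s3) (h10 * s2 + h11 * s3)
  = r0 * s2 * od0 w g00 g10 h00 h10 + r0 * s3 * od0 w g00 g10 h01 h11
    + r1 * s2 * od0 w g01 g11 h00 h10 + r1 * s3 * od0 w g01 g11 h01 h11.
Proof. by rewrite /od0; ring. Qed.

Lemma od1_bilinear w g00 g01 g10 g11 h00 h01 h10 h11 r0 r1 s2 s3 :
  od1 w (g00 * r0 + g01 * r1) (g10 * r0 + g11 * r1)
        (h00 * s2 + h01 * s3) (h10 * s2 + h11 * s3)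
  = r0 * s2 * od1 w g00 g10 h00 h10 + r0 * s3 * od1 w g00 g10 h01 h11
    + r1 * s2 * od1 w g01 g11 h00 h10 + r1 * s3 * od1 w g01 g11 h01 h11.
Proof. by rewrite /od1; ring. Qed.

Lemma iso_eqsP w w' G H :
  iso_eqs w w' G H <->
  forall x y, mul w (ap G H x) (ap G H y) = ap G H (mul w' x y).
Proof.
case: G H => [g00 g01 g10 g11] [h00 h01 h10 h11]; split; last first.
  move=> E.
  pose e i : vec K := V4 (i == 0%N)%:R (i == 1%N)%:R (i == 2%N)%:R (i == 3%N)%:R.
  have E0 i j := congr1 (@v0 K) (E (e i) (e j)).
  have E1 i j := congr1 (@v1 K) (E (e i) (e j)).
  have E2 i j := congr1 (@v2 K) (E (e i) (e j)).
  have E3 i j := congr1 (@v3 K) (E (e i) (e j)).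
  have simpl01 := (mulr0, mulr1, mul0r, addr0, add0r, oppr0).
  rewrite /iso_eqs /ev0 /ev1 /od0 /od1.
  split; split.
  - by split; [have := E0 0%N 0%N|have := E1 0%N 0%N];
      rewrite /= /ev0 /ev1 /od0 /od1 !simpl01 => ->.
  - by split; [have := E0 0%N 1%N|have := E1 0%N 1%N];
      rewrite /= /ev0 /ev1 /od0 /od1 !simpl01 => ->.
  - by split; [have := E0 1%N 1%N|have := E1 1%N 1%N];
      rewrite /= /ev0 /ev1 /od0 /od1 !simpl01 => ->.
  - by split; [have := E2 0%N 2%N|have := E3 0%N 2%N];
      rewrite /= /ev0 /ev1 /od0 /od1 !simpl01 => ->.
  - by split; [have := E2 0%N 3%N|have := E3 0%N 3%N];
      rewrite /= /ev0 /ev1 /od0 /od1 !simpl01 => ->.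
  - by split; [have := E2 1%N 2%N|have := E3 1%N 2%N];
      rewrite /= /ev0 /ev1 /od0 /od1 !simpl01 => ->.
  - by split; [have := E2 1%N 3%N|have := E3 1%N 3%N];
      rewrite /= /ev0 /ev1 /od0 /od1 !simpl01 => ->.
  - by split; [have := E0 2%N 3%N|have := E1 2%N 3%N];
      rewrite /= /ev0 /ev1 /od0 /od1 !simpl01 => ->.
move=> [[[E1 E2] [E3 E4] [E5 E6]]].
move=> [[E7 E8] [E9 E10] [E11 E12] [E13 E14] [E15 E16]].
move=> [r0 r1 r2 r3] [s0 s1 s2 s3]; apply: V4_eq => /=.
- rewrite ev0_bilinear E1 E3 E5 /ev0 /ev1.
  transitivity (g00 * (ev0 w' r0 r1 s0 s1) + g01 * (ev1 w' r0 r1 s0 s1)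
     + (cp0 w * (h00 * h11 - h10 * h01)) * (r2 * s3 - r3 * s2)).
    by rewrite /ev0 /ev1; ring.
  by rewrite E15 /ev0 /ev1; ring.
- rewrite ev1_bilinear E2 E4 E6.
  transitivity (g10 * (ev0 w' r0 r1 s0 s1) + g11 * (ev1 w' r0 r1 s0 s1)
     + (cp1 w * (h00 * h11 - h10 * h01)) * (r2 * s3 - r3 * s2)).
    by rewrite /ev0 /ev1; ring.
  by rewrite E16 /ev0 /ev1; ring.
- by rewrite !od0_bilinear E7 E9 E11 E13 /od0 /od1; ring.
- by rewrite !od1_bilinear E8 E10 E12 E14 /od0 /od1; ring.
Qed.

Lemma isoI w w' G H :
  mdet G != 0 -> mdet H != 0 -> iso_eqs w w' G H -> iso w w'.
Proof. by move=> G0 H0 /iso_eqsP E; exists G, H. Qed.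

Lemma isoE w w' : iso w w' ->
  exists G H, [/\ mdet G != 0, mdet H != 0 & iso_eqs w w' G H].
Proof. by move=> [G [H [G0 H0 /iso_eqsP E]]]; exists G, H. Qed.

Lemma iso_jordan w w' : iso w w' -> qjordan w -> qjordan w'.
Proof.
move=> [G [H [G0 H0 E]]] J a b g d r0 s0 r1 s1 r2 s2 r3 s3 x y z t.
have apD u v : ap G H (vadd u v) = vadd (ap G H u) (ap G H v).
  by case: u v => ? ? ? ? [? ? ? ?]; apply: V4_eq => /=; ring.
have apZ k u : ap G H (vscale k u) = vscale k (ap G H u).
  by case: u => ? ? ? ?; apply: V4_eq => /=; ring.
have ap_inj u v : ap G H u = ap G H v -> u = v.
  case: u v {E} => u0 u1 u2 u3 [t0 t1 t2 t3] [].
  case: G H G0 H0 {apD apZ} => g00 g01 g10 g11 [h00 h01 h10 h11] /= G0 H0.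
  move=> e0 e1 e2 e3; apply: V4_eq; [apply: (mulfI G0)|apply: (mulfI G0)|
    apply: (mulfI H0)|apply: (mulfI H0)].
  - transitivity (g11 * (g00 * u0 + g01 * u1) - g01 * (g10 * u0 + g11 * u1)).
      by ring.
    by rewrite e0 e1; ring.
  - transitivity (g00 * (g10 * u0 + g11 * u1) - g10 * (g00 * u0 + g01 * u1)).
      by ring.
    by rewrite e0 e1; ring.
  - transitivity (h11 * (h00 * u2 + h01 * u3) - h01 * (h10 * u2 + h11 * u3)).
      by ring.
    by rewrite e2 e3; ring.
  - transitivity (h00 * (h10 * u2 + h11 * u3) - h10 * (h00 * u2 + h01 * u3)).
      by ring.
    by rewrite e2 e3; ring.
have hom c r s : exists r' s', ap G H (vhom c r s) = vhom c r' s'.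
  case: c; [exists (m00 H * r + m01 H * s), (m10 H * r + m11 H * s)
           |exists (m00 G * r + m01 G * s), (m10 G * r + m11 G * s)];
  by apply: V4_eq => /=; ring.
apply: ap_inj; rewrite /jordan_lhs /jordan_rhs !apD !apZ -!E.
have [? [? ->]] := hom a r0 s0; have [? [? ->]] := hom b r1 s1.
have [? [? ->]] := hom g r2 s2; have [? [? ->]] := hom d r3 s3.
exact: J.
Qed.

End Isomorphism.

(** * The Jordan identity on basis vectors and its verification by evaluation *)

Section Basis.
Variable K : comPzRingType.
Implicit Types (w : tab K) (x y : vec K).

Definition bas (i : nat) : vec K :=
  match i with 0 => V4 1 0 0 0 | 1 => V4 0 1 0 0 | 2 => V4 0 0 1 0 | _ => V4 0 0 0 1 end.
Definition bpar (i : nat) := match i with 0 | 1 => false | _ => true end.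
Definition sgn (b : bool) : K := if b then -1 else 1.

Definition rmul w (j : nat) x : vec K :=
  let: V4 r0 r1 r2 r3 := x in
  match j with
  | 0 => V4 (ca0 w * r0 + cb0 w * r1) (ca1 w * r0 + cb1 w * r1)
            (cx00 w * r2 + cx01 w * r3) (cx10 w * r2 + cx11 w * r3)
  | 1 => V4 (cb0 w * r0 + cc0 w * r1) (cb1 w * r0 + cc1 w * r1)
            (cy00 w * r2 + cy01 w * r3) (cy10 w * r2 + cy11 w * r3)
  | 2 => V4 (- cp0 w * r3) (- cp1 w * r3)
            (cx00 w * r0 + cy00 w * r1) (cx10 w * r0 + cy10 w * r1)
  | _ => V4 (cp0 w * r2) (cp1 w * r2)
            (cx01 w * r0 + cy01 w * r1) (cx11 w * r0 + cy11 w * r1)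
  end.

Lemma mul_bas w j x : mul w x (bas j) = rmul w j x.
Proof.
by case: x => ? ? ? ?; case: j => [|[|[|j]]]; apply: V4_eq;
  rewrite /= /ev0 /ev1 /od0 /od1; ring.
Qed.

(** A form of the identity that evaluates: signs come from boolean operations on the parities
    instead of powers of -1, and products with a basis vector from [rmul]. *)
Definition bas_lhs w (i j k l : nat) : vec K :=
  let: (a, b, g, d) := (bpar i, bpar j, bpar k, bpar l) in
  vadd (vadd (rmul w l (rmul w k (rmul w j (bas i))))
   (vscale (sgn ((b && g) (+) (b && d) (+) (g && d)))
     (rmul w j (rmul w k (rmul w l (bas i))))))
   (vscale (sgn ((a && b) (+) (a && g) (+) (a && d) (+) (g && d)))
     (rmul w i (rmul w k (rmul w l (bas j))))).

Definition bas_rhs w (i j k l : nat) : vec K :=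
  let: (a, b, g, d) := (bpar i, bpar j, bpar k, bpar l) in
  vadd (vadd (mul w (rmul w j (bas i)) (rmul w l (bas k)))
    (vscale (sgn (d && (b (+) g))) (mul w (rmul w l (bas i)) (rmul w k (bas j)))))
    (vscale (sgn (b && g)) (mul w (rmul w k (bas i)) (rmul w l (bas j)))).

Lemma sgnE (b : bool) n : b = odd n -> sgn b = (-1) ^+ n.
Proof. by rewrite -signr_odd => <-; case: b. Qed.

Lemma jordan_basE w i j k l :
  jordan_lhs w (bpar i) (bpar j) (bpar k) (bpar l) (bas i) (bas j) (bas k) (bas l)
    = bas_lhs w i j k l /\
  jordan_rhs w (bpar i) (bpar j) (bpar k) (bpar l) (bas i) (bas j) (bas k) (bas l)
    = bas_rhs w i j k l.
Proof.
rewrite /jordan_lhs /jordan_rhs /bas_lhs /bas_rhs !mul_bas; split; do ?congr (vadd _ _);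
  by congr (vscale _ _); apply/esym/sgnE;
  rewrite ?oddD ?oddM ?oddD; case: (bpar i) (bpar j) (bpar k) (bpar l) => [] [] [] [].
Qed.

Lemma jordan_basis w : qjordan w -> forall i j k l, bas_lhs w i j k l = bas_rhs w i j k l.
Proof.
move=> J i j k l; have [<- <-] := jordan_basE w i j k l.
have bh m : exists r s, bas m = vhom (bpar m) r s.
  by case: m => [|[|[|m]]] /=;
    [exists 1, 0|exists 0, 1|exists 1, 0|exists 0, 1].
have [? [? ->]] := bh i; have [? [? ->]] := bh j; have [? [? ->]] := bh k.
have [? [? ->]] := bh l; exact: J.
Qed.

Lemma eq0_of_eq (t c x y : K) : x = y -> t = c * (x - y) -> t = 0.
Proof. by move=> -> ->; rewrite subrr mulr0. Qed.

End Basis.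

Definition vco (K : Type) (m : nat) (x : vec K) :=
  match m with 0 => v0 x | 1 => v1 x | 2 => v2 x | _ => v3 x end.

(* Proves t = 0 from coordinate m of the Jordan identity of the basis vectors
   of indices i, j, k, l, which is t / c = 0. *)
Tactic Notation "jrel" constr(J) constr(q) uconstr(c) :=
  match q with
  | (?i, ?j, ?k, ?l, ?m) =>
    refine (eq0_of_eq (c := c) (congr1 (vco m) (jordan_basis J i j k l)) _);
    rewrite /= /ev0 /ev1 /od0 /od1 /=; field
  end.

Tactic Notation "jzero" hyp(J) constr(x) constr(q) uconstr(c) :=
  let e := fresh in have e : x = 0; [by jrel J q c|rewrite {}e in J *].

Section Check.
Variable K : comPzRingType.
Implicit Types (w : tab K) (x y z t : vec K).

Let comb (r s : K) x y := vadd (vscale r x) (vscale s y).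

Let mul_combl w r s x x' y : mul w (comb r s x x') y = comb r s (mul w x y) (mul w x' y).
Proof.
by case: x x' y => ? ? ? ? [? ? ? ?] [? ? ? ?]; apply: V4_eq;
  rewrite /= /ev0 /ev1 /od0 /od1 /=; ring.
Qed.

Let mul_combr w r s x y y' : mul w x (comb r s y y') = comb r s (mul w x y) (mul w x y').
Proof.
by case: x y y' => ? ? ? ? [? ? ? ?] [? ? ? ?]; apply: V4_eq;
  rewrite /= /ev0 /ev1 /od0 /od1 /=; ring.
Qed.

Let comb3 r s k l x x' y y' z z' :
  vadd (vadd (comb r s x x') (vscale k (comb r s y y'))) (vscale l (comb r s z z'))
  = comb r s (vadd (vadd x (vscale k y)) (vscale l z))
             (vadd (vadd x' (vscale k y')) (vscale l z')).
Proof.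
by case: x x' y y' z z' => ? ? ? ? [? ? ? ?] [? ? ? ?] [? ? ? ?] [? ? ? ?] [? ? ? ?];
  apply: V4_eq; rewrite /=; ring.
Qed.

(** For fixed parities both sides are linear in each argument, and the homogeneous vectors of parity
    [c] are spanned by the basis vectors of indices [2 c] and [2 c + 1]. *)
Lemma qjordan_basis w :
  (forall i j k l, (i < 4)%N -> (j < 4)%N -> (k < 4)%N -> (l < 4)%N ->
     bas_lhs w i j k l = bas_rhs w i j k l) -> qjordan w.
Proof.
move=> B a b g d r0 s0 r1 s1 r2 s2 r3 s3 x y z t.
have vhE c r s : vhom c r s = comb r s (bas K c.*2) (bas K c.*2.+1).
  by case: c; apply: V4_eq => /=; ring.
have B' i j k l : (i < 4)%N -> (j < 4)%N -> (k < 4)%N -> (l < 4)%N ->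
    bpar i = a -> bpar j = b -> bpar k = g -> bpar l = d ->
    jordan_lhs w a b g d (bas K i) (bas K j) (bas K k) (bas K l)
    = jordan_rhs w a b g d (bas K i) (bas K j) (bas K k) (bas K l).
  move=> i4 j4 k4 l4 <- <- <- <-; have [-> ->] := jordan_basE w i j k l.
  exact: B.
have par0 (c : bool) : ((c.*2 < 4)%N * (c.*2.+1 < 4)%N * (bpar c.*2 = c) * (bpar c.*2.+1 = c))%type.
  by case: c.
pose lin (F G : vec K -> vec K) :=
  forall r s u v, F u = G u -> F v = G v -> F (comb r s u v) = G (comb r s u v).
have linx y' z' t' : lin (fun u => jordan_lhs w a b g d u y' z' t')
                         (fun u => jordan_rhs w a b g d u y' z' t').
  move=> r s u v; rewrite /jordan_lhs /jordan_rhs => Eu Ev.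
  by rewrite !(mul_combl, mul_combr) !comb3 Eu Ev.
have liny x' z' t' : lin (fun u => jordan_lhs w a b g d x' u z' t')
                         (fun u => jordan_rhs w a b g d x' u z' t').
  move=> r s u v; rewrite /jordan_lhs /jordan_rhs => Eu Ev.
  by rewrite !(mul_combl, mul_combr) !comb3 Eu Ev.
have linz x' y' t' : lin (fun u => jordan_lhs w a b g d x' y' u t')
                         (fun u => jordan_rhs w a b g d x' y' u t').
  move=> r s u v; rewrite /jordan_lhs /jordan_rhs => Eu Ev.
  by rewrite !(mul_combl, mul_combr) !comb3 Eu Ev.
have lint x' y' z' : lin (fun u => jordan_lhs w a b g d x' y' z' u)
                         (fun u => jordan_rhs w a b g d x' y' z' u).
  move=> r s u v; rewrite /jordan_lhs /jordan_rhs => Eu Ev.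
  by rewrite !(mul_combl, mul_combr) !comb3 Eu Ev.
rewrite {}/x {}/y {}/z {}/t !vhE.
apply: linx; apply: liny; apply: linz; apply: lint.
all: by apply: B'; rewrite par0.
Qed.

Definition vmap (L : Type) (f : K -> L) x :=
  let: V4 a b c d := x in V4 (f a) (f b) (f c) (f d).
Definition tmap (L : Type) (f : K -> L) w :=
  Tab (f (ca0 w)) (f (ca1 w)) (f (cb0 w)) (f (cb1 w)) (f (cc0 w)) (f (cc1 w))
   (f (cx00 w)) (f (cx01 w)) (f (cx10 w)) (f (cx11 w))
   (f (cy00 w)) (f (cy01 w)) (f (cy10 w)) (f (cy11 w)) (f (cp0 w)) (f (cp1 w)).

End Check.

Section Map.
Variables (R S : comPzRingType) (f : {rmorphism R -> S}).
Implicit Types (W : tab R) (x y : vec R).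

Lemma rmul_map W j x : rmul (tmap f W) j (vmap f x) = vmap f (rmul W j x).
Proof.
by case: x => *; case: j => [|[|[|j]]]; apply: V4_eq => /=;
  rewrite ?(rmorphD, rmorphN, rmorphM, mulNr).
Qed.

Lemma mul_map W x y : mul (tmap f W) (vmap f x) (vmap f y) = vmap f (mul W x y).
Proof.
case: x y => ? ? ? ? [? ? ? ?]; rewrite /mul /=; apply: V4_eq;
  by rewrite /ev0 /ev1 /od0 /od1 /= !(rmorphD, rmorphN, rmorphM).
Qed.

Lemma vadd_map x y : vadd (vmap f x) (vmap f y) = vmap f (vadd x y).
Proof. by case: x y => ? ? ? ? [? ? ? ?]; rewrite /vadd /=; apply: V4_eq; rewrite rmorphD. Qed.

Lemma vscale_map b x : vscale (sgn S b) (vmap f x) = vmap f (vscale (sgn R b) x).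
Proof.
by case: b x => [] [? ? ? ?]; apply: V4_eq;
  rewrite /= ?mulN1r ?mul1r ?rmorphN.
Qed.

Lemma bas_map m : bas S m = vmap f (bas R m).
Proof. by case: m => [|[|[|m]]]; apply: V4_eq; rewrite /= ?rmorph0 ?rmorph1. Qed.

Lemma bas_lhs_map W i j k l : bas_lhs (tmap f W) i j k l = vmap f (bas_lhs W i j k l).
Proof. by rewrite /bas_lhs !bas_map !(rmul_map, mul_map, vscale_map, vadd_map). Qed.

Lemma bas_rhs_map W i j k l : bas_rhs (tmap f W) i j k l = vmap f (bas_rhs W i j k l).
Proof. by rewrite /bas_rhs !bas_map !(rmul_map, mul_map, vscale_map, vadd_map). Qed.

End Map.

Section Integral.
Variable K : numFieldType.
Implicit Types (W : tab int) (x y : vec int).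
Local Notation f := (intr : int -> K).

Definition veq x y := [&& v0 x == v0 y, v1 x == v1 y, v2 x == v2 y & v3 x == v3 y].

Definition jordan_check W :=
  all (fun i => all (fun j => all (fun k => all (fun l =>
    veq (bas_lhs W i j k l) (bas_rhs W i j k l))
  (iota 0 4)) (iota 0 4)) (iota 0 4)) (iota 0 4).

(* Doubling the basis doubles the table. *)
Lemma qjordan_check W (w : tab K) :
  jordan_check W -> tmap f W = tmap (fun c => 2%:R * c) w -> qjordan w.
Proof.
move=> C E; have : iso (tmap f W) w.
  apply: (@isoI _ _ _ (M2 2^-1 0 0 2^-1) (M2 2^-1 0 0 2^-1)).
  - by rewrite /= mulr0 subr0 mulf_neq0 ?invr_eq0 ?pnatr_eq0.
  - by rewrite /= mulr0 subr0 mulf_neq0 ?invr_eq0 ?pnatr_eq0.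
  rewrite E /iso_eqs /ev0 /ev1 /od0 /od1 /=; do 2! split; split; by field.
move/iso_jordan; apply; apply: qjordan_basis => i j k l i4 j4 k4 l4.
have : bas_lhs W i j k l = bas_rhs W i j k l.
  move: C; rewrite /jordan_check => /allP/(_ i); rewrite mem_iota i4 => /(_ isT).
  move=> /allP/(_ j); rewrite mem_iota j4 => /(_ isT).
  move=> /allP/(_ k); rewrite mem_iota k4 => /(_ isT).
  move=> /allP/(_ l); rewrite mem_iota l4 => /(_ isT).
  case: (bas_lhs _ _ _ _ _) (bas_rhs _ _ _ _ _) => ? ? ? ? [? ? ? ?].
  by move=> /and4P[/eqP/= -> /eqP/= -> /eqP/= -> /eqP/= ->].
by move/(congr1 (vmap f)); rewrite -bas_lhs_map -bas_rhs_map.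
Qed.

Lemma Tab_eq (L : Type) (w w' : tab L) :
  ca0 w = ca0 w' -> ca1 w = ca1 w' -> cb0 w = cb0 w' -> cb1 w = cb1 w' -> cc0 w = cc0 w' -> cc1 w = cc1 w' -> cx00 w = cx00 w' -> cx01 w = cx01 w' -> cx10 w = cx10 w' -> cx11 w = cx11 w' -> cy00 w = cy00 w' -> cy01 w = cy01 w' -> cy10 w = cy10 w' -> cy11 w = cy11 w' -> cp0 w = cp0 w' -> cp1 w = cp1 w' ->
  w = w'.
Proof. by case: w w' => [????????????????] [????????????????] /=; do 16! move=> ->. Qed.

Lemma intr_double : [/\ f 0%N = 2 * 0, f 1%N = 2 * 2^-1 & f 2%N = 2 * 1].
Proof. by rewrite mulr0 mulr1 divff // pnatr_eq0. Qed.

End Integral.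

(** * Tables depending affinely on a parameter *)

Section Interpolation.
Variable K : numFieldType.
Implicit Types (W : tab {poly K}) (x y : vec {poly K}).

Definition tev W (t : K) : tab K := tmap (horner^~ t) W.

Let le n (p : {poly K}) := (size p <= n.+1)%N.

Let leD n p q : le n p -> le n q -> le n (p + q).
Proof.
by rewrite /le => p_n q_n; rewrite (leq_trans (size_polyD _ _)) // geq_max p_n.
Qed.

Let leN n p : le n p -> le n (- p).
Proof. by rewrite /le size_polyN. Qed.

Let leM m n p q : le m p -> le n q -> le (m + n) (p * q).
Proof.
rewrite /le => pm qn; apply: leq_trans (size_polyMleq _ _) _.
by rewrite -subn1 leq_subLR (leq_trans (leq_add pm qn)) // addSn addnS add1n.
Qed.

Definition affine_tab W :=
  [/\ [/\ le 1 (ca0 W), le 1 (ca1 W), le 1 (cb0 W) & le 1 (cb1 W)],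
      [/\ le 1 (cc0 W), le 1 (cc1 W), le 1 (cp0 W) & le 1 (cp1 W)],
      [/\ le 1 (cx00 W), le 1 (cx01 W), le 1 (cx10 W) & le 1 (cx11 W)]
    & [/\ le 1 (cy00 W), le 1 (cy01 W), le 1 (cy10 W) & le 1 (cy11 W)]].

Let vle n x := [/\ le n (v0 x), le n (v1 x), le n (v2 x) & le n (v3 x)].

Let vle_rmul W j n x : affine_tab W -> vle n x -> vle n.+1 (rmul W j x).
Proof.
case: x => ? ? ? ? [[? ? ? ?] [? ? ? ?] [? ? ? ?] [? ? ? ?]] [/= ? ? ? ?].
rewrite -add1n; case: j => [|[|[|j]]]; split; rewrite /=.
all: repeat first [by apply: leM | by apply: leM => //; apply: leN | apply: leD].
Qed.

Let vle_mul W m n x y : affine_tab W -> vle m x -> vle n y -> vle (m + n).+1 (mul W x y).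
Proof.
case: x y => ? ? ? ? [? ? ? ?] [[? ? ? ?] [? ? ? ?] [? ? ? ?] [? ? ? ?]].
move=> [/= ? ? ? ?] [/= ? ? ? ?].
rewrite -add1n /mul /ev0 /ev1 /od0 /od1; split=> /=.
all: do ! [apply: leD | apply: leN]; apply: leM => //.
all: do ! [exact: leM | by rewrite addnC; exact: leM | apply: leD | apply: leN].
Qed.

Let vle_vadd n x y : vle n x -> vle n y -> vle n (vadd x y).
Proof.
by case: x y => ? ? ? ? [? ? ? ?] [/= ? ? ? ?] [/= ? ? ? ?]; split; exact: leD.
Qed.

Let vle_sgn n b x : vle n x -> vle n (vscale (sgn _ b) x).
Proof.
by case: b x => [] [? ? ? ?] [/= ? ? ? ?]; split; rewrite /= ?mulN1r ?mul1r //;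
  exact: leN.
Qed.

Let vle_bas i : vle 0 (bas _ i).
Proof. by case: i => [|[|[|i]]]; split; rewrite /le /= ?size_poly0 ?size_poly1. Qed.

(* The Jordan identities of a table affine in t are cubic in t. *)
Lemma qjordan_affine W t : affine_tab W ->
  (forall n : nat, (n < 4)%N -> qjordan (tev W n%:R)) -> qjordan (tev W t).
Proof.
move=> aW J; apply: qjordan_basis => i j k l _ _ _ _.
have L : vle 3 (bas_lhs W i j k l).
  rewrite /bas_lhs; do ! apply: vle_vadd; do ? apply: vle_sgn;
  by do ! apply: vle_rmul => //; exact: vle_bas.
have R : vle 3 (bas_rhs W i j k l).
  rewrite /bas_rhs; do ! apply: vle_vadd; do ? apply: vle_sgn;
  by apply: (@vle_mul _ 1 1) => //; apply: vle_rmul => //; exact: vle_bas.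
have E p q : le 3 p -> le 3 q -> (forall n : nat, (n < 4)%N -> p.[n%:R] = q.[n%:R]) -> p = q.
  move=> p3 q3 pq; apply/eqP; rewrite -subr_eq0; apply/negPn/negP => pq0.
  have := @max_poly_roots _ _ [seq n%:R | n <- iota 0 4] pq0.
  rewrite size_map size_iota => H; have : (4 < size (p - q)%R)%N.
    apply: H; first by apply/allP => _ /mapP[n + ->]; rewrite mem_iota => /pq pqn;
      rewrite rootE hornerD hornerN pqn subrr.
    by rewrite map_inj_uniq ?iota_uniq // => m n /eqP; rewrite eqr_nat => /eqP.
  by rewrite ltnNge; move/negP; apply; exact: leD p3 (leN q3).
rewrite /tev (bas_lhs_map (horner_eval t)) (bas_rhs_map (horner_eval t)); congr vmap.
have {}J n : (n < 4)%N -> vmap (horner_eval n%:R) (bas_lhs W i j k l)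
                          = vmap (horner_eval n%:R) (bas_rhs W i j k l).
  by move=> /J/jordan_basis/(_ i j k l); rewrite -bas_lhs_map -bas_rhs_map.
move: L R J; case: (bas_lhs _ _ _ _ _) (bas_rhs _ _ _ _ _) => ? ? ? ? [? ? ? ?].
move=> [/= ? ? ? ?] [/= ? ? ? ?] J.
by apply: V4_eq; apply: E => // n /J[].
Qed.

End Interpolation.

(** * Open conditions separating the listed superalgebras *)

Section Invariants.
Variable K : fieldType.
Implicit Types (w : tab K) (A B G H : mat K) (s t x y : K).

(* RA and RM are the matrices of the multiplication by the even vector (s, t) on
   the even and on the odd part, and RP that of the multiplication by f_0 f_1 on
   the odd part; the invariants are traces of products of these. *)
Definition RA w s t := M2 (ca0 w * s + cb0 w * t) (cb0 w * s + cc0 w * t)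
                          (ca1 w * s + cb1 w * t) (cb1 w * s + cc1 w * t).
Definition RM w s t := M2 (cx00 w * s + cy00 w * t) (cx01 w * s + cy01 w * t)
                          (cx10 w * s + cy10 w * t) (cx11 w * s + cy11 w * t).
Definition RP w := RM w (cp0 w) (cp1 w).

Definition trA w s t := mtr (RA w s t).
Definition trM w s t := mtr (RM w s t).
Definition tau w s t s' t' := mtr (mmul (RA w s t) (RA w s' t')).
Definition qM w s t s' t' := mtr (mmul (RM w s t) (RM w s' t')).
(** The trace of the multiplication by x^2 minus that of the square of the multiplication by x: it
    vanishes when the even part is associative and is s^2 / 4 when e n = n / 2, so it detects
    non-associative even parts. *)
Definition nu w s t := trA w (ev0 w s t s t) (ev1 w s t s t) - tau w s t s t.

(** The Gram determinant of the trace form [tau], nonzero exactly on the normal form with two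
    orthogonal idempotents. *)
Definition discA w := tau w 1 0 1 0 * tau w 0 1 0 1 - tau w 1 0 0 1 ^+ 2.
(** In a basis orthonormal for [tau] this is 4 times the squared norm of the linear form [trM], plus
    8 times the trace and 48 times the determinant of the quadratic form [qM]. In general these
    contractions with the inverse of [tau] are multiplied by [discA] to become polynomial, so that
    [numA / discA] is invariant. *)
Definition numA w :=
  let t00 := tau w 1 0 1 0 in let t01 := tau w 1 0 0 1 in let t11 := tau w 0 1 0 1 in
  let q00 := qM w 1 0 1 0 in let q01 := qM w 1 0 0 1 in let q11 := qM w 0 1 0 1 in
  let r0 := trM w 1 0 in let r1 := trM w 0 1 in
  4 * (t11 * r0 ^+ 2 - 2 * t01 * r0 * r1 + t00 * r1 ^+ 2)
  + 8 * (t11 * q00 - 2 * t01 * q01 + t00 * q11)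
  + 48 * (q00 * q11 - q01 ^+ 2).

(* The determinant of the vectors z and A z, with z = (x, y). *)
Definition wedge A x y :=
  x * (m10 A * x + m11 A * y) - y * (m00 A * x + m01 A * y).

(* For d != 0, sep ms m n d vanishes when n / d is an element of ms other than m. *)
Definition sep (ms : seq nat) m (n d : K) := \prod_(k <- rem m ms) (n - k%:R * d).

(* The values on normal forms of numA / discA when the even part is semisimple, of
   qM / nu when it is not associative, and of 10 trM^2 / tau in the remaining cases;
   the coefficients of numA were chosen so that its values are distinct integers. *)
Definition vals1 := [:: 0; 12; 3; 19; 32; 8; 6; 27; 34; 9; 14; 72; 16]%N.
Definition vals2 := [:: 0; 1; 2; 4; 5; 8]%N.
Definition vals4 := [:: 0; 2; 5; 10; 18; 20]%N.

Definition cond1 m w := discA w * sep vals1 m (numA w) (discA w) != 0.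
Definition cond1p m w := cond1 m w /\ ((cp0 w != 0) || (cp1 w != 0)).
Definition cond2 m w := exists s t, nu w s t * sep vals2 m (qM w s t s t) (nu w s t) != 0.
(** Separates [J56] from [J54] and [J64] from [J62], which have the same eigenvalues x < y of the
    idempotent on the odd part. There [RP] sends one eigenvector to the other; composed on the left
    with the idempotent it is multiplied by the eigenvalue of its target, and on the right
    ([cond3r]) by that of its source. With b = 3 x / (x + y), which is 0 or 1, the term in [b]
    cancels this factor when the eigenvalue is x, and not when it is y. *)
Definition cond3l m b w := cond2 m w /\ exists s t x y,
  wedge (madd (mscale 3 (mmul (RM w s t) (RP w))) (mscale (- b * trM w s t) (RP w))) x y != 0.
Definition cond3r m b w := cond2 m w /\ exists s t x y,
  wedge (madd (mscale 3 (mmul (RP w) (RM w s t))) (mscale (- b * trM w s t) (RP w))) x y != 0.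
(** The first half says that [RP] is not a scalar matrix. The values 2 and 18 of [vals4] belong to
    none of the superalgebras that this condition is to detect: they are the ratios of [J54], [J56]
    and of [J62], [J64], where [RP] is not scalar either, and they are listed so as to be
    excluded. *)
Definition cond4 m w := (exists x y, wedge (RP w) x y != 0) /\
  exists s t, sep vals4 m (10 * trM w s t ^+ 2) (tau w s t s t) != 0.

Definition gap G s t := (m00 G * s + m01 G * t, m10 G * s + m11 G * t).

(** No inverse is formed: [mdet G] times the trace of [A] is a combination of the entries of [A G]
    with the cofactors of [G] as coefficients. *)
Lemma mtr_conj G A B : mdet G != 0 -> mmul A G = mmul G B -> mtr A = mtr B.
Proof.
case: G A B => a b c d [x y z t] [x' y' z' t'] /= G0 [E1 E2 E3 E4].
apply: (mulfI G0).
transitivity ((x * a + y * c) * d - (x * b + y * d) * c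
              + (z * b + t * d) * a - (z * a + t * c) * b); first by ring.
by rewrite E1 E2 E3 E4; ring.
Qed.

Lemma mmulA A B G : mmul A (mmul B G) = mmul (mmul A B) G.
Proof.
by case: A B G => ? ? ? ? [? ? ? ?] [? ? ? ?]; rewrite /mmul; apply: M2_eq; ring.
Qed.

Lemma mmulDl A B G : mmul (madd A B) G = madd (mmul A G) (mmul B G).
Proof.
by case: A B G => ? ? ? ? [? ? ? ?] [? ? ? ?]; rewrite /mmul; apply: M2_eq; ring.
Qed.

Lemma mmulDr A B G : mmul G (madd A B) = madd (mmul G A) (mmul G B).
Proof.
by case: A B G => ? ? ? ? [? ? ? ?] [? ? ? ?]; rewrite /mmul; apply: M2_eq; ring.
Qed.

Lemma mmulZl k A B : mmul (mscale k A) B = mscale k (mmul A B).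
Proof. by case: A B => ? ? ? ? [? ? ? ?]; rewrite /mmul; apply: M2_eq; ring. Qed.

Lemma mmulZr k A B : mmul A (mscale k B) = mscale k (mmul A B).
Proof. by case: A B => ? ? ? ? [? ? ? ?]; rewrite /mmul; apply: M2_eq; ring. Qed.

Lemma mscaleA k l A : mscale k (mscale l A) = mscale (k * l) A.
Proof. by case: A => ? ? ? ?; apply: M2_eq; ring. Qed.

Lemma mscale_inj k A B : k != 0 -> mscale k A = mscale k B -> A = B.
Proof.
case: A B => ? ? ? ? [? ? ? ?] k0 []; do 4! move/(mulfI k0) => ->; by [].
Qed.

Lemma wedge_conj H A B x y : mmul A H = mmul H B ->
  wedge A (gap H x y).1 (gap H x y).2 = mdet H * wedge B x y.
Proof.
case: H A B => a b c d [p q r u] [p' q' r' u'] [E1 E2 E3 E4] /=.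
rewrite /wedge /=.
transitivity ((a * x + b * y) * ((r * a + u * c) * x + (r * b + u * d) * y)
   - (c * x + d * y) * ((p * a + q * c) * x + (p * b + q * d) * y)); first by ring.
by rewrite E1 E2 E3 E4; ring.
Qed.

Section Iso.
Variables (w w' : tab K) (G H : mat K).
Hypotheses (G0 : mdet G != 0) (H0 : mdet H != 0) (E : iso_eqs w w' G H).

Let RA_conj s t : mmul (RA w (gap G s t).1 (gap G s t).2) G = mmul G (RA w' s t).
Proof.
case: G E => a b c d; case: H => a' b' c' d'; rewrite /iso_eqs.
case=> [] [[E1 E2] [E3 E4] [E5 E6] _]; move: E1 E2 E3 E4 E5 E6.
rewrite /ev0 /ev1 => E1 E2 E3 E4 E5 E6; apply: M2_eq => /=.
- transitivity (s * (a * ca0 w' + b * ca1 w') + t * (a * cb0 w' + b * cb1 w')).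
    by rewrite -E1 -E3; ring.
  by ring.
- transitivity (s * (a * cb0 w' + b * cb1 w') + t * (a * cc0 w' + b * cc1 w')).
    by rewrite -E3 -E5; ring.
  by ring.
- transitivity (s * (c * ca0 w' + d * ca1 w') + t * (c * cb0 w' + d * cb1 w')).
    by rewrite -E2 -E4; ring.
  by ring.
- transitivity (s * (c * cb0 w' + d * cb1 w') + t * (c * cc0 w' + d * cc1 w')).
    by rewrite -E4 -E6; ring.
  by ring.
Qed.

Let RM_conj s t : mmul (RM w (gap G s t).1 (gap G s t).2) H = mmul H (RM w' s t).
Proof.
case: G H E => a b c d [a' b' c' d']; rewrite /iso_eqs.
case=> [] _ [[E1 E2] [E3 E4] [E5 E6] [E7 E8] _]; move: E1 E2 E3 E4 E5 E6 E7 E8.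
rewrite /od0 /od1 => E1 E2 E3 E4 E5 E6 E7 E8; apply: M2_eq => /=.
- transitivity (s * (a' * cx00 w' + b' * cx10 w') + t * (a' * cy00 w' + b' * cy10 w')).
    by rewrite -E1 -E5; ring.
  by ring.
- transitivity (s * (a' * cx01 w' + b' * cx11 w') + t * (a' * cy01 w' + b' * cy11 w')).
    by rewrite -E3 -E7; ring.
  by ring.
- transitivity (s * (c' * cx00 w' + d' * cx10 w') + t * (c' * cy00 w' + d' * cy10 w')).
    by rewrite -E2 -E6; ring.
  by ring.
- transitivity (s * (c' * cx01 w' + d' * cx11 w') + t * (c' * cy01 w' + d' * cy11 w')).
    by rewrite -E4 -E8; ring.
  by ring.
Qed.

Let p_conj : cp0 w * mdet H = m00 G * cp0 w' + m01 G * cp1 w' /\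
             cp1 w * mdet H = m10 G * cp0 w' + m11 G * cp1 w'.
Proof.
by case: G H E => a b c d [a' b' c' d'] [_ [_ _ _ _ [E1 E2]]] /=; 
  rewrite [b' * c']mulrC.
Qed.

(** The product of odd vectors is alternating, so a change of odd basis multiplies f_0 f_1 by its
    determinant; hence the correcting scalar. It cancels the factor [mdet H] of [wedge_conj], which
    makes the [wedge] conditions invariant. *)
Let RP_conj : mmul (RP w) H = mmul H (mscale (mdet H)^-1 (RP w')).
Proof.
apply: (@mscale_inj (mdet H)) => //; rewrite -[RHS]mmulZr mscaleA divff //.
rewrite -mmulZl; have -> : mscale (mdet H) (RP w) = RM w (gap G (cp0 w') (cp1 w')).1 (gap G (cp0 w') (cp1 w')).2.
  by rewrite /gap /=; case: p_conj => <- <-; apply: M2_eq => /=; ring.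
rewrite RM_conj; congr mmul.
by rewrite /RP; case: (RM _ _ _) => *; apply: M2_eq; rewrite mul1r.
Qed.

Lemma trA_iso s t : trA w (gap G s t).1 (gap G s t).2 = trA w' s t.
Proof. exact: mtr_conj G0 (RA_conj s t). Qed.

Lemma trM_iso s t : trM w (gap G s t).1 (gap G s t).2 = trM w' s t.
Proof. exact: mtr_conj H0 (RM_conj s t). Qed.

Lemma tau_iso s t s' t' :
  tau w (gap G s t).1 (gap G s t).2 (gap G s' t').1 (gap G s' t').2 = tau w' s t s' t'.
Proof. by apply: mtr_conj G0 _; rewrite -mmulA RA_conj mmulA RA_conj -mmulA. Qed.

Lemma qM_iso s t s' t' :
  qM w (gap G s t).1 (gap G s t).2 (gap G s' t').1 (gap G s' t').2 = qM w' s t s' t'.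
Proof. by apply: mtr_conj H0 _; rewrite -mmulA RM_conj mmulA RM_conj -mmulA. Qed.

Let sq_conj s t :
  gap G (ev0 w' s t s t) (ev1 w' s t s t) =
  (ev0 w (gap G s t).1 (gap G s t).2 (gap G s t).1 (gap G s t).2,
   ev1 w (gap G s t).1 (gap G s t).2 (gap G s t).1 (gap G s t).2).
Proof.
case: G E => a b c d; case: H => a' b' c' d'; rewrite /iso_eqs.
case=> [] [[E1 E2] [E3 E4] [E5 E6] _]; rewrite /gap ev0_bilinear ev1_bilinear /=.
by rewrite E1 E2 E3 E4 E5 E6 /ev0 /ev1; congr pair; ring.
Qed.

Lemma nu_iso s t : nu w (gap G s t).1 (gap G s t).2 = nu w' s t.
Proof. by rewrite /nu tau_iso -(trA_iso (ev0 w' s t s t)) sq_conj. Qed.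

Lemma wedge_RP_iso x y : wedge (RP w) (gap H x y).1 (gap H x y).2 = wedge (RP w') x y.
Proof.
rewrite (wedge_conj _ _ RP_conj); rewrite /wedge; case: (RP w') => *.
by rewrite /=; field.
Qed.

Lemma wedgel_iso b s t x y :
  wedge (madd (mscale 3 (mmul (RM w (gap G s t).1 (gap G s t).2) (RP w)))
              (mscale (- b * trM w (gap G s t).1 (gap G s t).2) (RP w)))
        (gap H x y).1 (gap H x y).2
  = wedge (madd (mscale 3 (mmul (RM w' s t) (RP w')))
                (mscale (- b * trM w' s t) (RP w'))) x y.
Proof.
rewrite trM_iso; set k := _ * trM _ _ _.
rewrite (@wedge_conj _ _ (mscale (mdet H)^-1 (madd (mscale 3 (mmul (RM w' s t) (RP w')))
                (mscale k (RP w'))))).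
  by rewrite /wedge; case: (madd _ _) => * /=; field.
rewrite mmulDl !mmulZl -mmulA RP_conj mmulA RM_conj -mmulA.
by rewrite !mmulZr mmulDr !mmulZr;
  case: (mmul _ _) (mmul _ _) => ? ? ? ? [? ? ? ?]; apply: M2_eq => /=; ring.
Qed.

Lemma wedger_iso b s t x y :
  wedge (madd (mscale 3 (mmul (RP w) (RM w (gap G s t).1 (gap G s t).2)))
              (mscale (- b * trM w (gap G s t).1 (gap G s t).2) (RP w)))
        (gap H x y).1 (gap H x y).2
  = wedge (madd (mscale 3 (mmul (RP w') (RM w' s t)))
                (mscale (- b * trM w' s t) (RP w'))) x y.
Proof.
rewrite trM_iso; set k := _ * trM _ _ _.
rewrite (@wedge_conj _ _ (mscale (mdet H)^-1 (madd (mscale 3 (mmul (RP w') (RM w' s t)))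
                (mscale k (RP w'))))).
  by rewrite /wedge; case: (madd _ _) => * /=; field.
rewrite mmulDl !mmulZl -mmulA RM_conj mmulA RP_conj -mmulA.
by rewrite mmulZl !mmulZr mmulDr !mmulZr;
  case: (mmul _ _) (mmul _ _) => ? ? ? ? [? ? ? ?]; apply: M2_eq => /=; ring.
Qed.

Let tauE u s t s' t' : tau u s t s' t' =
  s * s' * tau u 1 0 1 0 + (s * t' + t * s') * tau u 1 0 0 1 + t * t' * tau u 0 1 0 1.
Proof. by rewrite /tau /RA /=; ring. Qed.

Let qME u s t s' t' : qM u s t s' t' =
  s * s' * qM u 1 0 1 0 + (s * t' + t * s') * qM u 1 0 0 1 + t * t' * qM u 0 1 0 1.
Proof. by rewrite /qM /RM /=; ring. Qed.

Let trME u s t : trM u s t = s * trM u 1 0 + t * trM u 0 1.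
Proof. by rewrite /trM /RM /=; ring. Qed.

Lemma discA_iso : discA w' = mdet G ^+ 2 * discA w.
Proof.
rewrite /discA -!tau_iso ![tau w (gap _ _ _).1 _ _ _]tauE.
by case: (G) => a b c d /=; ring.
Qed.

Lemma numA_iso : numA w' = mdet G ^+ 2 * numA w.
Proof.
rewrite /numA -!tau_iso -!qM_iso -!trM_iso ![tau w (gap _ _ _).1 _ _ _]tauE.
rewrite ![qM w (gap _ _ _).1 _ _ _]qME ![trM w (gap _ _ _).1 _]trME.
by case: (G) => a b c d /=; ring.
Qed.

Lemma cp_iso : ((cp0 w' != 0) || (cp1 w' != 0)) = ((cp0 w != 0) || (cp1 w != 0)).
Proof.
case: p_conj => E0 E1; apply/idP/idP; apply: contraLR; rewrite !negb_or !negbK.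
  case/andP=> /eqP p0 /eqP p1; move: E0 E1; rewrite p0 p1 !mul0r => E0 E1.
  have e0 : mdet G * cp0 w' = 0.
    transitivity (m11 G * (m00 G * cp0 w' + m01 G * cp1 w')
                  - m01 G * (m10 G * cp0 w' + m11 G * cp1 w')).
      by case: (G) => a b c d /=; ring.
    by rewrite -E0 -E1 !mulr0 subrr.
  have e1 : mdet G * cp1 w' = 0.
    transitivity (m00 G * (m10 G * cp0 w' + m11 G * cp1 w')
                  - m10 G * (m00 G * cp0 w' + m01 G * cp1 w')).
      by case: (G) => a b c d /=; ring.
    by rewrite -E0 -E1 !mulr0 subrr.
  by move/eqP: e0; move/eqP: e1; rewrite !mulf_eq0 (negPf G0) /= => -> ->.
case/andP=> /eqP p0 /eqP p1; move/eqP: E0; move/eqP: E1.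
by rewrite p0 p1 !mulr0 addr0 !mulf_eq0 (negPf H0) !orbF => -> ->.
Qed.

Lemma gap_surj (A : mat K) s t : mdet A != 0 ->
  exists s' t', s = (gap A s' t').1 /\ t = (gap A s' t').2.
Proof.
case: A => a b c d /= A0.
by exists ((d * s - b * t) / (a * d - b * c)), ((a * t - c * s) / (a * d - b * c));
  split; field.
Qed.

End Iso.

Lemma sepZ ms m k n d : sep ms m (k * n) (k * d) = k ^+ size (rem m ms) * sep ms m n d.
Proof.
rewrite /sep; elim: (rem m ms) => [|i l IH]; first by rewrite !big_nil mulr1.
by rewrite !big_cons IH exprS; ring.
Qed.

Lemma cond1_iso m w w' : iso w w' -> cond1 m w <-> cond1 m w'.
Proof.
move=> /isoE[G [H [G0 H0 E]]]; rewrite /cond1 (discA_iso G0 E) (numA_iso G0 H0 E) sepZ.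
by rewrite !mulf_eq0 !expf_eq0 (negPf G0) !andbF.
Qed.

Lemma cond1p_iso m w w' : iso w w' -> cond1p m w <-> cond1p m w'.
Proof.
move=> I; rewrite /cond1p (cond1_iso m I); case/isoE: I => [G [H [G0 H0 E]]].
by rewrite (cp_iso G0 H0 E).
Qed.

Lemma cond2_iso m w w' : iso w w' -> cond2 m w <-> cond2 m w'.
Proof.
move=> /isoE[G [H [G0 H0 E]]]; split=> -[s [t]]; last first.
  by rewrite -(nu_iso G0 E) -(qM_iso H0 E) => P; exists (gap G s t).1, (gap G s t).2.
have [s' [t' [-> ->]]] := gap_surj s t G0.
by rewrite (nu_iso G0 E) (qM_iso H0 E) => P; exists s', t'.
Qed.

Lemma cond3l_iso m b w w' : iso w w' -> cond3l m b w <-> cond3l m b w'.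
Proof.
move=> I; rewrite /cond3l (cond2_iso m I); case/isoE: I => [G [H [G0 H0 E]]].
split=> -[U [s [t [x [y P]]]]]; (split; first by []); last first.
  exists (gap G s t).1, (gap G s t).2, (gap H x y).1, (gap H x y).2.
  by rewrite (wedgel_iso H0 E).
have [s' [t' [es et]]] := gap_surj s t G0; have [x' [y' [ex ey]]] := gap_surj x y H0.
by exists s', t', x', y'; move: P; rewrite es et ex ey (wedgel_iso H0 E).
Qed.

Lemma cond3r_iso m b w w' : iso w w' -> cond3r m b w <-> cond3r m b w'.
Proof.
move=> I; rewrite /cond3r (cond2_iso m I); case/isoE: I => [G [H [G0 H0 E]]].
split=> -[U [s [t [x [y P]]]]]; (split; first by []); last first.
  exists (gap G s t).1, (gap G s t).2, (gap H x y).1, (gap H x y).2.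
  by rewrite (wedger_iso H0 E).
have [s' [t' [es et]]] := gap_surj s t G0; have [x' [y' [ex ey]]] := gap_surj x y H0.
by exists s', t', x', y'; move: P; rewrite es et ex ey (wedger_iso H0 E).
Qed.

Lemma cond4_iso m w w' : iso w w' -> cond4 m w <-> cond4 m w'.
Proof.
move=> /isoE[G [H [G0 H0 E]]]; split=> -[[x [y P]] [s [t Q]]]; split.
- have [x' [y' [e e']]] := gap_surj x y H0; exists x', y'.
  by rewrite -(wedge_RP_iso H0 E) -e -e'.
- have [s' [t' [e e']]] := gap_surj s t G0; exists s', t'.
  by rewrite -(trM_iso H0 E) -(tau_iso G0 E) -e -e'.
- exists (gap H x y).1, (gap H x y).2; by rewrite (wedge_RP_iso H0 E).
- exists (gap G s t).1, (gap G s t).2; by rewrite (trM_iso H0 E) (tau_iso G0 E).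
Qed.

End Invariants.

(** * The listed tables and their conditions *)

Section Tables.
Variable K : numClosedFieldType.
Implicit Types (w : tab K) (x y p q s t : K) (i j m : nat).
Local Notation h := (2^-1 : K).

(* Two orthogonal idempotents, acting on the odd part by diag (x, y) and
   diag (x', y'). *)
Definition Bss x y x' y' p q : tab K :=
  Tab 1 0 0 0 0 1 x 0 0 y x' 0 0 y' p q.

(* An idempotent e and a nilpotent n, with e n = mu n and n^2 = 0. *)
Definition Bsn mu x y b00 b01 b10 b11 p q : tab K :=
  Tab 1 0 0 mu 0 0 x 0 0 y b00 b01 b10 b11 p q.

Definition tabs : seq (tab K) :=
  [:: Bss 0 0 0 0 0 0; Bss 0 0 0 1 0 0; Bss 0 0 0 h 0 0; Bss 0 0 1 h 0 0;
      Bss 0 0 1 1 0 1; Bss 0 0 h h 0 1; Bss 0 h 0 h 0 0; Bss 0 h 1 0 0 0;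
      Bss 0 h 1 h 0 0; Bss 0 h h 0 0 0; Bss 0 h h h 0 0; Bss 0 1 1 0 0 0;
      Bsn 0 0 0 0 0 1 0 0 1; Bsn 0 h h 0 0 1 0 0 1; Bsn 1 h h 0 0 1 0 0 1;
      Bsn 1 1 1 0 0 1 0 0 1; Bsn h 0 0 0 0 0 0 0 0; Bsn h 0 h 0 1 0 0 0 1;
      Bsn h 0 h 0 0 1 0 0 1; Bsn h 0 1 0 0 0 0 0 0; Bsn h h h 0 0 0 0 0 0;
      Bsn h h 1 0 1 0 0 0 1; Bsn h h 1 0 0 1 0 0 1; Bsn h 1 1 0 0 0 0 0 0].
Definition tab16 t := Bss h h h h 1 t.

Definition stratum j w :=
  if (j < 24)%N then iso w (nth (tab16 0) tabs j) else exists t, iso w (tab16 t).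

Inductive code := C1 of nat | C1p of nat | C2 of nat | C3l of nat & nat
  | C3r of nat & nat | C4 of nat.

Definition codes := [:: C1 0; C1 12; C1 3; C1 19; C1p 32; C1p 8; C1 6; C1 27;
  C1 34; C1 9; C1 14; C1 72; C4 0; C4 10; C4 5; C4 20; C2 0; C3r 1 0; C3l 1 0;
  C2 4; C2 2; C3r 5 1; C3l 5 1; C2 8; C1p 16].

Definition cond_of_code c w : Prop :=
  match c with
  | C1 m => cond1 m w | C1p m => cond1p m w | C2 m => cond2 m w
  | C3l m b => cond3l m b%:R w | C3r m b => cond3r m b%:R w | C4 m => cond4 m w
  end.

Definition stratum_cond j w := cond_of_code (nth (C1 0) codes j) w.

Lemma stratum_cond_iso j w w' : iso w w' -> stratum_cond j w <-> stratum_cond j w'.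
Proof.
rewrite /stratum_cond; case: (nth _ _ _) => [m|m|m|m b|m b|m] I /=.
- exact: cond1_iso.
- exact: cond1p_iso.
- exact: cond2_iso.
- exact: cond3l_iso.
- exact: cond3r_iso.
- exact: cond4_iso.
Qed.

Lemma sep_eq0 ms m m' (n d : K) : m != m' -> m \in ms -> uniq ms -> n = m%:R * d ->
  sep ms m' n d = 0.
Proof.
move=> mm' m_in ms_uniq ->; apply/eqP; rewrite /sep prodf_seq_eq0; apply/hasP; exists m; last by rewrite subrr eqxx.
by rewrite rem_filter // mem_filter /= mm'.
Qed.

Lemma sep_neq0 ms m (n d : K) : uniq ms -> n = m%:R * d -> d != 0 -> sep ms m n d != 0.
Proof.
move=> ms_uniq -> d0; rewrite /sep prodf_seq_neq0; apply/allP => k; rewrite rem_filter //.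
rewrite mem_filter /= -mulrBl mulf_eq0 negb_or d0 andbT subr_eq0 eqr_nat eq_sym.
by case/andP.
Qed.

Lemma cond1E m m' w : m \in vals1 -> numA w = m%:R * discA w -> cond1 m' w -> m' = m.
Proof.
move=> mv E; rewrite /cond1; case: (eqVneq m' m) => // mm'.
by rewrite (sep_eq0 _ mv _ E) ?mulr0 ?eqxx // eq_sym.
Qed.

Lemma cond2E m m' w : m \in vals2 -> (forall s t, qM w s t s t = m%:R * nu w s t) ->
  cond2 m' w -> m' = m.
Proof.
move=> mv E [s [t]]; case: (eqVneq m' m) => // mm'.
by rewrite (sep_eq0 _ mv _ (E s t)) ?mulr0 ?eqxx // eq_sym.
Qed.

Lemma cond4E m m' w : m \in vals4 ->
  (forall s t, 10 * trM w s t ^+ 2 = m%:R * tau w s t s t) -> cond4 m' w -> m' = m.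
Proof.
move=> mv E [_ [s [t]]]; case: (eqVneq m' m) => // mm'.
by rewrite (sep_eq0 _ mv _ (E s t)) ?eqxx // eq_sym.
Qed.

Lemma nu0_cond2 m w : (forall s t, nu w s t = 0) -> ~ cond2 m w.
Proof. by move=> E [s [t]]; rewrite E mul0r eqxx. Qed.

Lemma RP0_cond4 m w : (forall x y, wedge (RP w) x y = 0) -> ~ cond4 m w.
Proof. by move=> E [[x [y]]]; rewrite E eqxx. Qed.

Lemma disc0_cond1 m w : discA w = 0 -> ~ cond1 m w.
Proof. by rewrite /cond1 => ->; rewrite mul0r eqxx. Qed.

Lemma RP0_cond3l m b w : RP w = M2 0 0 0 0 -> ~ cond3l m b w.
Proof.
move=> E [_ [s [t [x [y]]]]]; rewrite E /wedge; case: (RM _ _ _) => ? ? ? ? /=.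
by rewrite !(mulr0, mul0r, addr0, subr0) eqxx.
Qed.

Lemma RP0_cond3r m b w : RP w = M2 0 0 0 0 -> ~ cond3r m b w.
Proof.
move=> E [_ [s [t [x [y]]]]]; rewrite E /wedge; case: (RM _ _ _) => ? ? ? ? /=.
by rewrite !(mulr0, mul0r, addr0, subr0) eqxx.
Qed.

(** The kinds are kept apart by multiples of 100, except that [C1] and [C1p] share a range, since
    both are told apart by their value of [numA / discA]. The parameter [b] is dropped because kind
    and [m] already determine the code. *)
Definition ncode c := match c with C1 m => m | C1p m => m | C2 m => 100 + m
  | C3l m b => 200 + m | C3r m b => 300 + m | C4 m => 400 + m end%N.

Lemma ncode_inj i j : (i < 25)%N -> (j < 25)%N ->
  ncode (nth (C1 0) codes i) = ncode (nth (C1 0) codes j) -> i = j.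
Proof.
move=> i25 j25 E; apply/eqP.
have : nth 0%N (map ncode codes) i == nth 0%N (map ncode codes) j.
  by rewrite !(nth_map (C1 0)) //; apply/eqP.
by rewrite nth_uniq.
Qed.

Lemma cond_Bss m w j : (j < 25)%N -> m \in vals1 -> numA w = m%:R * discA w ->
  (forall s t, nu w s t = 0) -> (forall x y, wedge (RP w) x y = 0) ->
  stratum_cond j w -> ncode (nth (C1 0) codes j) = m.
Proof.
move=> _ mv E N W; rewrite /stratum_cond; case: (nth _ _ _) => [m'|m'|m'|m' b|m' b|m'] /=.
- exact: cond1E.
- by case=> /(cond1E mv E).
- by move/(nu0_cond2 N).
- by case=> /(nu0_cond2 N).
- by case=> /(nu0_cond2 N).
- by move/(RP0_cond4 W).
Qed.

Lemma cond_dead w j : discA w = 0 -> (forall s t, nu w s t = 0) ->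
  (forall x y, wedge (RP w) x y = 0) \/
  (forall s t, trM w s t = 0 /\ tau w s t s t = 0) -> ~ stratum_cond j w.
Proof.
move=> D N W; rewrite /stratum_cond; case: (nth _ _ _) => [m'|m'|m'|m' b|m' b|m'] /=.
- exact: disc0_cond1.
- by case=> /(disc0_cond1 D).
- exact: nu0_cond2.
- by case=> /(nu0_cond2 N).
- by case=> /(nu0_cond2 N).
case: W => [|W]; first exact: RP0_cond4.
(* With both sides zero, the relation 10 trM^2 = m tau holds for m = 0 and for m = 2 alike, and
   [cond4] would force its parameter to equal both. *)
move=> V; have : m' = 0%N by apply: cond4E V => // s t; case: (W s t) => -> ->; rewrite expr0n /= !mulr0.
have : m' = 2%N by apply: cond4E V => // s t; case: (W s t) => -> ->; rewrite expr0n /= !mulr0.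
by move=> ->.
Qed.

Lemma cond_C4 w m j : discA w = 0 -> (forall s t, nu w s t = 0) -> m \in vals4 ->
  (forall s t, 10 * trM w s t ^+ 2 = m%:R * tau w s t s t) ->
  stratum_cond j w -> ncode (nth (C1 0) codes j) = (400 + m)%N.
Proof.
move=> D N mv E; rewrite /stratum_cond; case: (nth _ _ _) => [m'|m'|m'|m' b|m' b|m'] /=.
- by move/(disc0_cond1 D).
- by case=> /(disc0_cond1 D).
- by move/(nu0_cond2 N).
- by case=> /(nu0_cond2 N).
- by case=> /(nu0_cond2 N).
by move/(cond4E mv E) => ->.
Qed.

Lemma Bss_inv x y x' y' p q (w := Bss x y x' y' p q) :
  [/\ discA w = 1, numA w = 4 * ((x + y) ^+ 2 + (x' + y') ^+ 2)
        + 8 * (x ^+ 2 + y ^+ 2 + x' ^+ 2 + y' ^+ 2)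
        + 48 * ((x ^+ 2 + y ^+ 2) * (x' ^+ 2 + y' ^+ 2) - (x * x' + y * y') ^+ 2),
      forall s t, nu w s t = 0 &
      forall r s, wedge (RP w) r s = r * s * (p * (y - x) + q * (y' - x'))].
Proof.
by rewrite /w /discA /numA /nu /wedge /RP /tau /trA /trM /qM /ev0 /ev1 /=;
  split=> *; ring.
Qed.

Lemma Bsn_inv mu x y b00 b01 b10 b11 p q (w := Bsn mu x y b00 b01 b10 b11 p q) :
  [/\ discA w = 0, forall s t, nu w s t = (mu - mu ^+ 2) * s ^+ 2,
      forall s t, tau w s t s t = (1 + mu ^+ 2) * s ^+ 2,
      forall s t, trM w s t = (x + y) * s + (b00 + b11) * t
      & forall s t, qM w s t s t = (x * s + b00 * t) ^+ 2 + (y * s + b11 * t) ^+ 2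
                     + 2 * b01 * b10 * t ^+ 2].
Proof.
by rewrite /w /discA /nu /tau /trA /trM /qM /ev0 /ev1 /=; split=> *; ring.
Qed.

Lemma Bsn_wedge mu x y b00 b01 b10 b11 p q r s :
  wedge (RP (Bsn mu x y b00 b01 b10 b11 p q)) r s =
  q * b10 * r ^+ 2 - q * b01 * s ^+ 2 + r * s * (p * (y - x) + q * (b11 - b00)).
Proof. by rewrite /wedge /RP /=; ring. Qed.

End Tables.

Section ConditionValues.
Variable K : numClosedFieldType.
Implicit Types (w : tab K) (x y p q s t : K) (i j m : nat).
Local Notation h := (2^-1 : K).
Local Notation ncodej j := (ncode (nth (C1 0) codes j)).

Lemma cond_Bss_p0 m x y x' y' p q j : (j < 25)%N -> m \in vals1 ->
  numA (Bss x y x' y' p q) = m%:R -> p * (y - x) + q * (y' - x') = 0 ->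
  stratum_cond j (Bss x y x' y' p q) -> ncodej j = m.
Proof.
move=> j25 mv E W; have [D _ N We] := Bss_inv x y x' y' p q.
by apply: cond_Bss => //; [rewrite D mulr1|move=> r s; rewrite We W mulr0].
Qed.

Lemma Bsn_qM m x y b01 b10 q s t : x ^+ 2 + y ^+ 2 = m%:R / 4 -> b01 * b10 = 0 ->
  qM (Bsn h x y 0 b01 b10 0 0 q) s t s t = m%:R * nu (Bsn h x y 0 b01 b10 0 0 q) s t.
Proof.
move=> Em b0; have [_ N _ _ Q] := Bsn_inv h x y 0 b01 b10 0 0 q.
rewrite Q N; transitivity ((x ^+ 2 + y ^+ 2) * s ^+ 2 + 2 * (b01 * b10) * t ^+ 2).
  by ring.
by rewrite Em b0; field.
Qed.

Lemma Bsn_wedgel x y b q k s t r u (w := Bsn h x y 0 0 b 0 0 q) :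
  (wedge (madd (mscale 3 (mmul (RM w s t) (RP w))) (mscale (- k * trM w s t) (RP w))) r u
   = r ^+ 2 * s * (q * b * (3 * y - k * (x + y)))) *
  (wedge (madd (mscale 3 (mmul (RP w) (RM w s t))) (mscale (- k * trM w s t) (RP w))) r u
   = r ^+ 2 * s * (q * b * (3 * x - k * (x + y)))).
Proof. by rewrite /w /wedge /RP /trM /=; split; ring. Qed.

Lemma Bsn_wedger x y b q k s t r u (w := Bsn h x y 0 b 0 0 0 q) :
  (wedge (madd (mscale 3 (mmul (RM w s t) (RP w))) (mscale (- k * trM w s t) (RP w))) r u
   = - u ^+ 2 * s * (q * b * (3 * x - k * (x + y)))) *
  (wedge (madd (mscale 3 (mmul (RP w) (RM w s t))) (mscale (- k * trM w s t) (RP w))) r u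
   = - u ^+ 2 * s * (q * b * (3 * y - k * (x + y)))).
Proof. by rewrite /w /wedge /RP /trM /=; split; ring. Qed.

Section Nonassociative.
Variables (m m4 : nat) (x y : K).
Hypotheses (mv : m \in vals2) (Em : x ^+ 2 + y ^+ 2 = m%:R / 4).

Let cond_Bsn_aux w j : discA w = 0 ->
  (forall s t, qM w s t s t = m%:R * nu w s t) ->
  stratum_cond j w -> match nth (C1 0) codes j with
    | C1 _ | C1p _ => False | C2 m' => m' = m
    | C3l m' b => m' = m /\ cond3l m b%:R w | C3r m' b => m' = m /\ cond3r m b%:R w
    | C4 m' => cond4 m' w end.
Proof.
move=> D Q; rewrite /stratum_cond; case: (nth _ _ _) => [m'|m'|m'|m' b|m' b|m'] //=.
- exact: disc0_cond1.
- by case=> /(disc0_cond1 D).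
- exact: cond2E.
- by move=> V; have E : m' = m by [case: V => /(cond2E mv Q)]; rewrite -{2}E.
- by move=> V; have E : m' = m by [case: V => /(cond2E mv Q)]; rewrite -{2}E.
Qed.

Lemma cond_Bsn0 q j : stratum_cond j (Bsn h x y 0 0 0 0 0 q) -> ncodej j = (100 + m)%N.
Proof.
have [D _ _ _ _] := Bsn_inv h x y 0 0 0 0 0 q.
have RP0 : RP (Bsn h x y 0 0 0 0 0 q) = M2 0 0 0 0 by apply: M2_eq => /=; ring.
move/(cond_Bsn_aux D (fun s t => Bsn_qM q s t Em (mulr0 0))).
case: (nth _ _ _) => [m'|m'|m'|m' b|m' b|m'] //=.
- by move=> ->.
- by case=> _ /(RP0_cond3l RP0).
- by case=> _ /(RP0_cond3r RP0).
by move/RP0_cond4; case=> r u; rewrite RP0 /wedge /=; ring.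
Qed.

(** The factor 5 / 4 is 1 + mu^2 for mu = 1 / 2, the coefficient of s^2 in [tau]. *)
Hypothesis Em4 : 10 * (x + y) ^+ 2 = m4%:R * (5 / 4).
Hypothesis m4v : m4 \in vals4.

Let cond4_m4 m' b00 b01 b10 b11 p q : b00 + b11 = 0 ->
  cond4 m' (Bsn h x y b00 b01 b10 b11 p q) -> m' = m4.
Proof.
move=> b0; have [_ _ T R _] := Bsn_inv h x y b00 b01 b10 b11 p q.
apply: cond4E => // s t; rewrite T R b0.
transitivity (10 * (x + y) ^+ 2 * s ^+ 2); first by ring.
by rewrite Em4; field.
Qed.

Lemma cond_Bsnl b q j : stratum_cond j (Bsn h x y 0 0 b 0 0 q) ->
  match nth (C1 0) codes j with
  | C1 _ | C1p _ => False | C2 m' => m' = m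
  | C3l m' k => m' = m /\ q * b * (3 * y - k%:R * (x + y)) != 0
  | C3r m' k => m' = m /\ q * b * (3 * x - k%:R * (x + y)) != 0
  | C4 m' => m' = m4 end.
Proof.
have [D _ _ _ _] := Bsn_inv h x y 0 0 b 0 0 q.
move/(cond_Bsn_aux D (fun s t => Bsn_qM q s t Em (mul0r b))).
case: (nth _ _ _) => [m'|m'|m'|m' k|m' k|m'] //=.
- by case=> -> [_ [s [t [r [u]]]]]; rewrite Bsn_wedgel mulf_eq0 negb_or => /andP[].
- by case=> -> [_ [s [t [r [u]]]]]; rewrite Bsn_wedgel mulf_eq0 negb_or => /andP[].
by apply: cond4_m4; rewrite addr0.
Qed.

Lemma cond_Bsnr b q j : stratum_cond j (Bsn h x y 0 b 0 0 0 q) ->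
  match nth (C1 0) codes j with
  | C1 _ | C1p _ => False | C2 m' => m' = m
  | C3l m' k => m' = m /\ q * b * (3 * x - k%:R * (x + y)) != 0
  | C3r m' k => m' = m /\ q * b * (3 * y - k%:R * (x + y)) != 0
  | C4 m' => m' = m4 end.
Proof.
have [D _ _ _ _] := Bsn_inv h x y 0 b 0 0 0 q.
move/(cond_Bsn_aux D (fun s t => Bsn_qM q s t Em (mulr0 b))).
case: (nth _ _ _) => [m'|m'|m'|m' k|m' k|m'] //=.
- by case=> -> [_ [s [t [r [u]]]]]; rewrite Bsn_wedger mulf_eq0 negb_or => /andP[].
- by case=> -> [_ [s [t [r [u]]]]]; rewrite Bsn_wedger mulf_eq0 negb_or => /andP[].
by apply: cond4_m4; rewrite addr0.
Qed.

Lemma cond2_Bsn b01 b10 q : b01 * b10 = 0 -> cond2 m (Bsn h x y 0 b01 b10 0 0 q).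
Proof.
move=> b0; have [_ N _ _ _] := Bsn_inv h x y 0 b01 b10 0 0 q.
have nu1 : nu (Bsn h x y 0 b01 b10 0 0 q) 1 0 != 0.
  rewrite N; have -> : (h - h ^+ 2) * 1 ^+ 2 = 4^-1 by field.
  by rewrite invr_eq0 pnatr_eq0.
by exists 1, 0; rewrite mulf_neq0 // sep_neq0 //; exact: Bsn_qM.
Qed.

End Nonassociative.

Lemma cond_Bsn_assoc mu m x b p q j : mu - mu ^+ 2 = 0 -> m \in vals4 ->
  40 * x ^+ 2 = m%:R * (1 + mu ^+ 2) ->
  stratum_cond j (Bsn mu x x 0 0 b 0 p q) -> ncodej j = (400 + m)%N.
Proof.
move=> mu0 mv Em; have [D N T R _] := Bsn_inv mu x x 0 0 b 0 p q.
apply: cond_C4 => // s t; first by rewrite N mu0 mul0r.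
rewrite T R; transitivity (40 * x ^+ 2 * s ^+ 2); first by ring.
by rewrite Em; ring.
Qed.

Lemma cond4_Bsn mu m x b q : mu - mu ^+ 2 = 0 -> 1 + mu ^+ 2 != 0 -> m \in vals4 ->
  40 * x ^+ 2 = m%:R * (1 + mu ^+ 2) -> q * b != 0 -> cond4 m (Bsn mu x x 0 0 b 0 0 q).
Proof.
move=> mu0 mu1 mv Em qb; have [D N T R _] := Bsn_inv mu x x 0 0 b 0 0 q; split.
  by exists 1, 0; rewrite Bsn_wedge; apply: contraNneq qb => <-; apply/eqP; ring.
exists 1, 0; rewrite T R expr1n mulr1; apply: sep_neq0 => //.
by rewrite -Em; ring.
Qed.

End ConditionValues.

Definition dBss (x y x' y' p q : nat) : tab int :=
  Tab (Posz 2) 0 0 0 0 (Posz 2) (Posz x) 0 0 (Posz y) (Posz x') 0 0 (Posz y') (Posz p) (Posz q).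
Definition dBsn (mu x y b00 b01 b10 b11 p q : nat) : tab int :=
  Tab (Posz 2) 0 0 (Posz mu) 0 0 (Posz x) 0 0 (Posz y) (Posz b00) (Posz b01) (Posz b10) (Posz b11)
    (Posz p) (Posz q).

(* The tables tabs, doubled so as to be integral. *)
Definition dtabs : seq (tab int) :=
  ([:: dBss 0 0 0 0 0 0; dBss 0 0 0 2 0 0; dBss 0 0 0 1 0 0; dBss 0 0 2 1 0 0;
      dBss 0 0 2 2 0 2; dBss 0 0 1 1 0 2; dBss 0 1 0 1 0 0; dBss 0 1 2 0 0 0;
      dBss 0 1 2 1 0 0; dBss 0 1 1 0 0 0; dBss 0 1 1 1 0 0; dBss 0 2 2 0 0 0;
      dBsn 0 0 0 0 0 2 0 0 2; dBsn 0 1 1 0 0 2 0 0 2; dBsn 2 1 1 0 0 2 0 0 2;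
      dBsn 2 2 2 0 0 2 0 0 2; dBsn 1 0 0 0 0 0 0 0 0; dBsn 1 0 1 0 2 0 0 0 2;
      dBsn 1 0 1 0 0 2 0 0 2; dBsn 1 0 2 0 0 0 0 0 0; dBsn 1 1 1 0 0 0 0 0 0;
      dBsn 1 1 2 0 2 0 0 0 2; dBsn 1 1 2 0 0 2 0 0 2; dBsn 1 2 2 0 0 0 0 0 0])%N.

Section ConditionsOfTables.
Variable K : numClosedFieldType.
Implicit Types (w : tab K) (x y p q s t : K) (i j m : nat).
Local Notation h := (2^-1 : K).
Local Notation ncodej j := (ncode (nth (C1 0) codes j)).

Let only_Bss m x y x' y' p q i j : (i < 25)%N -> (j < 25)%N ->
  ncodej i = m -> m \in vals1 -> numA (Bss x y x' y' p q) = m%:R ->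
  p * (y - x) + q * (y' - x') = 0 -> stratum_cond j (Bss x y x' y' p q) -> j = i.
Proof.
by move=> i25 j25 E mv Em W /(cond_Bss_p0 j25 mv Em W); rewrite -E; exact: ncode_inj.
Qed.

Let only_Bsn0 m x y i j : (i < 25)%N -> (j < 25)%N -> ncodej i = (100 + m)%N ->
  m \in vals2 -> x ^+ 2 + y ^+ 2 = m%:R / 4 ->
  stratum_cond j (Bsn h x y 0 0 0 0 0 0) -> j = i.
Proof.
by move=> i25 j25 E mv Em /(cond_Bsn0 mv Em); rewrite -E; exact: ncode_inj.
Qed.

Let only_assoc mu m x i j : (i < 25)%N -> (j < 25)%N -> ncodej i = (400 + m)%N ->
  mu - mu ^+ 2 = 0 -> m \in vals4 -> 40 * x ^+ 2 = m%:R * (1 + mu ^+ 2) ->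
  stratum_cond j (Bsn mu x x 0 0 1 0 0 1) -> j = i.
Proof.
by move=> i25 j25 E mu0 mv Em /(cond_Bsn_assoc mu0 mv Em); rewrite -E; exact: ncode_inj.
Qed.

Ltac case25 j j25 :=
  move: j25;
  do 25! [case: j => [_|j];
    [rewrite /=; first [done|by case|case=> _ /eqP[]; by field]|]];
  done.

Lemma stratum_cond_tabs_inj i j : (i < 24)%N -> (j < 25)%N -> stratum_cond j (nth (tab16 0) (tabs K) i) -> j = i.
Proof.
have numE x y x' y' p q := let: And4 _ E _ _ := Bss_inv x y x' y' p q in E.
case: i => [_ j25|i].
  by apply: (@only_Bss 0) => //; [rewrite numE; field|ring].
case: i => [_ j25|i].
  by apply: (@only_Bss 12) => //; [rewrite numE; field|ring].
case: i => [_ j25|i].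
  by apply: (@only_Bss 3) => //; [rewrite numE; field|ring].
case: i => [_ j25|i].
  by apply: (@only_Bss 19) => //; [rewrite numE; field|ring].
case: i => [_ j25|i].
  by apply: (@only_Bss 32) => //; [rewrite numE; field|ring].
case: i => [_ j25|i].
  by apply: (@only_Bss 8) => //; [rewrite numE; field|ring].
case: i => [_ j25|i].
  by apply: (@only_Bss 6) => //; [rewrite numE; field|ring].
case: i => [_ j25|i].
  by apply: (@only_Bss 27) => //; [rewrite numE; field|ring].
case: i => [_ j25|i].
  by apply: (@only_Bss 34) => //; [rewrite numE; field|ring].
case: i => [_ j25|i].
  by apply: (@only_Bss 9) => //; [rewrite numE; field|ring].
case: i => [_ j25|i].
  by apply: (@only_Bss 14) => //; [rewrite numE; field|ring].
case: i => [_ j25|i].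
  by apply: (@only_Bss 72) => //; [rewrite numE; field|ring].
case: i => [_ j25|i].
  by apply: (@only_assoc _ 0) => //; field.
case: i => [_ j25|i].
  by apply: (@only_assoc _ 10) => //; field.
case: i => [_ j25|i].
  by apply: (@only_assoc _ 5) => //; field.
case: i => [_ j25|i].
  by apply: (@only_assoc _ 20) => //; field.
case: i => [_ j25|i]; first by apply: (@only_Bsn0 0) => //; field.
case: i => [_ j25|i].
  (* The ratio of [qM] to [nu] is 1 for this table and for the next one; only the two [wedge]
     conditions decide between them. The number 2 of [E2] is the parameter of no [C4] code, which
     rules out all of these. *)
  have E1 : 0 ^+ 2 + h ^+ 2 = 1%:R / 4 :> K by field.
  have E2 : 10 * (0 + h) ^+ 2 = 2%:R * (5 / 4 : K) by field.
  move/(cond_Bsnr (isT : 1%N \in vals2) E1 E2 isT).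
  by case25 j j25.
case: i => [_ j25|i].
  have E1 : 0 ^+ 2 + h ^+ 2 = 1%:R / 4 :> K by field.
  have E2 : 10 * (0 + h) ^+ 2 = 2%:R * (5 / 4 : K) by field.
  move/(cond_Bsnl (isT : 1%N \in vals2) E1 E2 isT).
  by case25 j j25.
case: i => [_ j25|i]; first by apply: (@only_Bsn0 4) => //; field.
case: i => [_ j25|i]; first by apply: (@only_Bsn0 2) => //; field.
case: i => [_ j25|i].
  have E1 : h ^+ 2 + 1 ^+ 2 = 5%:R / 4 :> K by field.
  have E2 : 10 * (h + 1) ^+ 2 = 18%:R * (5 / 4 : K) by field.
  move/(cond_Bsnr (isT : 5%N \in vals2) E1 E2 isT).
  by case25 j j25.
case: i => [_ j25|i].
  have E1 : h ^+ 2 + 1 ^+ 2 = 5%:R / 4 :> K by field.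
  have E2 : 10 * (h + 1) ^+ 2 = 18%:R * (5 / 4 : K) by field.
  move/(cond_Bsnl (isT : 5%N \in vals2) E1 E2 isT).
  by case25 j j25.
case: i => [_ j25|i]; first by apply: (@only_Bsn0 8) => //; field.
by [].
Qed.

Let cond1_Bss m x y x' y' p q : numA (Bss x y x' y' p q) = m%:R -> cond1 m (Bss x y x' y' p q).
Proof.
move=> E; have [D _ _ _] := Bss_inv x y x' y' p q.
by rewrite /cond1 D mul1r sep_neq0 ?oner_eq0 // E mulr1.
Qed.

Lemma stratum_cond_tabs i : (i < 24)%N -> stratum_cond i (nth (tab16 0) (tabs K) i).
Proof.
have numE x y x' y' p q := let: And4 _ E _ _ := Bss_inv x y x' y' p q in E.
have four_neq0 : (4^-1 : K) != 0 by rewrite invr_eq0 pnatr_eq0.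
do 4! (case: i => [_|i]; first by apply: cond1_Bss; rewrite numE; field).
do 2! (case: i => [_|i];
  first by split; [apply: cond1_Bss; rewrite numE; field|rewrite /= oner_eq0 orbT]).
do 6! (case: i => [_|i]; first by apply: cond1_Bss; rewrite numE; field).
do 4! (case: i => [_|i]; first by
  apply: cond4_Bsn => //; rewrite ?mulr1 ?oner_eq0 //;
  [field|rewrite ?expr1n ?expr0n ?addr0 ?oner_eq0 -?[1 + 1]/(2%:R) ?pnatr_eq0|field]).
case: i => [_|i]; first by apply: cond2_Bsn; rewrite ?mulr0 //; field.
case: i => [_|i].
  split; first by apply: cond2_Bsn; rewrite ?mulr0 ?mul0r //; field.
  exists 1, 0, 0, 1; rewrite Bsn_wedger.
  rewrite [X in X != 0](_ : _ = - (3 / 2)); last by field.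
  by rewrite ?oppr_eq0 mulf_neq0 ?invr_eq0 ?pnatr_eq0.
case: i => [_|i].
  split; first by apply: cond2_Bsn; rewrite ?mulr0 ?mul0r //; field.
  exists 1, 0, 1, 0; rewrite Bsn_wedgel.
  rewrite [X in X != 0](_ : _ = 3 / 2); last by field.
  by rewrite ?oppr_eq0 mulf_neq0 ?invr_eq0 ?pnatr_eq0.
case: i => [_|i]; first by apply: cond2_Bsn; rewrite ?mulr0 //; field.
case: i => [_|i]; first by apply: cond2_Bsn; rewrite ?mulr0 //; field.
case: i => [_|i].
  split; first by apply: cond2_Bsn; rewrite ?mulr0 ?mul0r //; field.
  exists 1, 0, 0, 1; rewrite Bsn_wedger.
  rewrite [X in X != 0](_ : _ = - (3 / 2)); last by field.
  by rewrite ?oppr_eq0 mulf_neq0 ?invr_eq0 ?pnatr_eq0.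
case: i => [_|i].
  split; first by apply: cond2_Bsn; rewrite ?mulr0 ?mul0r //; field.
  exists 1, 0, 1, 0; rewrite Bsn_wedgel.
  rewrite [X in X != 0](_ : _ = 3 / 2); last by field.
  by rewrite ?oppr_eq0 mulf_neq0 ?invr_eq0 ?pnatr_eq0.
case: i => [_|i]; first by apply: cond2_Bsn; rewrite ?mulr0 //; field.
by [].
Qed.

Lemma numA_tab16 t : numA (tab16 t) = 16%:R :> K.
Proof. by have [_ -> _ _] := Bss_inv h h h h 1 t; field. Qed.

Lemma stratum_cond_tab16_inj t j : (j < 25)%N -> stratum_cond j (tab16 t : tab K) -> j = 24%N.
Proof. by move=> j25; apply: (@only_Bss 16) => //; [exact: numA_tab16|ring]. Qed.

Lemma stratum_cond_tab16 t : stratum_cond 24 (tab16 t : tab K).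
Proof. by split; [apply: cond1_Bss; exact: numA_tab16|rewrite /= oner_eq0]. Qed.

Lemma qjordan_tab16 t : qjordan (tab16 t : tab K).
Proof.
pose c := @polyC K.
pose W := Tab 1%:P 0 0 0 0 1%:P (c h) 0 0 (c h) (c h) 0 0 (c h) 1%:P 'X.
have We s : tev W s = tab16 s.
  by apply: Tab_eq; rewrite /= ?hornerX ?hornerC.
have [d0 d1 d2] := intr_double K.
rewrite -We; apply: qjordan_affine => [|n n4].
  do ! split; rewrite ?size_polyX ?size_poly0 ?size_polyC //;
  by case: eqP.
rewrite We; have : jordan_check (Tab (Posz 2) 0%N 0%N 0%N 0%N 2%N 1%N 0%N 0%N 1%N 1%N 0%N 0%N 1%N 2%N (2 * n)%N).
  by case: n n4 => [|[|[|[|//]]]] _; vm_compute.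
move/qjordan_check; apply; apply: Tab_eq;
  first [exact: d0|exact: d1|exact: d2|by rewrite /= -pmulrn natrM].
Qed.

Lemma dtabsE i : (i < 24)%N ->
  tmap intr (nth (dBss 0 0 0 0 0 0) dtabs i) = tmap (fun c => 2%:R * c) (nth (tab16 0) (tabs K) i).
Proof.
have [d0 d1 d2] := intr_double K.
do 24! (case: i => [_|i]; first by apply: Tab_eq; first [exact: d0|exact: d1|exact: d2]).
by [].
Qed.

Lemma qjordan_tabs i : (i < 24)%N -> qjordan (nth (tab16 0) (tabs K) i).
Proof.
move=> i24; apply: (qjordan_check _ (dtabsE i24)).
have : all jordan_check dtabs by vm_compute.
by move/(all_nthP (dBss 0 0 0 0 0 0)); apply.
Qed.

End ConditionsOfTables.

(** * Normal forms of Jordan tables *)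

Section Reduction.
Variable K : numClosedFieldType.
Implicit Types (w : tab K) (G H M : mat K).
Local Notation h := (2^-1 : K).

Definition even_part w := (ca0 w, ca1 w, cb0 w, cb1 w, cc0 w, cc1 w).
Definition Lx w := M2 (cx00 w) (cx01 w) (cx10 w) (cx11 w).
Definition Ly w := M2 (cy00 w) (cy01 w) (cy10 w) (cy11 w).

Lemma iso_even w g00 g01 g10 g11 a0 a1 b0 b1 c0 c1 :
  g00 * g11 - g01 * g10 != 0 ->
  ev0 w g00 g10 g00 g10 = g00 * a0 + g01 * a1 /\ ev1 w g00 g10 g00 g10 = g10 * a0 + g11 * a1 ->
  ev0 w g00 g10 g01 g11 = g00 * b0 + g01 * b1 /\ ev1 w g00 g10 g01 g11 = g10 * b0 + g11 * b1 ->
  ev0 w g01 g11 g01 g11 = g00 * c0 + g01 * c1 /\ ev1 w g01 g11 g01 g11 = g10 * c0 + g11 * c1 ->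
  exists2 w', iso w w' & even_part w' = (a0, a1, b0, b1, c0, c1).
Proof.
move=> d0 E1 E2 E3; exists (Tab a0 a1 b0 b1 c0 c1
  (g00 * cx00 w + g10 * cy00 w) (g00 * cx01 w + g10 * cy01 w)
  (g00 * cx10 w + g10 * cy10 w) (g00 * cx11 w + g10 * cy11 w)
  (g01 * cx00 w + g11 * cy00 w) (g01 * cx01 w + g11 * cy01 w)
  (g01 * cx10 w + g11 * cy10 w) (g01 * cx11 w + g11 * cy11 w)
  ((g11 * cp0 w - g01 * cp1 w) / (g00 * g11 - g01 * g10))
  ((g00 * cp1 w - g10 * cp0 w) / (g00 * g11 - g01 * g10))) => //.
apply: (@isoI _ _ _ (M2 g00 g01 g10 g11) (M2 1 0 0 1)) => //.
  by rewrite /= mulr0 subr0 mulr1 oner_neq0.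
by split; [split|rewrite /od0 /od1 /=; split; split; field].
Qed.

Lemma iso_odd w H x00 x01 x10 x11 y00 y01 y10 y11 : mdet H != 0 ->
  mmul (Lx w) H = mmul H (M2 x00 x01 x10 x11) ->
  mmul (Ly w) H = mmul H (M2 y00 y01 y10 y11) ->
  iso w (Tab (ca0 w) (ca1 w) (cb0 w) (cb1 w) (cc0 w) (cc1 w) x00 x01 x10 x11
             y00 y01 y10 y11 (mdet H * cp0 w) (mdet H * cp1 w)).
Proof.
case: H => a b c d H0 [E1 E2 E3 E4] [F1 F2 F3 F4].
apply: (@isoI _ _ _ (M2 1 0 0 1) (M2 a b c d)) => //.
  by rewrite /= mulr0 subr0 mulr1 oner_neq0.
split; first by rewrite /ev0 /ev1 /=; split; split; ring.
rewrite /od0 /od1 !(mul0r, mul1r, mulr0, addr0, add0r).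
by split; split; rewrite /= -?E1 -?E2 -?E3 -?E4 -?F1 -?F2 -?F3 -?F4; ring.
Qed.

Lemma conj_ex H M : mdet H != 0 ->
  exists x00 x01 x10 x11, mmul M H = mmul H (M2 x00 x01 x10 x11).
Proof.
case: H M => a b c d [x y z t] /= H0; pose k := (a * d - b * c)^-1.
exists (k * (d * (x * a + y * c) - b * (z * a + t * c))),
  (k * (d * (x * b + y * d) - b * (z * b + t * d))),
  (k * (a * (z * a + t * c) - c * (x * a + y * c))),
  (k * (a * (z * b + t * d) - c * (x * b + y * d))).
by rewrite /k; apply: M2_eq; field.
Qed.

(** For a root l of the characteristic polynomial and b nonzero, (b, l - a) is an eigenvector; it is
    put second in the basis so that the matrix becomes lower triangular. *)
Lemma triangular M : exists H x y z, mdet H != 0 /\ mmul M H = mmul H (M2 x 0 z y).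
Proof.
case: M => a b c d; have [->|b0] := eqVneq b 0.
  exists (M2 1 0 0 1), a, d, c; rewrite /= mulr0 subr0 mulr1 oner_neq0; split=> //.
  by apply: M2_eq; ring.
pose r := sqrtC ((a + d) ^+ 2 - 4 * (a * d - b * c)).
have r2 : r ^+ 2 = (a + d) ^+ 2 - 4 * (a * d - b * c) by rewrite sqrtCK.
pose l := (a + d + r) / 2.
have l2 : l ^+ 2 = (a + d) * l - (a * d - b * c).
  transitivity ((r ^+ 2 + 2 * (a + d) * r + (a + d) ^+ 2) / 4); first by rewrite /l; field.
  by rewrite r2 /l; field.
exists (M2 0 b 1 (l - a)), (a + d - l), l, 1; split.
  by rewrite /= mul0r sub0r mulr1 oppr_eq0.
apply: M2_eq; try ring.
by transitivity ((a + d) * l - (a * d - b * c) - a * l); [ring|rewrite -l2; ring].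
Qed.

(** The hypothesis says that x = (s, t) and x^2 are independent; they are the new basis. *)
Lemma even_generator w s t : s * ev1 w s t s t - t * ev0 w s t s t != 0 ->
  exists2 w', iso w w' & exists l m c0 c1, even_part w' = (0, 1, l, m, c0, c1).
Proof.
set u := ev0 w s t s t; set v := ev1 w s t s t => d0; pose d := s * v - t * u.
have d1 : s * v - u * t != 0 by rewrite [u * t]mulrC.
pose l x y := (v * x - u * y) / (s * v - u * t); pose m x y := (s * y - t * x) / (s * v - u * t).
pose b0 := ev0 w s t u v; pose b1 := ev1 w s t u v.
pose c0 := ev0 w u v u v; pose c1 := ev1 w u v u v.
have [] := @iso_even w s u t v 0 1 (l b0 b1) (m b0 b1) (l c0 c1) (m c0 c1) d1.
- by rewrite -/u -/v; split; ring.
- by rewrite -/b0 -/b1 /l /m; split; field.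
- by rewrite -/c0 -/c1 /l /m; split; field.
by move=> w' I E; exists w' => //; exists (l b0 b1), (m b0 b1), (l c0 c1), (m c0 c1).
Qed.

(* The even part is generated by x with x (x - r) (x - s) = 0. *)
Lemma even_cubic w r s : even_part w = (0, 1, - (r * s), r + s, - (r * s) * (r + s), - (r * s) + (r + s) ^+ 2) ->
  exists2 w', iso w w' & even_part w' = (1, 0, 0, 0, 0, 1) \/ even_part w' = (1, 0, 0, 1, 0, 0) \/
    even_part w' = (1, 0, 0, 0, 0, 0) \/ even_part w' = (0, 1, 0, 0, 0, 0).
Proof.
wlog s0 : r s / r = 0 -> s = 0.
  have [r0|r0] := eqVneq r 0; last by apply=> e; rewrite e eqxx in r0.
  by move=> H E; apply: (H s r); rewrite 1?[s * r]mulrC 1?[s + r]addrC // r0.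
have evE a0 a1 b0 b1 c0 c1 r0 r1 q0 q1 : even_part w = (a0, a1, b0, b1, c0, c1) ->
    ev0 w r0 r1 q0 q1 = a0 * (r0 * q0) + b0 * (r0 * q1 + r1 * q0) + c0 * (r1 * q1) /\
    ev1 w r0 r1 q0 q1 = a1 * (r0 * q0) + b1 * (r0 * q1 + r1 * q0) + c1 * (r1 * q1).
  by rewrite /ev0 /ev1 => -[-> -> -> -> -> ->].
move=> E; have {}evE r0 r1 q0 q1 := evE _ _ _ _ _ _ r0 r1 q0 q1 E.
have [r0|r0] := eqVneq r 0.
  exists w; first exact: iso_refl.
  by do 3! right; rewrite E s0 // r0 !(mulr0, mul0r, oppr0, addr0, expr0n).
(* For a double root r, 2 x / r - x^2 / r^2 is a unit of the even part and x^2 / r - x has square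
   zero. *)
have [e|rs] := eqVneq r s.
  have d0 : 2 / r * r^-1 - (-1) * - (r ^+ 2)^-1 != 0.
    have -> : 2 / r * r^-1 - (-1) * - (r ^+ 2)^-1 = (r ^+ 2)^-1 by field.
    by rewrite invr_eq0 expf_neq0.
  have [] := @iso_even w (2 / r) (-1) (- (r ^+ 2)^-1) (r^-1) 1 0 0 1 0 0 d0.
  - by case: (evE (2 / r) (- (r ^+ 2)^-1) (2 / r) (- (r ^+ 2)^-1)) => -> ->; rewrite -e; split; field.
  - by case: (evE (2 / r) (- (r ^+ 2)^-1) (-1) (r^-1)) => -> ->; rewrite -e; split; field.
  - by case: (evE (-1) (r^-1) (-1) (r^-1)) => -> ->; rewrite -e; split; field.
  by move=> w' I F; exists w' => //; right; left.
have rs0 : r - s != 0 by rewrite subr_eq0.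
have [e|s1] := eqVneq s 0.
  have d0 : 0 * (- r^-1) - 1 * (r ^+ 2)^-1 != 0.
    by rewrite mul0r sub0r mul1r oppr_eq0 invr_eq0 expf_neq0.
  have [] := @iso_even w 0 1 ((r ^+ 2)^-1) (- r^-1) 1 0 0 0 0 0 d0.
  - by case: (evE 0 ((r ^+ 2)^-1) 0 ((r ^+ 2)^-1)) => -> ->; rewrite e; split; field.
  - by case: (evE 0 ((r ^+ 2)^-1) 1 (- r^-1)) => -> ->; rewrite e; split; field.
  - by case: (evE 1 (- r^-1) 1 (- r^-1)) => -> ->; rewrite e; split; field.
  by move=> w' I F; exists w' => //; right; right; left.
(* Lagrange interpolation: x (x - s) / (r (r - s)) and x (r - x) / (s (r - s)) are the orthogonal
   idempotents attached to the roots r and s. *)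
pose g00 := - s / (r * (r - s)); pose g10 := (r * (r - s))^-1.
pose g01 := r / (s * (r - s)); pose g11 := - (s * (r - s))^-1.
have d0 : g00 * g11 - g01 * g10 != 0.
  have -> : g00 * g11 - g01 * g10 = - (r * s * (r - s))^-1.
    by rewrite /g00 /g01 /g10 /g11; field; rewrite r0 s1 rs0.
  by rewrite oppr_eq0 invr_eq0 !mulf_neq0.
have [] := @iso_even w g00 g01 g10 g11 1 0 0 0 0 1 d0.
- by case: (evE g00 g10 g00 g10) => -> ->; rewrite /g00 /g01 /g10 /g11; split; field; rewrite r0 s1 rs0.
- by case: (evE g00 g10 g01 g11) => -> ->; rewrite /g00 /g01 /g10 /g11; split; field; rewrite r0 s1 rs0.
- by case: (evE g01 g11 g01 g11) => -> ->; rewrite /g00 /g01 /g10 /g11; split; field; rewrite r0 s1 rs0.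
by move=> w' I F; exists w' => //; left.
Qed.

(** The Jordan identity with all four arguments x reads 3 x (x x^2) = 3 x^2 x^2, and x^3 = l x + m
    x^2 determines the left side. *)
Lemma qjordan_cubic w l m c0 c1 : qjordan w -> even_part w = (0, 1, l, m, c0, c1) ->
  c0 = l * m /\ c1 = l + m ^+ 2.
Proof.
case: w => a0 a1 b0 b1 d0 d1 x00 x01 x10 x11 y00 y01 y10 y11 p q J.
rewrite /even_part /= => -[e0 e1 e2 e3 e4 e5]; move: J; rewrite e0 e1 e2 e3 e4 e5 => J.
by split; apply/eqP; rewrite -subr_eq0; apply/eqP;
  [jrel J (0, 0, 0, 0, 0)%N (- 3^-1)|jrel J (0, 0, 0, 0, 1)%N (- 3^-1)].
Qed.

(** If some x is independent of x^2, the even part is generated by x and the cubic case applies.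
    Otherwise x^2 = f(x) x for all x, with f a linear form as seen on (1, 0), (0, 1), (1, 1) and (1,
    -1). Then either f = 0 and the product is zero, or e with f(e) = 1 and n in the kernel of f
    satisfy e^2 = e, e n = n / 2 and n^2 = 0. *)
Lemma even_normal w : qjordan w ->
  exists2 w', iso w w' & even_part w' = (1, 0, 0, 0, 0, 1) \/ even_part w' = (1, 0, 0, 1, 0, 0) \/
    even_part w' = (1, 0, 0, 0, 0, 0) \/ even_part w' = (0, 1, 0, 0, 0, 0) \/
    even_part w' = (1, 0, 0, h, 0, 0) \/ even_part w' = (0, 0, 0, 0, 0, 0).
Proof.
move=> J.
have gen s t : s * ev1 w s t s t - t * ev0 w s t s t != 0 ->
  exists2 w', iso w w' & even_part w' = (1, 0, 0, 0, 0, 1) \/ even_part w' = (1, 0, 0, 1, 0, 0) \/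
    even_part w' = (1, 0, 0, 0, 0, 0) \/ even_part w' = (0, 1, 0, 0, 0, 0) \/
    even_part w' = (1, 0, 0, h, 0, 0) \/ even_part w' = (0, 0, 0, 0, 0, 0).
  case/even_generator=> w' I [l [m [c0 [c1 E]]]].
  have [e0 e1] := qjordan_cubic (iso_jordan I J) E.
  pose d := sqrtC (m ^+ 2 + 4 * l).
  have d2 : d ^+ 2 = m ^+ 2 + 4 * l by rewrite sqrtCK.
  have el : l = - ((m + d) / 2 * ((m - d) / 2)).
    transitivity ((d ^+ 2 - m ^+ 2) / 4); last by field.
    by rewrite d2; field.
  have em : m = (m + d) / 2 + (m - d) / 2 by field.
  have [|w'' I' F] := @even_cubic w' ((m + d) / 2) ((m - d) / 2).
    by rewrite -em -el E e0 e1.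
  exists w''; first exact: iso_trans I I'.
  by case: F => [|[|[|]]] ->; do ? [by left | right].
have [e1|] := eqVneq (ca1 w) 0; last first.
  by move=> a1; apply: (gen 1 0); apply: contraNneq a1 => <-; rewrite /ev0 /ev1; apply/eqP; ring.
have [e2|] := eqVneq (cc0 w) 0; last first.
  move=> a1; apply: (gen 0 1); apply: contraNneq a1 => e; rewrite -oppr_eq0 -e.
  by rewrite /ev0 /ev1; apply/eqP; ring.
have [e3|] := eqVneq (1 * ev1 w 1 1 1 1 - 1 * ev0 w 1 1 1 1) 0; last exact: gen.
have [e4|] := eqVneq (1 * ev1 w 1 (-1) 1 (-1) - (-1) * ev0 w 1 (-1) 1 (-1)) 0; last exact: gen.
have f1 : cb1 w = ca0 w / 2.
  apply/eqP; rewrite -subr_eq0; apply/eqP.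
  transitivity (((1 * ev1 w 1 1 1 1 - 1 * ev0 w 1 1 1 1) - (1 * ev1 w 1 (-1) 1 (-1) - (-1) * ev0 w 1 (-1) 1 (-1)) - 2 * ca1 w * 0 + 2 * cc0 w) / 4).
    by rewrite /ev0 /ev1 e1 e2; field.
  by rewrite e3 e4 e2; ring.
have f2 : cb0 w = cc1 w / 2.
  apply/eqP; rewrite -subr_eq0; apply/eqP.
  transitivity (- ((1 * ev1 w 1 1 1 1 - 1 * ev0 w 1 1 1 1) + (1 * ev1 w 1 (-1) 1 (-1) - (-1) * ev0 w 1 (-1) 1 (-1))) / 4 + ca1 w / 2).
    by rewrite /ev0 /ev1 e1 e2; field.
  by rewrite e3 e4 e1; ring.
have [a0|a0] := eqVneq (ca0 w) 0.
  have [c0|c0] := eqVneq (cc1 w) 0.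
    exists w; first exact: iso_refl.
    by do 5! right; rewrite /even_part e1 e2 f1 f2 a0 c0 mul0r.
  have d0 : 0 * 0 - 1 * (cc1 w)^-1 != 0.
    by rewrite mul0r sub0r mul1r oppr_eq0 invr_eq0.
  have [] := @iso_even w 0 1 ((cc1 w)^-1) 0 1 0 0 h 0 0 d0.
  - by rewrite /ev0 /ev1 e1 e2 f1 f2 a0; split; field.
  - by rewrite /ev0 /ev1 e1 e2 f1 f2 a0; split; field.
  - by rewrite /ev0 /ev1 e1 e2 f1 f2 a0; split; field.
  by move=> w' I F; exists w' => //; do 4! right; left.
have d0 : (ca0 w)^-1 * ca0 w - (- cc1 w) * 0 != 0.
  by rewrite mulr0 subr0 mulVf // oner_neq0.
have [] := @iso_even w ((ca0 w)^-1) (- cc1 w) 0 (ca0 w) 1 0 0 h 0 0 d0.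
- by rewrite /ev0 /ev1 e1 e2 f1 f2; split; field.
- by rewrite /ev0 /ev1 e1 e2 f1 f2; split; field.
- by rewrite /ev0 /ev1 e1 e2 f1 f2; split; field.
by move=> w' I F; exists w' => //; do 4! right; left.
Qed.

End Reduction.

(** * Polynomial curves and limits of the listed tables *)

Section Curves.
Variable K : numClosedFieldType.

Definition ispoly (f : K -> K) := exists p : {poly K}, forall s, f s = p.[s].

Lemma ispolyC c : ispoly (fun=> c).
Proof. by exists c%:P => s; rewrite hornerC. Qed.

Lemma ispolyX : ispoly id.
Proof. by exists 'X => s; rewrite hornerX. Qed.

Lemma ispolyD f g : ispoly f -> ispoly g -> ispoly (fun s => f s + g s).
Proof. by move=> [p E] [q E']; exists (p + q) => s; rewrite E E' hornerD. Qed.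

Lemma ispolyN f : ispoly f -> ispoly (fun s => - f s).
Proof. by move=> [p E]; exists (- p) => s; rewrite E hornerN. Qed.

Lemma ispolyM f g : ispoly f -> ispoly g -> ispoly (fun s => f s * g s).
Proof. by move=> [p E] [q E']; exists (p * q) => s; rewrite E E' hornerM. Qed.

Definition tpoly (c : K -> tab K) := exists W, forall s, c s = tev W s.

Lemma tpolyI c0 c1 c2 c3 c4 c5 c6 c7 c8 c9 d0 d1 d2 d3 d4 d5 :
  [/\ ispoly c0, ispoly c1, ispoly c2 & ispoly c3] ->
  [/\ ispoly c4, ispoly c5, ispoly c6 & ispoly c7] ->
  [/\ ispoly c8, ispoly c9, ispoly d0 & ispoly d1] ->
  [/\ ispoly d2, ispoly d3, ispoly d4 & ispoly d5] ->
  tpoly (fun s => Tab (c0 s) (c1 s) (c2 s) (c3 s) (c4 s) (c5 s) (c6 s) (c7 s)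
                      (c8 s) (c9 s) (d0 s) (d1 s) (d2 s) (d3 s) (d4 s) (d5 s)).
Proof.
move=> [[P0 E0] [P1 E1] [P2 E2] [P3 E3]] [[P4 E4] [P5 E5] [P6 E6] [P7 E7]].
move=> [[P8 E8] [P9 E9] [Q0 F0] [Q1 F1]] [[Q2 F2] [Q3 F3] [Q4 F4] [Q5 F5]].
exists (Tab P0 P1 P2 P3 P4 P5 P6 P7 P8 P9 Q0 Q1 Q2 Q3 Q4 Q5) => s.
by rewrite /tev /tmap /= -E0 -E1 -E2 -E3 -E4 -E5 -E6 -E7 -E8 -E9 -F0 -F1 -F2 -F3 -F4 -F5.
Qed.

End Curves.

Ltac ispoly := repeat first
  [exact: ispolyC | exact: ispolyX | apply: ispolyD | apply: ispolyN | apply: ispolyM].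
Ltac tpoly := apply: tpolyI; split; ispoly.

Section Good.
Variable K : numClosedFieldType.
Implicit Types (w : tab K) (x y p q s t : K) (i j m : nat).
Local Notation h := (2^-1 : K).
Local Notation ncodej j := (ncode (nth (C1 0) codes j)).

(* Z stands for the closure of the union of the strata. *)
Variable Z : tab K -> Prop.
Hypothesis Z_iso : forall w w', iso w w' -> Z w' -> Z w.
Hypothesis Z_lim : forall c : K -> tab K, tpoly c -> (forall s, s != 0 -> Z (c s)) -> Z (c 0).
Hypothesis Z_stratum : forall j w, (j < 25)%N -> stratum j w -> Z w.

(** The first half yields density of the union of the strata, the second that each stratum is open
    in the variety. Both are transported by [iso], so it suffices to treat normal forms. *)
Definition good w := Z w /\ forall j, (j < 25)%N -> stratum_cond j w -> stratum j w.

Lemma stratum_iso j w w' : iso w w' -> stratum j w' -> stratum j w.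
Proof.
rewrite /stratum => I; case: ifP => _; first exact: iso_trans.
by case=> t I'; exists t; apply: iso_trans I'.
Qed.

Lemma good_iso w w' : iso w w' -> good w' -> good w.
Proof.
move=> I [Zw' G]; split; first exact: Z_iso Zw'.
by move=> j j25 /(stratum_cond_iso j I) /(G j j25); exact: stratum_iso.
Qed.

Lemma good_stratum i w : (i < 25)%N -> stratum i w -> good w.
Proof.
move=> i25 Xw; split; first exact: Z_stratum Xw.
move=> j j25 Uw; suff -> : j = i by [].
move: Xw; rewrite /stratum; case: ifP => [i24 I|i24 [t I]].
  exact: stratum_cond_tabs_inj i24 j25 ((stratum_cond_iso j I).1 Uw).
have -> : i = 24%N by apply/eqP; rewrite eqn_leq -ltnS i25 /= leqNgt i24.
exact: stratum_cond_tab16_inj j25 ((stratum_cond_iso j I).1 Uw).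
Qed.

Lemma good_tab i : (i < 24)%N -> good (nth (tab16 0) (tabs K) i).
Proof.
by move=> i24; apply: (@good_stratum i); [exact: ltn_trans i24 _|rewrite /stratum i24; exact: iso_refl].
Qed.

Lemma good_dead w : Z w -> (forall j, (j < 25)%N -> ~ stratum_cond j w) -> good w.
Proof. by move=> Zw N; split=> // j j25 /(N j j25). Qed.

Lemma Bss_swap_odd x y x' y' p q : iso (Bss x y x' y' p q) (Bss y x y' x' (- p) (- q)).
Proof.
apply: (@isoI _ _ _ (M2 1 0 0 1) (M2 0 1 1 0)).
- by rewrite /= mulr0 subr0 mulr1 oner_neq0.
- by rewrite /= mulr0 sub0r mulr1 oppr_eq0 oner_neq0.
by rewrite /iso_eqs /ev0 /ev1 /od0 /od1 /=; do 2! split; split; ring.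
Qed.

Lemma Bss_swap_even x y x' y' p q : iso (Bss x y x' y' p q) (Bss x' y' x y q p).
Proof.
apply: (@isoI _ _ _ (M2 0 1 1 0) (M2 1 0 0 1)).
- by rewrite /= mulr0 sub0r mulr1 oppr_eq0 oner_neq0.
- by rewrite /= mulr0 subr0 mulr1 oner_neq0.
by rewrite /iso_eqs /ev0 /ev1 /od0 /od1 /=; do 2! split; split; ring.
Qed.

Lemma Bss_scale k x y x' y' p q : k != 0 ->
  iso (Bss x y x' y' p q) (Bss x y x' y' (k * p) (k * q)).
Proof.
move=> k0; apply: (@isoI _ _ _ (M2 1 0 0 1) (M2 k 0 0 1)).
- by rewrite /= mulr0 subr0 mulr1 oner_neq0.
- by rewrite /= mulr0 subr0 mulr1.
by rewrite /iso_eqs /ev0 /ev1 /od0 /od1 /=; do 2! split; split; ring.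
Qed.

(** The value of [numA] leaves only the condition of index [i], which also requires f_0 f_1 to be
    nonzero; hence no condition holds and being a limit is enough. *)
Lemma good_Bss_p0 i m x y x' y' : (i < 25)%N -> ncodej i = m -> nth (C1 0) codes i = C1p m ->
  m \in vals1 -> numA (Bss x y x' y' 0 0) = m%:R ->
  Z (Bss x y x' y' 0 0) -> good (Bss x y x' y' 0 0).
Proof.
move=> i25 Ei Ci mv Em Zw; apply: good_dead => // j j25 Uj.
have W0 : 0 * (y - x) + 0 * (y' - x') = 0 :> K by ring.
have := cond_Bss_p0 j25 mv Em W0 Uj; rewrite -Ei => /(ncode_inj j25 i25) E.
by move: Uj; rewrite E /stratum_cond Ci => -[_]; rewrite /= eqxx.
Qed.

Let numE x y x' y' p q := let: And4 _ E _ _ := Bss_inv x y x' y' p q in E.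

Lemma good_Bss_0011 q : good (Bss 0 0 1 1 0 q).
Proof.
have good1 s : s != 0 -> good (Bss 0 0 1 1 0 s).
  move=> s0; apply: good_iso (Bss_scale _ _ _ _ _ _ (invr_neq0 s0)) _.
  by rewrite mulr0 mulVf //; apply: (@good_tab 4).
case: (eqVneq q 0) => [->|]; last exact: good1.
apply: (@good_Bss_p0 4 32) => //; first by rewrite numE; field.
apply: (Z_lim (c := fun s => Bss 0 0 1 1 0 s)); first by tpoly.
by move=> s /good1[].
Qed.

Lemma good_Bss_00hh q : good (Bss 0 0 h h 0 q).
Proof.
have good1 s : s != 0 -> good (Bss 0 0 h h 0 s).
  move=> s0; apply: good_iso (Bss_scale _ _ _ _ _ _ (invr_neq0 s0)) _.
  by rewrite mulr0 mulVf //; apply: (@good_tab 5).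
case: (eqVneq q 0) => [->|]; last exact: good1.
apply: (@good_Bss_p0 5 8) => //; first by rewrite numE; field.
apply: (Z_lim (c := fun s => Bss 0 0 h h 0 s)); first by tpoly.
by move=> s /good1[].
Qed.

(** Up to scaling only the ratio of p and q matters. The family covers p nonzero, exchanging the
    idempotents gives p = 0 with q nonzero, and p = q = 0 is a limit. *)
Lemma good_Bss_hhhh p q : good (Bss h h h h p q).
Proof.
have good1 s t : s != 0 -> good (Bss h h h h s t).
  move=> s0; apply: (@good_stratum 24) => //; exists (s^-1 * t).
  by have := Bss_scale h h h h s t (invr_neq0 s0); rewrite mulVf.
case: (eqVneq p 0) => [->|]; last exact: good1.
case: (eqVneq q 0) => [->|q0]; last first.
  by apply: good_iso (Bss_swap_even _ _ _ _ _ _) _; exact: good1.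
apply: (@good_Bss_p0 24 16) => //; first by rewrite numE; field.
apply: (Z_lim (c := fun s => Bss h h h h s 0)); first by tpoly.
by move=> s /good1-/(_ 0)[].
Qed.

(* The possible eigenvalues of two orthogonal idempotents on an odd vector. *)
Definition weight x x' :=
  [|| (x == 0) && (x' == 0), (x == 0) && (x' == h), (x == 0) && (x' == 1),
      (x == h) && (x' == 0), (x == h) && (x' == h) | (x == 1) && (x' == 0)].

Lemma good_Bss0 x y x' y' : weight x x' -> weight y y' -> good (Bss x y x' y' 0 0).
Proof.
pose P a b c d := good (Bss a b c d 0 0); rewrite -/(P x y x' y').
have so a b c d : P b a d c -> P a b c d.
  by move=> G; apply: good_iso (Bss_swap_odd _ _ _ _ _ _) _; rewrite oppr0.
have se a b c d : P c d a b -> P a b c d.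
  by move=> G; apply: good_iso (Bss_swap_even _ _ _ _ _ _) _.
have g0 : P 0 0 0 0 := good_tab (isT : 0 < 24)%N.
have g1 : P 0 0 0 1 := good_tab (isT : 1 < 24)%N.
have g2 : P 0 0 0 h := good_tab (isT : 2 < 24)%N.
have g3 : P 0 0 1 h := good_tab (isT : 3 < 24)%N.
have g6 : P 0 h 0 h := good_tab (isT : 6 < 24)%N.
have g7 : P 0 h 1 0 := good_tab (isT : 7 < 24)%N.
have g8 : P 0 h 1 h := good_tab (isT : 8 < 24)%N.
have g9 : P 0 h h 0 := good_tab (isT : 9 < 24)%N.
have g10 : P 0 h h h := good_tab (isT : 10 < 24)%N.
have g11 : P 0 1 1 0 := good_tab (isT : 11 < 24)%N.
have g4 : P 0 0 1 1 := good_Bss_0011 0.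
have g5 : P 0 0 h h := good_Bss_00hh 0.
have g12 : P h h h h := good_Bss_hhhh 0 0.
rewrite /weight; move: P so se g0 g1 g2 g3 g4 g5 g6 g7 g8 g9 g10 g11 g12.
(* Once the three scalars are variables, the 36 pairs of weights are matched syntactically with the
   thirteen tables above, up to the two exchanges. *)
move=> P so se; move: (0 : K) (1 : K) h.
move=> z u v g0 g1 g2 g3 g4 g5 g6 g7 g8 g9 g10 g11 g12.
move=> /or4P[/andP[/eqP-> /eqP->]|/andP[/eqP-> /eqP->]|/andP[/eqP-> /eqP->]
  |/or3P[/andP[/eqP-> /eqP->]|/andP[/eqP-> /eqP->]|/andP[/eqP-> /eqP->]]].
all: move=> /or4P[/andP[/eqP-> /eqP->]|/andP[/eqP-> /eqP->]|/andP[/eqP-> /eqP->]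
  |/or3P[/andP[/eqP-> /eqP->]|/andP[/eqP-> /eqP->]|/andP[/eqP-> /eqP->]]].
all: first [assumption | apply: so; assumption | apply: se; assumption
  | apply: so; apply: se; assumption].
Qed.

Lemma Bsn_scale g k l mu x y b01 b10 q b01' b10' q' : g != 0 -> k != 0 -> l != 0 ->
  l * b10' = g * k * b10 -> k * b01' = g * l * b01 -> g * q' = k * l * q ->
  iso (Bsn mu x y 0 b01 b10 0 0 q) (Bsn mu x y 0 b01' b10' 0 0 q').
Proof.
move=> g0 k0 l0 E1 E2 E3; apply: (@isoI _ _ _ (M2 1 0 0 g) (M2 k 0 0 l)).
- by rewrite /= mulr0 subr0 mul1r.
- by rewrite /= mulr0 subr0 mulf_neq0.
rewrite /iso_eqs /ev0 /ev1 /od0 /od1 /= !(mul0r, mulr0, add0r, addr0, mulr1, mul1r, subr0).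
by rewrite E1 E2 E3; do 2! split; split; ring.
Qed.

(** If b and q are nonzero, a square root of 1 / (b q) rescales both to 1. Otherwise no condition
    holds by hypothesis, and the table is reached by letting first q, with b nonzero, and then b
    tend to 0. *)
Lemma good_Bsnl i mu x y b q : (i < 24)%N ->
  nth (tab16 0) (tabs K) i = Bsn mu x y 0 0 1 0 0 1 ->
  (forall b q, q * b = 0 -> forall j, (j < 25)%N -> ~ stratum_cond j (Bsn mu x y 0 0 b 0 0 q)) ->
  good (Bsn mu x y 0 0 b 0 0 q).
Proof.
move=> i24 Ei dead.
have G b' q' : b' != 0 -> q' != 0 -> good (Bsn mu x y 0 0 b' 0 0 q').
  move=> b0 q0; pose k := sqrtC (b' * q')^-1.
  have k2 : k ^+ 2 = (b' * q')^-1 by rewrite sqrtCK.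
  have k0 : k != 0 by rewrite sqrtC_eq0 invr_eq0 mulf_neq0.
  apply: good_iso (good_tab i24); rewrite Ei.
  apply: (@Bsn_scale 1 k (k * b')); rewrite ?oner_neq0 ?mulf_neq0 //; try ring.
  transitivity (k ^+ 2 * (b' * q')); last by ring.
  by rewrite k2 mulVf ?mulr1 // mulf_neq0.
have Zb b' q' : b' != 0 -> Z (Bsn mu x y 0 0 b' 0 0 q').
  move=> b0; case: (eqVneq q' 0) => [->|q0]; last by case: (G _ _ b0 q0).
  apply: (Z_lim (c := fun s => Bsn mu x y 0 0 b' 0 0 s)); first by tpoly.
  by move=> s s0; case: (G _ _ b0 s0).
have [e|] := eqVneq (q * b) 0; last first.
  by rewrite mulf_eq0 negb_or => /andP[q0 b0]; exact: G.
apply: good_dead; last exact: dead.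
case: (eqVneq b 0) => [->|b0]; last exact: Zb.
apply: (Z_lim (c := fun s => Bsn mu x y 0 0 s 0 0 q)); first by tpoly.
by move=> s; exact: Zb.
Qed.

Lemma good_Bsnr i mu x y b q : (i < 24)%N ->
  nth (tab16 0) (tabs K) i = Bsn mu x y 0 1 0 0 0 1 ->
  (forall b q, q * b = 0 -> forall j, (j < 25)%N -> ~ stratum_cond j (Bsn mu x y 0 b 0 0 0 q)) ->
  good (Bsn mu x y 0 b 0 0 0 q).
Proof.
move=> i24 Ei dead.
have G b' q' : b' != 0 -> q' != 0 -> good (Bsn mu x y 0 b' 0 0 0 q').
  move=> b0 q0; pose k := sqrtC (b' * q')^-1.
  have k2 : k ^+ 2 = (b' * q')^-1 by rewrite sqrtCK.
  have k0 : k != 0 by rewrite sqrtC_eq0 invr_eq0 mulf_neq0.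
  apply: good_iso (good_tab i24); rewrite Ei.
  apply: (@Bsn_scale 1 (k * b') k); rewrite ?oner_neq0 ?mulf_neq0 //; try ring.
  transitivity (k ^+ 2 * (b' * q')); last by ring.
  by rewrite k2 mulVf ?mulr1 // mulf_neq0.
have Zb b' q' : b' != 0 -> Z (Bsn mu x y 0 b' 0 0 0 q').
  move=> b0; case: (eqVneq q' 0) => [->|q0]; last by case: (G _ _ b0 q0).
  apply: (Z_lim (c := fun s => Bsn mu x y 0 b' 0 0 0 s)); first by tpoly.
  by move=> s s0; case: (G _ _ b0 s0).
have [e|] := eqVneq (q * b) 0; last first.
  by rewrite mulf_eq0 negb_or => /andP[q0 b0]; exact: G.
apply: good_dead; last exact: dead.
case: (eqVneq b 0) => [->|b0]; last exact: Zb.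
apply: (Z_lim (c := fun s => Bsn mu x y 0 s 0 0 0 q)); first by tpoly.
by move=> s; exact: Zb.
Qed.

Lemma dead_Bsn mu x y b p q j : mu - mu ^+ 2 = 0 -> q * b = 0 -> p * (y - x) = 0 ->
  ~ stratum_cond j (Bsn mu x y 0 0 b 0 p q).
Proof.
move=> mu0 qb pyx; have [D N _ _ _] := Bsn_inv mu x y 0 0 b 0 p q.
apply: cond_dead => // [s t|]; first by rewrite N mu0 mul0r.
by left=> r s; rewrite Bsn_wedge qb pyx; ring.
Qed.

Let mu0 : 0 - 0 ^+ 2 = 0 :> K. Proof. by ring. Qed.
Let mu1 : 1 - 1 ^+ 2 = 0 :> K. Proof. by ring. Qed.

Lemma good_Bsn0_00 b q : good (Bsn 0 0 0 0 0 b 0 0 q).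
Proof. by apply: (@good_Bsnl 12) => // ? ? e j _; apply: dead_Bsn => //; ring. Qed.

Lemma good_Bsn0_hh b q : good (Bsn 0 h h 0 0 b 0 0 q).
Proof. by apply: (@good_Bsnl 13) => // ? ? e j _; apply: dead_Bsn => //; ring. Qed.

Lemma good_Bsn1_hh b q : good (Bsn 1 h h 0 0 b 0 0 q).
Proof. by apply: (@good_Bsnl 14) => // ? ? e j _; apply: dead_Bsn => //; ring. Qed.

Lemma good_Bsn1_11 b q : good (Bsn 1 1 1 0 0 b 0 0 q).
Proof. by apply: (@good_Bsnl 15) => // ? ? e j _; apply: dead_Bsn => //; ring. Qed.

Ltac dead25 j e :=
  do 25! [case: j => [_|j]; [rewrite /=; first [done|by case|by rewrite e mul0r eqxx => -[]]|]];
  done.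

Let E0h : 0 ^+ 2 + h ^+ 2 = 1%:R / 4. Proof. by field. Qed.
Let E0h4 : 10 * (0 + h) ^+ 2 = 2%:R * (5 / 4). Proof. by field. Qed.
Let Eh1 : h ^+ 2 + 1 ^+ 2 = 5%:R / 4. Proof. by field. Qed.
Let Eh14 : 10 * (h + 1) ^+ 2 = 18%:R * (5 / 4). Proof. by field. Qed.

Lemma good_Bsnh_0h_r b q : good (Bsn h 0 h 0 b 0 0 0 q).
Proof.
apply: (@good_Bsnr 17) => // b' q' e j + /(cond_Bsnr (isT : 1%N \in vals2) E0h E0h4 isT).
by dead25 j e.
Qed.

Lemma good_Bsnh_0h_l b q : good (Bsn h 0 h 0 0 b 0 0 q).
Proof.
apply: (@good_Bsnl 18) => // b' q' e j + /(cond_Bsnl (isT : 1%N \in vals2) E0h E0h4 isT).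
by dead25 j e.
Qed.

Lemma good_Bsnh_h1_r b q : good (Bsn h h 1 0 b 0 0 0 q).
Proof.
apply: (@good_Bsnr 21) => // b' q' e j + /(cond_Bsnr (isT : 5%N \in vals2) Eh1 Eh14 isT).
by dead25 j e.
Qed.

Lemma good_Bsnh_h1_l b q : good (Bsn h h 1 0 0 b 0 0 q).
Proof.
apply: (@good_Bsnl 22) => // b' q' e j + /(cond_Bsnl (isT : 5%N \in vals2) Eh1 Eh14 isT).
by dead25 j e.
Qed.

(* n / s is an idempotent of the curve n^2 = s n. *)
Lemma Z_Bsn0 u v x y p q : (forall s, s != 0 -> Z (Bss x y u v p (s * q))) ->
  Z (Bsn 0 x y 0 0 0 0 p q).
Proof.
move=> Zs.
pose c s := Tab 1 0 0 0 0 s x 0 0 y (s * u) 0 0 (s * v) p q.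
have -> : Bsn 0 x y 0 0 0 0 p q = c 0 by rewrite /c /Bsn !mul0r.
apply: Z_lim => [|s s0]; first by tpoly.
apply: Z_iso (Zs s s0); apply: (@isoI _ _ _ (M2 1 0 0 s^-1) (M2 1 0 0 1)).
- by rewrite /= mulr0 subr0 mul1r invr_eq0.
- by rewrite /= mulr0 subr0 mulr1 oner_neq0.
by rewrite /iso_eqs /ev0 /ev1 /od0 /od1 /=; do 2! split; split; field.
Qed.

(** On the curve n^2 = s n with unit e, the orthogonal idempotents are e - n / s and n / s. *)
Lemma Z_Bsn1 u v x y p q : (forall s, s != 0 -> Z (Bss (x - u) (y - v) u v p (p + s * q))) ->
  Z (Bsn 1 x y 0 0 0 0 p q).
Proof.
move=> Zs.
pose c s := Tab 1 0 0 1 0 s x 0 0 y (s * u) 0 0 (s * v) p q.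
have -> : Bsn 1 x y 0 0 0 0 p q = c 0 by rewrite /c /Bsn !mul0r.
apply: Z_lim => [|s s0]; first by tpoly.
apply: Z_iso (Zs s s0); apply: (@isoI _ _ _ (M2 1 0 (- s^-1) s^-1) (M2 1 0 0 1)).
- by rewrite /= mul0r subr0 mul1r invr_eq0.
- by rewrite /= mulr0 subr0 mulr1 oner_neq0.
by rewrite /iso_eqs /ev0 /ev1 /od0 /od1 /=; do 2! split; split; field.
Qed.

Lemma good_Bss10 p : good (Bss 1 1 0 0 p 0).
Proof. exact: good_iso (Bss_swap_even _ _ _ _ _ _) (good_Bss_0011 p). Qed.

Lemma good_Bsn0_hh_p p q : good (Bsn 0 h h 0 0 0 0 p q).
Proof.
apply: good_dead; last by move=> j _; apply: dead_Bsn => //; ring.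
by apply: (@Z_Bsn0 h h) => s _; case: (good_Bss_hhhh p (s * q)).
Qed.

Lemma good_Bsn0_11_p p : good (Bsn 0 1 1 0 0 0 0 p 0).
Proof.
apply: good_dead; last by move=> j _; apply: dead_Bsn => //; ring.
by apply: (@Z_Bsn0 0 0) => s _; rewrite mulr0; case: (good_Bss10 p).
Qed.

Lemma good_Bsn1_11_p p q : good (Bsn 1 1 1 0 0 0 0 p q).
Proof.
apply: good_dead; last by move=> j _; apply: dead_Bsn => //; ring.
apply: (@Z_Bsn1 h h) => s _; have -> : 1 - h = h :> K by field.
by case: (good_Bss_hhhh p (p + s * q)).
Qed.

Lemma good_Bsn0_diag x y : weight x 0 -> weight y 0 -> good (Bsn 0 x y 0 0 0 0 0 0).
Proof.
move=> wx wy; apply: good_dead; last by move=> j _; apply: dead_Bsn => //; ring.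
by apply: (@Z_Bsn0 0 0) => s _; rewrite mulr0; case: (good_Bss0 wx wy).
Qed.

Lemma good_Bsn1_diag x y : weight x 0 -> weight y 0 -> good (Bsn 1 x y 0 0 0 0 0 0).
Proof.
move=> wx wy; apply: good_dead; last by move=> j _; apply: dead_Bsn => //; ring.
by apply: (@Z_Bsn1 0 0) => s _; rewrite mulr0 addr0 !subr0; case: (good_Bss0 wx wy).
Qed.

(* The tables of C[X]X / (X^3), whose basis is X, X^2, and of the zero algebra. *)
Definition Bn3 x10 y10 p q : tab K := Tab 0 1 0 0 0 0 0 0 x10 0 0 0 y10 0 p q.
Definition Bn2 y10 p q : tab K := Tab 0 0 0 0 0 0 0 0 0 0 0 0 y10 0 p q.

Lemma dead_Bn3 x10 y10 p q j : ~ stratum_cond j (Bn3 x10 y10 p q).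
Proof.
apply: cond_dead => [|s t|]; [by rewrite /discA /tau /=; ring
  |by rewrite /nu /tau /trA /ev0 /ev1 /=; ring|].
by right=> s t; rewrite /trM /tau /=; split; ring.
Qed.

Lemma dead_Bn2 y10 p q j : ~ stratum_cond j (Bn2 y10 p q).
Proof.
apply: cond_dead => [|s t|]; [by rewrite /discA /tau /=; ring
  |by rewrite /nu /tau /trA /ev0 /ev1 /=; ring|].
by right=> s t; rewrite /trM /tau /=; split; ring.
Qed.

(* X = 2 s u + s v with orthogonal idempotents u and v. *)
Let det_uv s : s != 0 -> mdet (M2 (- (2 * s)^-1) (2 / s) ((2 * s ^+ 2)^-1) (- (s ^+ 2)^-1)) != 0.
Proof.
move=> s0; have -> : mdet (M2 (- (2 * s)^-1) (2 / s) ((2 * s ^+ 2)^-1) (- (s ^+ 2)^-1)) = - (2 * s ^+ 3)^-1.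
  by rewrite /=; field.
by rewrite oppr_eq0 invr_eq0 mulf_neq0 ?pnatr_eq0 // expf_neq0.
Qed.

Lemma good_Bn3_y : good (Bn3 0 1 0 0).
Proof.
apply: good_dead; last by move=> j _; exact: dead_Bn3.
(* The even part is X^3 = 3 s X^2 - 2 s^2 X. On the odd part X acts by the scalar s, while the
   eigenvalues 2 s^2 and s^2 of X^2 differ by s^2; mixing the eigenvectors with coefficient s^-2
   produces an off-diagonal entry 1 that survives at s = 0. *)
pose c s := Tab 0 1 (- (2 * s * s)) (3 * s) (- (6 * s * s * s)) (7 * s * s)
  s 0 0 s (2 * s * s) 0 1 (s * s) 0 0.
have -> : Bn3 0 1 0 0 = c 0 by rewrite /c /Bn3 !(mulr0, oppr0).
apply: Z_lim => [|s s0]; first by tpoly.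
have w0 : weight h 0 by rewrite /weight !eqxx !orbT.
have w1 : weight 0 1 by rewrite /weight !eqxx !orbT.
case: (good_Bss0 w0 w1) => Zs _; apply: Z_iso Zs.
apply: (@isoI _ _ _ (M2 (- (2 * s)^-1) (2 / s) ((2 * s ^+ 2)^-1) (- (s ^+ 2)^-1)) (M2 1 0 (s ^+ 2)^-1 1)).
- exact: det_uv.
- by rewrite /= mul0r subr0 mulr1 oner_neq0.
by rewrite /iso_eqs /ev0 /ev1 /od0 /od1 /=; do 2! split; split; field.
Qed.

Lemma good_Bn3_p p q : good (Bn3 0 0 p q).
Proof.
apply: good_dead; last by move=> j _; exact: dead_Bn3.
pose c s := Tab 0 1 (- (2 * s * s)) (3 * s) (- (6 * s * s * s)) (7 * s * s)
  (3 * s * h) 0 0 (3 * s * h) (5 * s * s * h) 0 0 (5 * s * s * h) p q.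
have -> : Bn3 0 0 p q = c 0 by rewrite /c /Bn3 !(mulr0, mul0r, oppr0).
apply: Z_lim => [|s s0]; first by tpoly.
case: (good_Bss_hhhh (2 * s * p + 4 * s ^+ 2 * q) (s * p + s ^+ 2 * q)) => Zs _; apply: Z_iso Zs.
apply: (@isoI _ _ _ (M2 (- (2 * s)^-1) (2 / s) ((2 * s ^+ 2)^-1) (- (s ^+ 2)^-1)) (M2 1 0 0 1)).
- exact: det_uv.
- by rewrite /= mulr0 subr0 mulr1 oner_neq0.
by rewrite /iso_eqs /ev0 /ev1 /od0 /od1 /=; do 2! split; split; field.
Qed.

(* X = s u + n with a unit u and n^2 = 0. *)
Lemma good_Bn3_x q : good (Bn3 1 0 0 q).
Proof.
apply: good_dead; last by move=> j _; exact: dead_Bn3.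
pose c s := Tab 0 1 (- (s * s)) (2 * s) (- (2 * s * s * s)) (3 * s * s)
  s 0 1 s (s * s) 0 (2 * s) (s * s) (- (s * q)) q.
have -> : Bn3 1 0 0 q = c 0 by rewrite /c /Bn3 !(mulr0, mul0r, oppr0).
apply: Z_lim => [|s s0]; first by tpoly.
case: (good_Bsn1_11 1 (s * q)) => Zs _; apply: Z_iso Zs.
apply: (@isoI _ _ _ (M2 (2 / s) (- 1) (- (s ^+ 2)^-1) (s^-1)) (M2 1 0 0 1)).
- rewrite [mdet _](_ : _ = (s ^+ 2)^-1) ?invr_eq0 ?expf_neq0 //=; by field.
- by rewrite /= mulr0 subr0 mulr1 oner_neq0.
by rewrite /iso_eqs /ev0 /ev1 /od0 /od1 /=; do 2! split; split; field.
Qed.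

(** For p = 0 the table is the limit of e^2 = s e, where e / s is idempotent. For q nonzero a shear
    of the even part removes p, and q = 0 is a further limit. *)
Lemma good_Bn2 b p q : good (Bn2 b p q).
Proof.
have Z0 r t : Z (Bn2 r 0 t).
  pose c s := Tab s 0 0 0 0 0 0 0 0 0 0 0 r 0 0 t.
  apply: (Z_lim (c := c)) => [|s s0]; first by tpoly.
  case: (good_Bsn0_00 r t) => Zs _; apply: Z_iso Zs.
  apply: (@isoI _ _ _ (M2 s^-1 0 0 1) (M2 1 0 0 1)).
  - by rewrite /= mulr0 subr0 mulr1 invr_eq0.
  - by rewrite /= mulr0 subr0 mulr1 oner_neq0.
  by rewrite /iso_eqs /ev0 /ev1 /od0 /od1 /=; do 2! split; split; field.
have Zq r t s : s != 0 -> Z (Bn2 r t s).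
  move=> s0; apply: Z_iso (Z0 r s).
  apply: (@isoI _ _ _ (M2 1 (t / s) 0 1) (M2 1 0 0 1)).
  - by rewrite /= mulr0 subr0 mulr1 oner_neq0.
  - by rewrite /= mulr0 subr0 mulr1 oner_neq0.
  by rewrite /iso_eqs /ev0 /ev1 /od0 /od1 /=; do 2! split; split; field.
apply: good_dead; last by move=> j _; exact: dead_Bn2.
have [->|] := eqVneq q 0; last exact: Zq.
apply: (Z_lim (c := fun s => Bn2 b p s)) => [|s]; [by tpoly|exact: Zq].
Qed.

(** * Peirce eigenvalues and the six kinds of even part *)

Definition idv x := x = 0 \/ x = h \/ x = 1.

Let root_idv x : 2 * x ^+ 3 - 3 * x ^+ 2 + x = 0 -> idv x.
Proof.
move=> E; have /eqP : x * (2 * x - 1) * (x - 1) = 0 by rewrite -E; ring.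
rewrite !mulf_eq0 !subr_eq0 -orbA => /or3P[/eqP->|/eqP e|/eqP->]; [by left| |by do 2! right].
by right; left; transitivity ((2 * x) / 2); [field|rewrite e mul1r].
Qed.

(** The multiplication M by an idempotent is a root of P = 2 X^3 - 3 X^2 + X. The factor of z is the
    divided difference of P at x and y, so the third equation is the off-diagonal entry of P(M). For
    x = y this factor is P'(x), which is nonzero because the roots 0, 1/2, 1 are simple, so z = 0;
    for x and y distinct M is diagonalizable anyway. *)
Let idem_diag x y z : 2 * x ^+ 3 - 3 * x ^+ 2 + x = 0 -> 2 * y ^+ 3 - 3 * y ^+ 2 + y = 0 ->
  (2 * x ^+ 2 + 2 * x * y + 2 * y ^+ 2 - 3 * x - 3 * y + 1) * z = 0 ->
  exists2 H, mdet H != 0 & mmul (M2 x 0 z y) H = mmul H (M2 x 0 0 y).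
Proof.
move=> /root_idv Ix _ Ez; have [e|xy] := eqVneq x y; last first.
  have xy0 : x - y != 0 by rewrite subr_eq0.
  exists (M2 1 0 (z / (x - y)) 1); first by rewrite /= mul0r subr0 mulr1 oner_neq0.
  by apply: M2_eq; field.
exists (M2 1 0 0 1); first by rewrite /= mulr0 subr0 mulr1 oner_neq0.
have -> : z = 0.
  move: Ez; rewrite -e; case: Ix => [|[|]] -> Ez.
  - by rewrite -[RHS]Ez; ring.
  - apply/eqP; rewrite -oppr_eq0; apply/eqP.
    by transitivity (2 * 0 : K); [rewrite -[X in _ = 2 * X]Ez; field|ring].
  - by rewrite -[RHS]Ez; ring.
by apply: M2_eq; ring.
Qed.

Let commutes_scalar x (H : mat K) : mmul (M2 x 0 0 x) H = mmul H (M2 x 0 0 x).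
Proof. by case: H => *; apply: M2_eq; ring. Qed.

Let iso_jordan2 w w' : qjordan w -> iso w w' -> qjordan w'.
Proof. by move=> J I; exact: iso_jordan I J. Qed.

Definition ordered x y := (x = y /\ idv x) \/
  [\/ x = 0 /\ y = h, x = 0 /\ y = 1 | x = h /\ y = 1].

Let idem_normal w mu c0 c1 : qjordan w -> even_part w = (1, 0, 0, mu, c0, c1) ->
  exists x y b00 b01 b10 b11 p q, ordered x y /\
    iso w (Tab 1 0 0 mu c0 c1 x 0 0 y b00 b01 b10 b11 p q).
Proof.
case: w => a0 a1 b0 b1 d0 d1 x00 x01 x10 x11 y00 y01 y10 y11 p q J.
rewrite /even_part /= => -[e0 e1 e2 e3 e4 e5]; move: J; rewrite {}e0 {}e1 {}e2 {}e3 {}e4 {}e5.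
set w := Tab _ _ _ _ _ _ _ _ _ _ _ _ _ _ _ _ => J.
have [H [x [y [z [H0 E]]]]] := triangular (Lx w).
have [b00 [b01 [b10 [b11 F]]]] := conj_ex (Ly w) H0.
have := iso_odd H0 E F; set w1 := Tab _ _ _ _ _ _ _ _ _ _ _ _ _ _ _ _ => I1.
have J1 := iso_jordan2 J I1.
have Ex : 2 * x ^+ 3 - 3 * x ^+ 2 + x = 0 by jrel J1 (0, 0, 0, 2, 2)%N 1.
have Ey : 2 * y ^+ 3 - 3 * y ^+ 2 + y = 0 by jrel J1 (0, 0, 0, 3, 3)%N 1.
have Ez : (2 * x ^+ 2 + 2 * x * y + 2 * y ^+ 2 - 3 * x - 3 * y + 1) * z = 0.
  by jrel J1 (0, 0, 0, 2, 3)%N 1.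
have [H' H'0 E'] := idem_diag Ex Ey Ez.
have [b00' [b01' [b10' [b11' F']]]] := conj_ex (Ly w1) H'0.
have I2 := iso_odd (w := w1) H'0 E' F'.
have Ix := root_idv Ex; have Iy := root_idv Ey.
have key u v r s r' s' p' q' : idv u -> idv v ->
    iso w (Tab 1 0 0 mu c0 c1 u 0 0 v r s r' s' p' q') -> ordered u v \/ ordered v u.
  rewrite /ordered => Iu Iv _; case: Iu => [|[|]] ->; case: Iv => [|[|]] ->.
  - by left; left; split=> //; left.
  - by left; right; constructor 1.
  - by left; right; constructor 2.
  - by right; right; constructor 1.
  - by left; left; split=> //; right; left.
  - by left; right; constructor 3.
  - by right; right; constructor 2.
  - by right; right; constructor 3.
  - by left; left; split=> //; right; right.
have I3 := iso_trans I1 I2.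
case: (key _ _ _ _ _ _ _ _ Ix Iy I3) => O.
  by do 8! eexists; split; [exact: O|exact: I3].
have S0 : mdet (M2 0 1 1 0 : mat K) != 0 by rewrite /= mulr0 sub0r mulr1 oppr_eq0 oner_neq0.
exists y, x, b11', b10', b01', b00'; do 2! eexists; split; first exact: O.
apply: iso_trans I3 _; apply: (iso_odd S0); by apply: M2_eq => /=; ring.
Qed.

Let weight_of x x' : idv x -> idv x' -> x' * x * (2 * x - 1) = 0 ->
  x' * x * (2 * x' - 1) = 0 -> weight x x'.
Proof.
have h0 : h != 0 :> K by rewrite invr_eq0 pnatr_eq0.
have h1 : 2 * h - 1 = 0 :> K by field.
have h2 : 2 * 1 - 1 = 1 :> K by ring.
rewrite /weight => -[|[|]] -> [|[|]] ->; rewrite ?h1 ?h2 ?eqxx ?orbT // => E F.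
- by move/eqP: F; rewrite mul1r mulr1 (negPf h0).
- by move/eqP: E; rewrite !mulr1 (negPf h0).
- by move/eqP: E; rewrite !mulr1 oner_eq0.
Qed.

(** The identities with two odd arguments give (x - y) p = 0 and its analogues: unless f_0 f_1 = 0,
    both idempotents act on the odd part by scalars. The remaining equations then decide which
    coordinates of f_0 f_1 may be nonzero for each weight. *)
Lemma good_Bss x y x' y' p q : qjordan (Bss x y x' y' p q) ->
  idv x -> idv y -> idv x' -> idv y' -> good (Bss x y x' y' p q).
Proof.
move=> J Ix Iy Ix' Iy'.
have W1 : weight x x'.
  apply: weight_of => //.
  - by jrel J (0, 0, 1, 2, 2)%N 1.
  - by jrel J (0, 1, 1, 2, 2)%N 1.
have W2 : weight y y'.
  apply: weight_of => //.
  - by jrel J (0, 0, 1, 3, 3)%N 1.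
  - by jrel J (0, 1, 1, 3, 3)%N 1.
have R1 : p * (2 * x * y - 2 * x - y + 1) = 0 by jrel J (0, 0, 3, 2, 0)%N 1.
have R2 : p * (2 * x * y - x - 2 * y + 1) = 0 by jrel J (0, 0, 2, 3, 0)%N (-1).
have R3 : p * (2 * x' * y' - y') = 0 by jrel J (1, 1, 3, 2, 0)%N 1.
have R4 : p * (2 * x' * y' - x') = 0 by jrel J (1, 1, 2, 3, 0)%N (-1).
have S1 : q * (2 * x * y - y) = 0 by jrel J (0, 0, 3, 2, 1)%N 1.
have S2 : q * (2 * x * y - x) = 0 by jrel J (0, 0, 2, 3, 1)%N (-1).
have S3 : q * (2 * x' * y' - 2 * x' - y' + 1) = 0 by jrel J (1, 1, 3, 2, 1)%N 1.
have S4 : q * (2 * x' * y' - x' - 2 * y' + 1) = 0 by jrel J (1, 1, 2, 3, 1)%N (-1).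
have Pxy : p * (x - y) = 0 by transitivity (p * (2 * x * y - x - 2 * y + 1) - p * (2 * x * y - 2 * x - y + 1)); [ring|rewrite R1 R2 subrr].
have Pxy' : p * (x' - y') = 0 by transitivity (p * (2 * x' * y' - y') - p * (2 * x' * y' - x')); [ring|rewrite R3 R4 subrr].
have Qxy : q * (x - y) = 0 by transitivity (q * (2 * x * y - y) - q * (2 * x * y - x)); [ring|rewrite S1 S2 subrr].
have Qxy' : q * (x' - y') = 0 by transitivity (q * (2 * x' * y' - x' - 2 * y' + 1) - q * (2 * x' * y' - 2 * x' - y' + 1)); [ring|rewrite S3 S4 subrr].
have [/andP[/eqP p0 /eqP q0]|N] := boolP ((p == 0) && (q == 0)).
  by rewrite p0 q0; exact: good_Bss0.
have [ey ey'] : y = x /\ y' = x'.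
  move/eqP: Pxy; move/eqP: Pxy'; move/eqP: Qxy; move/eqP: Qxy'.
  rewrite !mulf_eq0 !subr_eq0; case: (p == 0) N => /=; case: (q == 0) => //= _;
  by do 4! (move/eqP=> ?).
move: R1 R3 S1 S3; rewrite {W2 Iy Iy' R2 R4 S2 S4 Pxy Pxy' Qxy Qxy' J}ey ey' => R1 R3 S1 S3.
have p_x0 : x = 0 -> p = 0 by move=> e; rewrite -[RHS]R1 e; ring.
have p_x1 : x' = 1 -> p = 0 by move=> e; rewrite -[RHS]R3 e; ring.
have q_x0 : x = 1 -> q = 0 by move=> e; rewrite -[RHS]S1 e; ring.
have q_x1 : x' = 0 -> q = 0 by move=> e; rewrite -[RHS]S3 e; ring.
move: W1 => /or4P[/andP[/eqP e /eqP e']|/andP[/eqP e /eqP e']|/andP[/eqP e /eqP e']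
  |/or3P[/andP[/eqP e /eqP e']|/andP[/eqP e /eqP e']|/andP[/eqP e /eqP e']]].
- by move: N; rewrite (p_x0 e) (q_x1 e') eqxx.
- by rewrite (p_x0 e) e e'; exact: good_Bss_00hh.
- by rewrite (p_x0 e) e e'; exact: good_Bss_0011.
- rewrite (q_x1 e') e e'; exact: good_iso (Bss_swap_even _ _ _ _ _ _) (good_Bss_00hh p).
- by rewrite e e'; exact: good_Bss_hhhh.
- by rewrite (q_x1 e') e e'; exact: good_Bss10.
Qed.

(** If the first idempotent has two eigenvalues on the odd part, the identities make the second one
    diagonal as well. If it acts by a scalar, every change of odd basis preserves it, and the second
    one is diagonalized. *)
Let good_even_ss w : qjordan w -> even_part w = (1, 0, 0, 0, 0, 1) -> good w.
Proof.
move=> J Ew; have [x [y [b00 [b01 [b10 [b11 [p [q [O I]]]]]]]]] := idem_normal J Ew.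
apply: (good_iso I); have {J} := iso_jordan2 J I; move=> J.
case: O => [[ey Ix]|O]; last first.
  have e1 : b01 = 0.
    by case: O J => -[-> ->] J; [jrel J (0, 0, 3, 1, 2)%N 2|jrel J (0, 0, 3, 1, 2)%N 1|jrel J (0, 0, 1, 3, 2)%N 2].
  have e2 : b10 = 0.
    by case: O J => -[-> ->] J; [jrel J (0, 0, 1, 2, 3)%N (-2)|jrel J (0, 0, 1, 2, 3)%N (-1)|jrel J (0, 0, 2, 1, 3)%N (-2)].
  move: J; rewrite e1 e2 => J; apply: good_Bss => //.
  - by case: O => -[-> _]; rewrite /idv; auto.
  - by case: O => -[_ ->]; rewrite /idv; auto.
  - by apply: root_idv; jrel J (1, 1, 1, 2, 2)%N 1.
  - by apply: root_idv; jrel J (1, 1, 1, 3, 3)%N 1.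
move: J; rewrite -{}ey; set w1 := Tab _ _ _ _ _ _ _ _ _ _ _ _ _ _ _ _ => J.
have [H [u [v [z [H0 E]]]]] := triangular (Ly w1).
have I1 := iso_odd H0 (commutes_scalar x H : mmul (Lx w1) H = _) E.
apply: (good_iso I1); have {J} := iso_jordan2 J I1.
set w2 := Tab _ _ _ _ _ _ _ _ _ _ _ _ _ _ _ _ => J.
have Eu : 2 * u ^+ 3 - 3 * u ^+ 2 + u = 0 by jrel J (1, 1, 1, 2, 2)%N 1.
have Ev : 2 * v ^+ 3 - 3 * v ^+ 2 + v = 0 by jrel J (1, 1, 1, 3, 3)%N 1.
have Ez : (2 * u ^+ 2 + 2 * u * v + 2 * v ^+ 2 - 3 * u - 3 * v + 1) * z = 0.
  by jrel J (1, 1, 1, 2, 3)%N 1.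
have [H' H'0 E'] := idem_diag Eu Ev Ez.
have I2 := iso_odd (w := w2) H'0 (commutes_scalar x H') E'.
apply: (good_iso I2); apply: good_Bss => //; [exact: iso_jordan2 J I2| |]; exact: root_idv.
Qed.

Let good_even_snh w : qjordan w -> even_part w = (1, 0, 0, h, 0, 0) -> good w.
Proof.
move=> J Ew; have [x [y [b00 [b01 [b10 [b11 [p [q [O I]]]]]]]]] := idem_normal J Ew.
apply: (good_iso I); have {J} := iso_jordan2 J I.
case: O => [[<- [|[|]] ->]|[] [-> ->]] J.
- jzero J b00 (0, 0, 1, 2, 2)%N (2).
  jzero J b01 (0, 0, 1, 3, 2)%N (2).
  jzero J b10 (0, 0, 1, 2, 3)%N (2).
  jzero J b11 (0, 0, 1, 3, 3)%N (2).
  jzero J p (0, 0, 2, 3, 0)%N (-1).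
  jzero J q (0, 0, 2, 3, 1)%N (-2).
  exact: (@good_tab 16).
- jzero J b00 (0, 1, 0, 2, 2)%N (-4).
  jzero J b01 (0, 1, 0, 3, 2)%N (-4).
  jzero J b10 (0, 1, 0, 2, 3)%N (-4).
  jzero J b11 (0, 1, 0, 3, 3)%N (-4).
  jzero J p (1, 2, 0, 3, 1)%N (4).
  jzero J q (0, 2, 0, 3, 1)%N (-4).
  exact: (@good_tab 20).
- jzero J b00 (0, 0, 1, 2, 2)%N (2).
  jzero J b01 (0, 0, 1, 3, 2)%N (2).
  jzero J b10 (0, 0, 1, 2, 3)%N (2).
  jzero J b11 (0, 0, 1, 3, 3)%N (2).
  jzero J p (1, 2, 0, 3, 1)%N (4).
  jzero J q (0, 0, 2, 3, 1)%N (-2).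
  exact: (@good_tab 23).
- jzero J b00 (0, 0, 1, 2, 2)%N (2).
  jzero J b11 (0, 1, 0, 3, 3)%N (-4).
  jzero J p (0, 0, 3, 2, 0)%N (2).
  (* As e n = n / 2, n maps each of the two eigenspaces into the other. The identity on n, n, e, f
     with n^2 = 0 reads 2 n (e (n f)) = n (n f), and as e (n f) = 0 for f in the eigenspace of 1/2,
     it leaves n (n f) = 0. Only one off-diagonal entry may then be nonzero. *)
  have /eqP : b01 * b10 = 0 by jrel J (1, 1, 0, 3, 3)%N (-1).
  rewrite mulf_eq0 => /orP[] /eqP ->; [exact: good_Bsnh_0h_l|exact: good_Bsnh_0h_r].
- jzero J b00 (0, 0, 1, 2, 2)%N (2).
  jzero J b01 (0, 0, 1, 3, 2)%N (-2).
  jzero J b10 (0, 0, 1, 2, 3)%N (-2).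
  jzero J b11 (0, 0, 1, 3, 3)%N (2).
  jzero J p (0, 0, 2, 3, 0)%N (1).
  jzero J q (0, 0, 2, 3, 1)%N (2).
  exact: (@good_tab 19).
- jzero J b00 (0, 1, 0, 2, 2)%N (-4).
  jzero J b11 (0, 0, 1, 3, 3)%N (2).
  jzero J p (0, 0, 2, 3, 0)%N (2).
  have /eqP : b01 * b10 = 0 by jrel J (1, 1, 0, 2, 2)%N (1).
  rewrite mulf_eq0 => /orP[] /eqP ->; [exact: good_Bsnh_h1_l|exact: good_Bsnh_h1_r].
Qed.

Let good_even_sn1 w : qjordan w -> even_part w = (1, 0, 0, 1, 0, 0) -> good w.
Proof.
move=> J Ew; have [x [y [b00 [b01 [b10 [b11 [p [q [O I]]]]]]]]] := idem_normal J Ew.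
apply: (good_iso I); have {J} := iso_jordan2 J I.
case: O => [[<- [|[|]] ->]|[] [-> ->]] J.
- jzero J b00 (0, 0, 1, 2, 2)%N (1).
  jzero J b01 (0, 0, 1, 3, 2)%N (1).
  jzero J b10 (0, 0, 1, 2, 3)%N (1).
  jzero J b11 (0, 0, 1, 3, 3)%N (1).
  jzero J p (0, 0, 2, 3, 0)%N (-1).
  jzero J q (0, 0, 2, 3, 1)%N (-1).
  by apply: good_Bsn1_diag; rewrite /weight !eqxx ?orbT.
- have [H [u [v [z [H0 E]]]]] := triangular (Ly (Tab 1 0 0 1 0 0 h 0 0 h b00 b01 b10 b11 p q)).
  have I1 := iso_odd (w := Tab 1 0 0 1 0 0 h 0 0 h b00 b01 b10 b11 p q)
    H0 (commutes_scalar h H) E.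
  apply: (good_iso I1); have {J} := iso_jordan2 J I1; rewrite /=.
  move: (mdet H * p) (mdet H * q) => p' q' J.
  (* As n^2 = 0, the identity on n, n, n, f reads 2 n (n (n f)) = 0, so the triangular matrix of n
     has zero diagonal. *)
  have e_u : u = 0.
    by apply/eqP; have /eqP : u ^+ 3 = 0; [jrel J (1, 1, 1, 2, 2)%N (2^-1)|rewrite expf_eq0].
  rewrite {}e_u in J *.
  have e_v : v = 0.
    by apply/eqP; have /eqP : v ^+ 3 = 0; [jrel J (1, 1, 1, 3, 3)%N (2^-1)|rewrite expf_eq0].
  rewrite {}e_v in J *.
  have e_p : p' = 0 by jrel J (0, 1, 2, 3, 1)%N (-2).
  by rewrite e_p; exact: good_Bsn1_hh.
- have [H [u [v [z [H0 E]]]]] := triangular (Ly (Tab 1 0 0 1 0 0 1 0 0 1 b00 b01 b10 b11 p q)).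
  have I1 := iso_odd (w := Tab 1 0 0 1 0 0 1 0 0 1 b00 b01 b10 b11 p q)
    H0 (commutes_scalar 1 H) E.
  apply: (good_iso I1); have {J} := iso_jordan2 J I1; rewrite /=.
  move: (mdet H * p) (mdet H * q) => p' q' J.
  have e_u : u = 0.
    by apply/eqP; have /eqP : u ^+ 3 = 0; [jrel J (1, 1, 1, 2, 2)%N (2^-1)|rewrite expf_eq0].
  rewrite {}e_u in J *.
  have e_v : v = 0.
    by apply/eqP; have /eqP : v ^+ 3 = 0; [jrel J (1, 1, 1, 3, 3)%N (2^-1)|rewrite expf_eq0].
  rewrite {}e_v in J *.
  (* Either n acts by zero and f_0 f_1 is arbitrary, or f_0 f_1 is a multiple of n; the two cases
     are limits of different strata. *)
  have /eqP : z * p' = 0 by jrel J (1, 1, 2, 2, 1)%N (2^-1).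
  rewrite mulf_eq0 => /orP[] /eqP ->; [exact: good_Bsn1_11_p|exact: good_Bsn1_11].
- jzero J b00 (0, 0, 1, 2, 2)%N (1).
  jzero J b01 (0, 0, 3, 1, 2)%N (-2).
  jzero J b10 (0, 0, 1, 2, 3)%N (2).
  jzero J p (0, 0, 3, 2, 0)%N (2).
  jzero J q (0, 0, 3, 2, 1)%N (2).
  have e_b11 : b11 = 0.
    by apply/eqP; have /eqP : b11 ^+ 2 = 0; [jrel J (0, 1, 1, 3, 3)%N (-1)|rewrite expf_eq0].
  rewrite {}e_b11 in J *.
  by apply: good_Bsn1_diag; rewrite /weight !eqxx ?orbT.
- jzero J b00 (0, 0, 1, 2, 2)%N (1).
  jzero J b01 (0, 0, 1, 3, 2)%N (-1).
  jzero J b10 (0, 0, 2, 1, 3)%N (1).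
  jzero J p (0, 0, 2, 3, 0)%N (1).
  jzero J q (0, 0, 2, 3, 1)%N (1).
  have e_b11 : b11 = 0.
    by apply/eqP; have /eqP : b11 ^+ 3 = 0; [jrel J (1, 1, 1, 3, 3)%N (2^-1)|rewrite expf_eq0].
  rewrite {}e_b11 in J *.
  by apply: good_Bsn1_diag; rewrite /weight !eqxx ?orbT.
- jzero J b01 (0, 0, 1, 3, 2)%N (-2).
  jzero J b10 (0, 0, 2, 1, 3)%N (2).
  jzero J p (0, 0, 2, 3, 0)%N (2).
  jzero J q (0, 0, 2, 3, 1)%N (2).
  have e_b00 : b00 = 0.
    by apply/eqP; have /eqP : b00 ^+ 2 = 0; [jrel J (1, 1, 0, 2, 2)%N (-1)|rewrite expf_eq0].
  rewrite {}e_b00 in J *.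
  have e_b11 : b11 = 0.
    by apply/eqP; have /eqP : b11 ^+ 3 = 0; [jrel J (1, 1, 1, 3, 3)%N (2^-1)|rewrite expf_eq0].
  rewrite {}e_b11 in J *.
  by apply: good_Bsn1_diag; rewrite /weight !eqxx ?orbT.
Qed.

Let good_even_sn0 w : qjordan w -> even_part w = (1, 0, 0, 0, 0, 0) -> good w.
Proof.
move=> J Ew; have [x [y [b00 [b01 [b10 [b11 [p [q [O I]]]]]]]]] := idem_normal J Ew.
apply: (good_iso I); have {J} := iso_jordan2 J I.
case: O => [[<- [|[|]] ->]|[] [-> ->]] J.
- have [H [u [v [z [H0 E]]]]] := triangular (Ly (Tab 1 0 0 0 0 0 0 0 0 0 b00 b01 b10 b11 p q)).
  have I1 := iso_odd (w := Tab 1 0 0 0 0 0 0 0 0 0 b00 b01 b10 b11 p q)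
    H0 (commutes_scalar 0 H) E.
  apply: (good_iso I1); have {J} := iso_jordan2 J I1; rewrite /=.
  move: (mdet H * p) (mdet H * q) => p' q' J.
  have e_p : p' = 0 by jrel J (0, 0, 2, 3, 0)%N (-1).
  rewrite {}e_p in J *.
  have e_u : u = 0.
    by apply/eqP; have /eqP : u ^+ 3 = 0; [jrel J (1, 1, 1, 2, 2)%N (2^-1)|rewrite expf_eq0].
  rewrite {}e_u in J *.
  have e_v : v = 0.
    by apply/eqP; have /eqP : v ^+ 3 = 0; [jrel J (1, 1, 1, 3, 3)%N (2^-1)|rewrite expf_eq0].
  rewrite {}e_v in J *.
  exact: good_Bsn0_00.
- have [H [u [v [z [H0 E]]]]] := triangular (Ly (Tab 1 0 0 0 0 0 h 0 0 h b00 b01 b10 b11 p q)).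
  have I1 := iso_odd (w := Tab 1 0 0 0 0 0 h 0 0 h b00 b01 b10 b11 p q)
    H0 (commutes_scalar h H) E.
  apply: (good_iso I1); have {J} := iso_jordan2 J I1; rewrite /=.
  move: (mdet H * p) (mdet H * q) => p' q' J.
  have e_u : u = 0.
    by apply/eqP; have /eqP : u ^+ 3 = 0; [jrel J (1, 1, 1, 2, 2)%N (2^-1)|rewrite expf_eq0].
  rewrite {}e_u in J *.
  have e_v : v = 0.
    by apply/eqP; have /eqP : v ^+ 3 = 0; [jrel J (1, 1, 1, 3, 3)%N (2^-1)|rewrite expf_eq0].
  rewrite {}e_v in J *.
  have /eqP : z * p' = 0 by jrel J (0, 1, 2, 2, 0)%N 1.
  rewrite mulf_eq0 => /orP[] /eqP ->; [exact: good_Bsn0_hh_p|exact: good_Bsn0_hh].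
- jzero J b00 (0, 0, 1, 2, 2)%N (1).
  jzero J b01 (0, 0, 1, 3, 2)%N (1).
  jzero J b10 (0, 0, 1, 2, 3)%N (1).
  jzero J b11 (0, 0, 1, 3, 3)%N (1).
  jzero J q (0, 0, 2, 3, 1)%N (-1).
  exact: good_Bsn0_11_p.
- jzero J b01 (0, 0, 3, 1, 2)%N (2).
  jzero J b10 (0, 0, 1, 2, 3)%N (-2).
  jzero J p (0, 0, 3, 2, 0)%N (2).
  jzero J q (0, 0, 3, 2, 1)%N (-2).
  have e_b00 : b00 = 0.
    by apply/eqP; have /eqP : b00 ^+ 3 = 0; [jrel J (1, 1, 1, 2, 2)%N (2^-1)|rewrite expf_eq0].
  rewrite {}e_b00 in J *.
  have e_b11 : b11 = 0.
    by apply/eqP; have /eqP : b11 ^+ 2 = 0; [jrel J (1, 1, 0, 3, 3)%N (1)|rewrite expf_eq0].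
  rewrite {}e_b11 in J *.
  by apply: good_Bsn0_diag; rewrite /weight !eqxx ?orbT.
- jzero J b01 (0, 0, 3, 1, 2)%N (1).
  jzero J b10 (0, 0, 1, 2, 3)%N (-1).
  jzero J p (0, 0, 2, 3, 0)%N (1).
  jzero J q (0, 0, 3, 2, 1)%N (-1).
  jzero J b11 (0, 0, 1, 3, 3)%N (1).
  have e_b00 : b00 = 0.
    by apply/eqP; have /eqP : b00 ^+ 3 = 0; [jrel J (1, 1, 1, 2, 2)%N (2^-1)|rewrite expf_eq0].
  rewrite {}e_b00 in J *.
  by apply: good_Bsn0_diag; rewrite /weight !eqxx ?orbT.
- jzero J b01 (0, 0, 1, 3, 2)%N (2).
  jzero J b10 (0, 0, 2, 1, 3)%N (-2).
  jzero J p (0, 0, 2, 3, 0)%N (2).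
  jzero J q (0, 0, 2, 3, 1)%N (-2).
  jzero J b11 (0, 0, 1, 3, 3)%N (1).
  have e_b00 : b00 = 0.
    by apply/eqP; have /eqP : b00 ^+ 2 = 0; [jrel J (1, 1, 0, 2, 2)%N (1)|rewrite expf_eq0].
  rewrite {}e_b00 in J *.
  by apply: good_Bsn0_diag; rewrite /weight !eqxx ?orbT.
Qed.

Let cube0 x : x ^+ 3 = 0 -> x = 0.
Proof. by move/eqP; rewrite expf_eq0 => /eqP. Qed.

(** If X^2 acts on the odd part by a nonzero nilpotent matrix, the identities make X act by a
    multiple of it and force f_0 f_1 = 0; subtracting a multiple of X^2 from X removes the action of
    X. If X^2 acts by zero, the odd basis is free to triangularize X. *)
Let good_even_n3 w : qjordan w -> even_part w = (0, 1, 0, 0, 0, 0) -> good w.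
Proof.
case: w => a0 a1 b0 b1 d0 d1 x00 x01 x10 x11 y00 y01 y10 y11 p q J.
rewrite /even_part /= => -[e0 e1 e2 e3 e4 e5]; move: J; rewrite {}e0 {}e1 {}e2 {}e3 {}e4 {}e5.
set w := Tab _ _ _ _ _ _ _ _ _ _ _ _ _ _ _ _ => J.
have [H [u [v [z [H0 F]]]]] := triangular (Ly w).
have [b00 [b01 [b10 [b11 E]]]] := conj_ex (Lx w) H0.
have I := iso_odd H0 E F; apply: (good_iso I); have {J} := iso_jordan2 J I; rewrite /=.
move: (mdet H * p) (mdet H * q) => p' q' J.
have u0 : u = 0 by apply: cube0; jrel J (1, 1, 1, 2, 2)%N (2^-1).
have v0 : v = 0 by apply: cube0; jrel J (1, 1, 1, 3, 3)%N (2^-1).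
move: J; rewrite {I F}u0 v0.
have [->|z0] := eqVneq z 0 => J; last first.
  have kill t : z * t = 0 -> t = 0 by move/eqP; rewrite mulf_eq0 (negPf z0) => /eqP.
  have e01 : b01 = 0 by apply: kill; jrel J (0, 0, 2, 0, 2)%N (3^-1).
  have e11 : b11 = b00.
    by apply/eqP; rewrite -subr_eq0; apply/eqP/kill; jrel J (0, 0, 2, 0, 3)%N (3^-1).
  move: J; rewrite {E}e01 e11 => J.
  have e00 : b00 = 0 by apply: cube0; jrel J (0, 0, 0, 2, 2)%N (2^-1).
  move: J; rewrite e00 => J.
  have ep : p' = 0 by apply: kill; jrel J (0, 0, 2, 2, 0)%N (-1).
  move: J; rewrite ep => J.
  have eq : q' = 0 by apply: kill; jrel J (0, 0, 2, 2, 1)%N (-1).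
  rewrite eq; apply: good_iso good_Bn3_y.
  apply: (@isoI _ _ _ (M2 1 0 (- (b10 / z)) 1) (M2 1 0 0 z)).
  - by rewrite /= mul0r subr0 mulr1 oner_neq0.
  - by rewrite /= mul0r subr0 mul1r.
  by rewrite /iso_eqs /ev0 /ev1 /od0 /od1 /=; do 2! split; split; field.
set w1 := Tab _ _ _ _ _ _ _ _ _ _ _ _ _ _ _ _ in J *.
have [H' [a [d [c [H'0 E']]]]] := triangular (Lx w1).
have I := iso_odd (w := w1) H'0 E' (commutes_scalar 0 H').
apply: (good_iso I); have {J} := iso_jordan2 J I; rewrite /=.
move: (mdet H' * p') (mdet H' * q') => p2 q2 J.
have ea : a = 0 by apply: cube0; jrel J (0, 0, 0, 2, 2)%N (2^-1).
have ed : d = 0 by apply: cube0; jrel J (0, 0, 0, 3, 3)%N (2^-1).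
move: J; rewrite {I E'}ea ed.
have [->|c0] := eqVneq c 0 => J; first exact: good_Bn3_p.
have ep : p2 = 0.
  apply/eqP; have /eqP : c * p2 = 0 by jrel J (0, 0, 2, 2, 1)%N (2^-1).
  by rewrite mulf_eq0 (negPf c0).
rewrite ep; apply: good_iso (good_Bn3_x (c * q2)).
apply: (@isoI _ _ _ (M2 1 0 0 1) (M2 1 0 0 c)).
- by rewrite /= mul0r subr0 mulr1 oner_neq0.
- by rewrite /= mul0r subr0 mul1r.
by rewrite /iso_eqs /ev0 /ev1 /od0 /od1 /=; do 2! split; split; ring.
Qed.

(** Both actions are nilpotent. If that of e_1 is nonzero, the action of e_0 is a multiple of it and
    is removed by a shear; if it is zero, e_0 is triangularized and the even vectors are
    exchanged. *)
Let good_even_n2 w : qjordan w -> even_part w = (0, 0, 0, 0, 0, 0) -> good w.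
Proof.
case: w => a0 a1 b0 b1 d0 d1 x00 x01 x10 x11 y00 y01 y10 y11 p q J.
rewrite /even_part /= => -[e0 e1 e2 e3 e4 e5]; move: J; rewrite {}e0 {}e1 {}e2 {}e3 {}e4 {}e5.
set w := Tab _ _ _ _ _ _ _ _ _ _ _ _ _ _ _ _ => J.
have [H [u [v [z [H0 F]]]]] := triangular (Ly w).
have [b00 [b01 [b10 [b11 E]]]] := conj_ex (Lx w) H0.
have I := iso_odd H0 E F; apply: (good_iso I); have {J} := iso_jordan2 J I; rewrite /=.
move: (mdet H * p) (mdet H * q) => p' q' J.
have u0 : u = 0 by apply: cube0; jrel J (1, 1, 1, 2, 2)%N (2^-1).
have v0 : v = 0 by apply: cube0; jrel J (1, 1, 1, 3, 3)%N (2^-1).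
move: J; rewrite {I F}u0 v0.
have [->|z0] := eqVneq z 0 => J; last first.
  have e01 : b01 = 0.
    apply/eqP; have /eqP : z ^+ 2 * b01 = 0 by jrel J (1, 1, 0, 2, 3)%N (2^-1).
    by rewrite mulf_eq0 expf_eq0 (negPf z0).
  move: J; rewrite {E}e01 => J.
  have e00 : b00 = 0 by apply: cube0; jrel J (0, 0, 0, 2, 2)%N (2^-1).
  have e11 : b11 = 0 by apply: cube0; jrel J (0, 0, 0, 3, 3)%N (2^-1).
  rewrite e00 e11; apply: good_iso (good_Bn2 z p' (q' + p' * b10 / z)).
  apply: (@isoI _ _ _ (M2 1 0 (- (b10 / z)) 1) (M2 1 0 0 1)).
  - by rewrite /= mul0r subr0 mulr1 oner_neq0.
  - by rewrite /= mul0r subr0 mulr1 oner_neq0.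
  by rewrite /iso_eqs /ev0 /ev1 /od0 /od1 /=; do 2! split; split; field.
set w1 := Tab _ _ _ _ _ _ _ _ _ _ _ _ _ _ _ _ in J *.
have [H' [a [d [c [H'0 E']]]]] := triangular (Lx w1).
have I := iso_odd (w := w1) H'0 E' (commutes_scalar 0 H').
apply: (good_iso I); have {J} := iso_jordan2 J I; rewrite /=.
move: (mdet H' * p') (mdet H' * q') => p2 q2 J.
have ea : a = 0 by apply: cube0; jrel J (0, 0, 0, 2, 2)%N (2^-1).
have ed : d = 0 by apply: cube0; jrel J (0, 0, 0, 3, 3)%N (2^-1).
rewrite ea ed; apply: good_iso (good_Bn2 c q2 p2).
apply: (@isoI _ _ _ (M2 0 1 1 0) (M2 1 0 0 1)).
- by rewrite /= mulr0 sub0r mulr1 oppr_eq0 oner_neq0.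
- by rewrite /= mul0r subr0 mulr1 oner_neq0.
by rewrite /iso_eqs /ev0 /ev1 /od0 /od1 /=; do 2! split; split; ring.
Qed.

Theorem qjordan_good w : qjordan w -> good w.
Proof.
move=> J; have [w' I E] := even_normal J; apply: (good_iso I).
have {}J := iso_jordan2 J I.
case: E => [|[|[|[|[|]]]]].
- exact: good_even_ss.
- exact: good_even_sn1.
- exact: good_even_sn0.
- exact: good_even_n3.
- exact: good_even_snh.
- exact: good_even_n2.
Qed.

End Good.

Local Open Scope classical_set_scope.
Local Open Scope ring_scope.

(** * Polynomial functions, irreducibility and components *)

Section PolynomialFunctions.
Variables (K : fieldType) (I : finType).
Implicit Types (f g : affine K I -> K) (A B Y : set (affine K I)).

Definition polyfun f := exists p, forall x, f x = zeval p x.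

Lemma polyfunC a : polyfun (fun=> a).
Proof. by exists (mpolyC _ a) => x; rewrite /zeval mevalC. Qed.

Lemma polyfun_coord i : polyfun (fun x => x i).
Proof.
by exists (mpolyX _ (mnm1 (enum_rank i))) => x; rewrite /zeval mevalXU enum_rankK.
Qed.

Lemma polyfunD f g : polyfun f -> polyfun g -> polyfun (fun x => f x + g x).
Proof. by move=> [p E] [q E']; exists (p + q) => x; rewrite E E' /zeval mevalD. Qed.

Lemma polyfunN f : polyfun f -> polyfun (fun x => - f x).
Proof. by move=> [p E]; exists (- p) => x; rewrite E /zeval mevalN. Qed.

Lemma polyfunM f g : polyfun f -> polyfun g -> polyfun (fun x => f x * g x).
Proof. by move=> [p E] [q E']; exists (p * q) => x; rewrite E E' /zeval mevalM. Qed.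

Lemma polyfun_sum (J : Type) (r : seq J) (P : pred J) (F : J -> affine K I -> K) :
  (forall j, polyfun (F j)) -> polyfun (fun x => \sum_(j <- r | P j) F j x).
Proof.
move=> HF; elim: r => [|j r IH].
  by rewrite (_ : (fun _ => _) = fun=> 0); [exact: polyfunC|apply/funext => x; rewrite big_nil].
rewrite (_ : (fun _ => _) = fun x => (if P j then F j x else 0) + \sum_(j <- r | P j) F j x).
  by apply: polyfunD => //; case: (P j); [exact: HF|exact: polyfunC].
by apply/funext => x; rewrite big_cons; case: (P j); rewrite ?add0r.
Qed.

Lemma polyfun_prod (J : Type) (r : seq J) (F : J -> affine K I -> K) :
  (forall j, polyfun (F j)) -> polyfun (fun x => \prod_(j <- r) F j x).
Proof.
move=> HF; elim: r => [|j r IH].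
  by rewrite (_ : (fun _ => _) = fun=> 1); [exact: polyfunC|apply/funext => x; rewrite big_nil].
rewrite (_ : (fun _ => _) = fun x => F j x * \prod_(j <- r) F j x); first exact: polyfunM.
by apply/funext => x; rewrite big_cons.
Qed.

Lemma closed_polyfun (J : Type) (F : J -> affine K I -> K) :
  (forall j, polyfun (F j)) -> closed [set x | forall j, F j x = 0].
Proof.
move=> HF; apply/zariski_closedE; exists [set p | exists j, forall x, F j x = zeval p x].
apply/seteqP; split=> x /= Fx; first by move=> p [j <-].
by move=> j; have [p E] := HF j; rewrite E; apply: Fx; exists j.
Qed.

Lemma open_polyfun f : polyfun f -> open [set x | f x <> 0].
Proof.
move=> Hf; rewrite -closedC; have := closed_polyfun (fun _ : unit => Hf).
congr closed; apply/seteqP; split=> x /= Fx; last by move=> []; apply: contrapT.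
by move/(_ (Fx tt)).
Qed.

Lemma closed_separate A x : closed A -> ~ A x ->
  exists f, [/\ polyfun f, forall y, A y -> f y = 0 & f x <> 0].
Proof.
move=> /zariski_closedE[S ->] /existsNP[p /not_implyP[Sp px]].
by exists (zeval p); split=> //; [exists p|move=> y; apply].
Qed.

Lemma closure_polyfun A x : closure A x <->
  forall f, polyfun f -> (forall y, A y -> f y = 0) -> f x = 0.
Proof.
split=> [Ax f Hf fA|H].
  apply: contrapT => fx.
  have /Ax[y [Ay]] : nbhs x [set x | f x <> 0].
    by apply: open_nbhs_nbhs; split=> //; exact: open_polyfun.
  by apply; exact: fA.
apply: contrapT => Ax.
have [f [Hf fA fx]] := closed_separate (@closed_closure _ A) Ax.
by apply: fx; apply: H => // y Ay; apply: fA; exact: subset_closure.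
Qed.

(** A fraction with denominator a power of [d]: curves in an orbit involve inverse matrices and are
    only rational in the parameter. *)
Definition localized (d : {poly K}) (u : K -> K) :=
  exists n, exists p : {poly K}, forall s, d.[s] != 0 -> u s * d.[s] ^+ n = p.[s].

Lemma localizedC d a : localized d (fun=> a).
Proof. by exists 0%N, a%:P => s _; rewrite expr0 mulr1 hornerC. Qed.

Lemma localizedD d u v : localized d u -> localized d v -> localized d (fun s => u s + v s).
Proof.
move=> [m [p E]] [n [q F]]; exists (m + n)%N, (p * d ^+ n + q * d ^+ m) => s ds.
by rewrite hornerD !hornerM !horner_exp -(E s ds) -(F s ds) exprD mulrDl;
  rewrite !mulrA [v s * _ * _]mulrAC.
Qed.

Lemma localizedM d u v : localized d u -> localized d v -> localized d (fun s => u s * v s).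
Proof.
move=> [m [p E]] [n [q F]]; exists (m + n)%N, (p * q) => s ds.
by rewrite hornerM -(E s ds) -(F s ds) exprD mulrACA.
Qed.

(** Stated for any class of functions containing the constants and closed under sum and product,
    since it serves both for [localized] curves and for polynomial maps between affine spaces. *)
Lemma polyfun_comp (S : Type) (P : (S -> K) -> Prop) f (c : S -> affine K I) :
  (forall a, P (fun=> a)) ->
  (forall u v, P u -> P v -> P (fun s => u s + v s)) ->
  (forall u v, P u -> P v -> P (fun s => u s * v s)) ->
  polyfun f -> (forall i, P (fun s => c s i)) -> P (fun s => f (c s)).
Proof.
move=> PC PD PM [p E] Pc; rewrite (_ : (fun _ => _) = fun s => zeval p (c s)); last exact/funext.
rewrite /zeval (_ : (fun _ => _) = fun s => \sum_(m <- msupp p)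
  mcoeff m p * \prod_i c s (enum_val i) ^+ (fun_of_multinom m i)); last first.
  by apply/funext => s; rewrite mevalE.
elim: (msupp p) => [|m r IH].
  by rewrite (_ : (fun _ => _) = fun=> 0) //; apply/funext => s; rewrite big_nil.
rewrite (_ : (fun _ => _) = fun s =>
   mcoeff m p * \prod_i c s (enum_val i) ^+ (fun_of_multinom m i) +
   \sum_(m <- r) mcoeff m p * \prod_i c s (enum_val i) ^+ (fun_of_multinom m i)); last first.
  by apply/funext => s; rewrite big_cons.
apply: (PD _ _) => //; apply: (PM _ _) => //.
elim: (index_enum _) => [|i l IHl].
  by rewrite (_ : (fun _ => _) = fun=> 1) //; apply/funext => s; rewrite big_nil.
rewrite (_ : (fun _ => _) = fun s => c s (enum_val i) ^+ (fun_of_multinom m i) *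
   \prod_(i <- l) c s (enum_val i) ^+ (fun_of_multinom m i)); last first.
  by apply/funext => s; rewrite big_cons.
apply: (PM _ _) => //; elim: (fun_of_multinom m i) => [|k IHk].
  by rewrite (_ : (fun _ => _) = fun=> 1) //; apply/funext => s; rewrite expr0.
rewrite (_ : (fun _ => _) = fun s => c s (enum_val i) * c s (enum_val i) ^+ k).
  exact: PM.
by apply/funext => s; rewrite exprS.
Qed.

Lemma polyfun_localized f d (c : K -> affine K I) : polyfun f ->
  (forall i, localized d (fun s => c s i)) -> localized d (fun s => f (c s)).
Proof.
by apply: polyfun_comp; [exact: localizedC|exact: localizedD|exact: localizedM].
Qed.

End PolynomialFunctions.

Section Irreducibility.
Variables (K : numFieldType) (I : finType).
Implicit Types (A B Y : set (affine K I)).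

(** The product p d vanishes everywhere, in particular at more integers than its degree allows. *)
Lemma poly_eq0_cofinite (d p : {poly K}) : d != 0 ->
  (forall s, d.[s] != 0 -> p.[s] = 0) -> p = 0.
Proof.
move=> d0 H; have : p * d = 0.
  apply/eqP/negPn/negP => pd0.
  pose rs := [seq n%:R | n <- iota 0 (size (p * d))] : seq K.
  have : (size rs < size (p * d)%R)%N.
    apply: max_poly_roots => //; last first.
      by rewrite map_inj_uniq ?iota_uniq // => m n /eqP; rewrite Num.Theory.eqr_nat => /eqP.
    apply/allP => s _; rewrite rootE hornerM.
    by have [->|ds] := eqVneq d.[s] 0; rewrite ?mulr0 // H ?mul0r.
  by rewrite size_map size_iota ltnn.
by move/eqP; rewrite mulf_eq0 (negPf d0) orbF => /eqP.
Qed.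

Lemma closed_curve A (c : K -> affine K I) : closed A ->
  (forall i, exists p : {poly K}, forall s, c s i = p.[s]) ->
  (forall s, s != 0 -> A (c s)) -> A (c 0).
Proof.
move=> cA Hc cs; apply: contrapT => /(closed_separate cA)[f [Hf fA]]; apply.
have [] := @polyfun_localized _ _ f 1 c Hf.
  by move=> i; have [p E] := Hc i; exists 0%N, p => s _; rewrite expr0 mulr1 E.
move=> n [p E]; have {}E s : f (c s) = p.[s].
  by rewrite -E ?hornerC ?oner_eq0 // expr1n mulr1.
rewrite E (@poly_eq0_cofinite 'X p) ?horner0 ?polyX_eq0 // => s.
by rewrite hornerX => s0; rewrite -E; apply/fA/cs.
Qed.

(** If Y lay in neither A nor B, polynomials vanishing on A and on B but not at points x and y of Y
    would have, along a rational curve from x to y inside Y, numerators with product zero; one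
    numerator would be zero, against its value at an endpoint. *)
Lemma irreducible_curves Y : Y !=set0 ->
  (forall x y, Y x -> Y y -> exists (d : {poly K}) (c : K -> affine K I),
     [/\ d.[0] != 0 /\ c 0 = x, d.[1] != 0 /\ c 1 = y,
         forall i, localized d (fun s => c s i)
       & forall s, d.[s] != 0 -> Y (c s)]) ->
  irreducible Y.
Proof.
move=> Y0 H; split=> // A B cA cB YAB.
apply: contrapT => /not_orP[/existsNP[x /not_implyP[Yx Ax]] /existsNP[y /not_implyP[Yy By]]].
have [d [c [[d0 cx] [d1 cy] lc cY]]] := H x y Yx Yy.
have [f [Hf fA fx]] := closed_separate cA Ax; have [g [Hg gB gy]] := closed_separate cB By.
have [m [p Ep]] := polyfun_localized Hf lc; have [n [q Eq]] := polyfun_localized Hg lc.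
have : p * q = 0.
  apply: (@poly_eq0_cofinite d); first by apply: contraNneq d0 => ->; rewrite horner0.
  move=> s ds; rewrite hornerM -(Ep s ds) -(Eq s ds).
  by case: (YAB _ (cY s ds)) => [/fA|/gB] ->; rewrite mul0r ?mulr0 ?mul0r.
move/eqP; rewrite mulf_eq0 => /orP[] /eqP e0.
- have /eqP := Ep 0 d0; rewrite e0 horner0 mulf_eq0 expf_eq0 (negPf d0) andbF orbF cx.
  by move/eqP.
- have /eqP := Eq 1 d1; rewrite e0 horner0 mulf_eq0 expf_eq0 (negPf d1) andbF orbF cy.
  by move/eqP.
Qed.

End Irreducibility.

Section Components.
Variable T : topologicalType.
Implicit Types (X Y Z : set T).

Lemma irreducible_closure Y : irreducible Y -> irreducible (closure Y).
Proof.
move=> [[y Yy] H]; split; first by exists y; exact: subset_closure.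
move=> A B cA cB YAB.
have sub C : closed C -> Y `<=` C -> closure Y `<=` C.
  by move=> cC YC; rewrite (closure_id C).1 //; exact: closureS.
case: (H A B cA cB) => [x Yx|YA|YB]; [exact/YAB/subset_closure|left|right]; exact: sub.
Qed.

Variables (n : nat) (X : set T) (Y U : nat -> set T).
Hypothesis Xcl : X = closure (\bigcup_(i in `I_n) Y i).
Hypothesis Yirr : forall i, (i < n)%N -> irreducible (Y i).
Hypothesis Uopen : forall i, (i < n)%N -> open (U i).
Hypothesis YU : forall i, (i < n)%N -> Y i = X `&` U i.
Hypothesis Ydisj : forall i j, (i < n)%N -> (j < n)%N -> Y i `&` Y j !=set0 -> i = j.

Let closed_cover m : closed (\bigcup_(i in `I_m) closure (Y i)).
Proof.
elim: m => [|m IH]; first by rewrite II0 bigcup_set0; exact: closed0.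
rewrite (_ : \bigcup_(i in `I_m.+1) _ = (\bigcup_(i in `I_m) closure (Y i)) `|` closure (Y m)).
  by apply: closedU => //; exact: closed_closure.
by rewrite IIS bigcup_setU bigcup_set1.
Qed.

Lemma cover_closure : X = \bigcup_(i in `I_n) closure (Y i).
Proof.
rewrite Xcl; apply/seteqP; split=> [|x [i im Yx]].
  rewrite [X in _ `<=` X](closure_id _).1; last exact: closed_cover.
  by apply: closureS => x [i im Yx]; exists i => //; exact: subset_closure.
by apply: closureS Yx => y Yy; exists i.
Qed.

Let irreducible_sub Z m : irreducible Z -> Z `<=` \bigcup_(i in `I_m) closure (Y i) ->
  exists2 i, (i < m)%N & Z `<=` closure (Y i).
Proof.
move=> Zirr; elim: m => [|m IH].
  by case: Zirr => -[x Zx] _ /(_ x Zx); rewrite II0 bigcup_set0.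
rewrite IIS bigcup_setU bigcup_set1 => ZU.
case: Zirr IH => _ /(_ _ _ (@closed_cover m) (@closed_closure _ (Y m)) ZU)[Zs|Zs] IH.
  by have [i im] := IH Zs; exists i => //; exact: leqW.
by exists m.
Qed.

(** A point of [Y i] lies in the closure of [Y j], so its neighbourhood [U i] meets [Y j], and
    within X this means that [Y i] does. *)
Lemma closure_component_inj i j : (i < n)%N -> (j < n)%N ->
  closure (Y i) `<=` closure (Y j) -> i = j.
Proof.
move=> i_n j_n sub; have [[y Yy] _] := Yirr i_n.
have Uy : U i y by move: Yy; rewrite YU // => -[].
have /(sub y (subset_closure Yy))[z [Yz Uz]] : nbhs y (U i).
  by apply: open_nbhs_nbhs; split=> //; exact: Uopen.
apply: Ydisj => //; exists z; split=> //; rewrite YU //; split=> //.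
by move: Yz; rewrite YU // => -[].
Qed.

(** Finitely many closures cover X, so any irreducible subset lies in one of them. This identifies a
    component by maximality and, since the closures are not nested, shows that each of them is
    maximal. *)
Lemma componentsP Z :
  irreducible_component X Z <-> exists2 i, (i < n)%N & Z = closure (Y i).
Proof.
have subX i : (i < n)%N -> closure (Y i) `<=` X.
  by move=> i_n x Yx; rewrite cover_closure; exists i.
have irr i : (i < n)%N -> irreducible (closure (Y i)).
  by move=> /Yirr; exact: irreducible_closure.
split=> [[ZX cZ Zirr Zmax]|[i i_n ->]].
  have [i i_n Zi] : exists2 i, (i < n)%N & Z `<=` closure (Y i).
    by apply: irreducible_sub => //; rewrite -cover_closure.
  by exists i => //; apply/esym/Zmax => //; [exact: subX|exact: closed_closure|exact: irr].
split; [exact: subX|exact: closed_closure|exact: irr|].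
move=> W WX cW Wirr iW; have [j j_n Wj] : exists2 j, (j < n)%N & W `<=` closure (Y j).
  by apply: irreducible_sub => //; rewrite -cover_closure.
have e : i = j by apply: closure_component_inj => //; exact: subset_trans iW Wj.
by apply/seteqP; split=> //; rewrite e.
Qed.

End Components.

(** * The group action on tables *)

Section Transport.
Variable K : fieldType.
Implicit Types (w : tab K) (x y : vec K) (G H : mat K).

Definition minv G := let: M2 a b c d := G in
  mscale (mdet G)^-1 (M2 d (- b) (- c) a).

(** The primed matrices stand for the inverses but are kept independent, so that [mul_conj_tab] is a
    polynomial identity valid without invertibility. *)
Definition conj_tab G H G' H' w :=
  let: M2 g00 g01 g10 g11 := G' in let: M2 h00 h01 h10 h11 := H' in
  Tab (m00 G * ev0 w g00 g10 g00 g10 + m01 G * ev1 w g00 g10 g00 g10)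
      (m10 G * ev0 w g00 g10 g00 g10 + m11 G * ev1 w g00 g10 g00 g10)
      (m00 G * ev0 w g00 g10 g01 g11 + m01 G * ev1 w g00 g10 g01 g11)
      (m10 G * ev0 w g00 g10 g01 g11 + m11 G * ev1 w g00 g10 g01 g11)
      (m00 G * ev0 w g01 g11 g01 g11 + m01 G * ev1 w g01 g11 g01 g11)
      (m10 G * ev0 w g01 g11 g01 g11 + m11 G * ev1 w g01 g11 g01 g11)
      (m00 H * od0 w g00 g10 h00 h10 + m01 H * od1 w g00 g10 h00 h10)
      (m00 H * od0 w g00 g10 h01 h11 + m01 H * od1 w g00 g10 h01 h11)
      (m10 H * od0 w g00 g10 h00 h10 + m11 H * od1 w g00 g10 h00 h10)
      (m10 H * od0 w g00 g10 h01 h11 + m11 H * od1 w g00 g10 h01 h11)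
      (m00 H * od0 w g01 g11 h00 h10 + m01 H * od1 w g01 g11 h00 h10)
      (m00 H * od0 w g01 g11 h01 h11 + m01 H * od1 w g01 g11 h01 h11)
      (m10 H * od0 w g01 g11 h00 h10 + m11 H * od1 w g01 g11 h00 h10)
      (m10 H * od0 w g01 g11 h01 h11 + m11 H * od1 w g01 g11 h01 h11)
      ((m00 G * cp0 w + m01 G * cp1 w) * (h00 * h11 - h10 * h01))
      ((m10 G * cp0 w + m11 G * cp1 w) * (h00 * h11 - h10 * h01)).

Lemma mul_conj_tab G H G' H' w x y :
  mul (conj_tab G H G' H' w) x y = ap G H (mul w (ap G' H' x) (ap G' H' y)).
Proof.
case: G' H' x y => g00 g01 g10 g11 [h00 h01 h10 h11] [r0 r1 r2 r3] [s0 s1 s2 s3].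
rewrite /= !ev0_bilinear !ev1_bilinear !od0_bilinear !od1_bilinear.
rewrite /conj_tab.
move: (ev0 w g00 g10 g00 g10) (ev1 w g00 g10 g00 g10) (ev0 w g00 g10 g01 g11)
  (ev1 w g00 g10 g01 g11) (ev0 w g01 g11 g01 g11) (ev1 w g01 g11 g01 g11) => ? ? ? ? ? ?.
move: (od0 w g00 g10 h00 h10) (od1 w g00 g10 h00 h10) (od0 w g00 g10 h01 h11)
  (od1 w g00 g10 h01 h11) (od0 w g01 g11 h00 h10) (od1 w g01 g11 h00 h10)
  (od0 w g01 g11 h01 h11) (od1 w g01 g11 h01 h11) => ? ? ? ? ? ? ? ?.
by apply: V4_eq; rewrite /ev0 /ev1 /od0 /od1 /=; ring.
Qed.

Definition tact G H w := conj_tab G H (minv G) (minv H) w.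

Lemma ap_minv G H x : mdet G != 0 -> mdet H != 0 ->
  (ap G H (ap (minv G) (minv H) x) = x) * (ap (minv G) (minv H) (ap G H x) = x).
Proof.
case: G H x => a b c d [a' b' c' d'] [r0 r1 r2 r3] /= G0 H0.
by split; apply: V4_eq; field.
Qed.

Lemma mdet_minv G : mdet G != 0 -> mdet (minv G) != 0.
Proof.
case: G => a b c d /= G0.
rewrite [X in X != 0](_ : _ = (a * d - b * c)^-1) ?invr_eq0 //; by field.
Qed.

Lemma tact_iso G H w : mdet G != 0 -> mdet H != 0 -> iso (tact G H w) w.
Proof.
move=> G0 H0; exists G, H; split=> // x y.
by rewrite mul_conj_tab !ap_minv.
Qed.

Lemma tab_ext w w' : (forall x y, mul w x y = mul w' x y) -> w = w'.
Proof.
move=> E; have {}E m i j : vco m (rmul w j (bas K i)) = vco m (rmul w' j (bas K i)).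
  by rewrite -!mul_bas E.
apply: Tab_eq;
  [have := E 0%N 0%N 0%N|have := E 1%N 0%N 0%N|have := E 0%N 0%N 1%N|have := E 1%N 0%N 1%N|have := E 0%N 1%N 1%N|have := E 1%N 1%N 1%N
  |have := E 2%N 0%N 2%N|have := E 2%N 0%N 3%N|have := E 3%N 0%N 2%N|have := E 3%N 0%N 3%N
  |have := E 2%N 1%N 2%N|have := E 2%N 1%N 3%N|have := E 3%N 1%N 2%N|have := E 3%N 1%N 3%N|have := E 0%N 2%N 3%N|have := E 1%N 2%N 3%N];
  by rewrite /= !(mulr0, mulr1, addr0, add0r).
Qed.

Lemma iso_tact w w' : iso w w' ->
  exists G H, [/\ mdet G != 0, mdet H != 0 & w = tact G H w'].
Proof.
move=> [G [H [G0 H0 E]]]; exists G, H; split=> //; apply: tab_ext => x y.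
by rewrite mul_conj_tab -E !ap_minv.
Qed.

Lemma iso_sym w w' : iso w w' -> iso w' w.
Proof.
move=> [G [H [G0 H0 E]]]; exists (minv G), (minv H); split; try exact: mdet_minv.
by move=> x y; rewrite -[LHS](ap_minv _ G0 H0).2 -E !ap_minv.
Qed.

End Transport.

(** * Tables as points of the variety *)

Section Coordinates.
Variable R : realType.
Local Notation C := R[i].
Local Notation V := 'cV[C]_(2 + 2).
Implicit Types (c : sconst R 2 2) (w : tab C).

(** Structure constants extended by 0 to the triples that violate the grading, so that sums may run
    over all indices. *)
Definition co c (i j k : 'I_(2 + 2)) : C :=
  if insub (i, j, k) is Some t then c t else 0.

Lemma coE c (t : gidx 2 2) : co c (val t).1.1 (val t).1.2 (val t).2 = c t.
Proof.
rewrite /co; have -> : ((val t).1.1, (val t).1.2, (val t).2) = val t.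
  by case: (val t) => [[]].
by rewrite valK.
Qed.

Lemma co_odd c i j k : par i (+) par j != par k -> co c i j k = 0.
Proof. by move=> P; rewrite /co insubF //; apply: negbTE. Qed.

Lemma smul_coord c (x y : V) k :
  smul c x y k 0 = \sum_i \sum_j co c i j k * x i 0 * y j 0.
Proof.
rewrite pair_bigA summxE /=.
rewrite (eq_bigr (fun t : gidx 2 2 => (\sum_(ij : 'I_(2 + 2) * 'I_(2 + 2))
    if val t == (ij, k) then co c ij.1 ij.2 k * x ij.1 0 * y ij.2 0 else 0))); last first.
  move=> t _; rewrite !mxE eqxx andbT (bigD1 (val t).1) //= big1 ?addr0; last first.
    by move=> ij ne; case: eqP => // e; move: ne; rewrite e eqxx.
  have [->|ne] := eqVneq k (val t).2.
    by rewrite -surjective_pairing eqxx coE mulr1.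
  by rewrite mulr0; case: eqP => // e; case/eqP: ne; exact: (esym (congr1 snd e)).
rewrite exchange_big /=; apply: eq_bigr => -[i j] _ /=.
have [P|P] := boolP (par i (+) par j == par k); last first.
  rewrite co_odd // !mul0r big1 // => t _; by case: eqP.
pose t : gidx 2 2 := Sub (i, j, k) P.
rewrite (bigD1 t) //= eqxx big1 ?addr0 // => t' ne; case: eqP => // e.
by case/eqP: ne; apply: val_inj.
Qed.

Definition qv (x : vec C) : V := \col_k vco k x.

Definition qvec (x : V) : vec C :=
  V4 (x (Ordinal (isT : (0 < 2 + 2)%N)) 0) (x (Ordinal (isT : (1 < 2 + 2)%N)) 0)
     (x (Ordinal (isT : (2 < 2 + 2)%N)) 0) (x (Ordinal (isT : (3 < 2 + 2)%N)) 0).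

Lemma qvecK x : qv (qvec x) = x.
Proof.
apply/colP => k; rewrite !mxE; case: k => -[|[|[|[|//]]]] k4 /=;
  by congr (x _ 0); apply: val_inj.
Qed.

Lemma qvK x : qvec (qv x) = x.
Proof. by case: x => ? ? ? ?; rewrite /qvec !mxE. Qed.

Lemma bvec_qv k : bvec R k = qv (bas C k) :> V.
Proof.
by apply/colP => l; rewrite !mxE eqxx andbT; case: k l => -[|[|[|[|//]]]] k4 [[|[|[|[|//]]]] l4].
Qed.

Definition sc w : sconst R 2 2 :=
  [ffun t : gidx 2 2 => vco (val t).2 (mul w (bas C (val t).1.1) (bas C (val t).1.2))].

Lemma co_sc w i j k : co (sc w) i j k = vco k (mul w (bas C i) (bas C j)).
Proof.
rewrite /co; case: insubP => [t P e|]; first by rewrite ffunE e.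
rewrite mul_bas; case: i j k => -[|[|[|[|//]]]] i4 [[|[|[|[|//]]]] j4] [[|[|[|[|//]]]] k4] //= _;
  by rewrite ?(mulr0, addr0).
Qed.

Lemma smul_sc w x y : smul (sc w) (qv x) (qv y) = qv (mul w x y).
Proof.
apply/colP => k; rewrite smul_coord [RHS]mxE.
under eq_bigr => i _ do under eq_bigr => j _ do rewrite co_sc mul_bas !mxE.
rewrite !big_ord_recl !big_ord0 /=.
case: x y => r0 r1 r2 r3 [s0 s1 s2 s3]; case: k => -[|[|[|[|//]]]] k4 /=;
  by rewrite /ev0 /ev1 /od0 /od1; ring.
Qed.

Definition tab_of c : tab C :=
  let e n (n4 : (n < 2 + 2)%N) := Ordinal n4 in
  let o0 := e 0%N isT in let o1 := e 1%N isT in let o2 := e 2%N isT in let o3 := e 3%N isT in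
  Tab (co c o0 o0 o0) (co c o0 o0 o1) (co c o0 o1 o0) (co c o0 o1 o1) (co c o1 o1 o0) (co c o1 o1 o1)
      (co c o0 o2 o2) (co c o0 o3 o2) (co c o0 o2 o3) (co c o0 o3 o3)
      (co c o1 o2 o2) (co c o1 o3 o2) (co c o1 o2 o3) (co c o1 o3 o3) (co c o2 o3 o0) (co c o2 o3 o1).

Lemma tab_ofK w : tab_of (sc w) = w.
Proof.
by apply: Tab_eq; rewrite /tab_of /= co_sc mul_bas /= ?(mulr0, mulr1, addr0, add0r).
Qed.

Lemma sc_inj : injective sc.
Proof. exact: can_inj tab_ofK. Qed.

Lemma qv_add x y : qv (vadd x y) = qv x + qv y.
Proof.
by case: x y => ? ? ? ? [? ? ? ?]; apply/colP => -[[|[|[|[|//]]]] k4]; rewrite !mxE.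
Qed.

Lemma qv_scale a x : qv (vscale a x) = a *: qv x.
Proof.
by case: x => ? ? ? ?; apply/colP => -[[|[|[|[|//]]]] k4]; rewrite !mxE.
Qed.

Lemma homogeneous_qv a x : homogeneous a x -> exists r s, x = qv (vhom a r s) :> V.
Proof.
move=> hx; case: a hx => hx.
  exists (x (Ordinal (isT : (2 < 2 + 2)%N)) 0), (x (Ordinal (isT : (3 < 2 + 2)%N)) 0).
  by rewrite -[LHS]qvecK; congr qv; apply: V4_eq => //; exact: hx.
exists (x (Ordinal (isT : (0 < 2 + 2)%N)) 0), (x (Ordinal (isT : (1 < 2 + 2)%N)) 0).
by rewrite -[LHS]qvecK; congr qv; apply: V4_eq => //; exact: hx.
Qed.

Lemma qv_homogeneous a r s : homogeneous a (qv (vhom a r s)).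
Proof. by case: a => -[[|[|[|[|//]]]] k4] //=; rewrite !mxE. Qed.

Lemma jordan_sc w : jordan (sc w) <-> qjordan w.
Proof.
split=> [[_ J] a b g d r0 s0 r1 s1 r2 s2 r3 s3|J].
  have := J a b g d _ _ _ _ (@qv_homogeneous a r0 s0) (@qv_homogeneous b r1 s1)
    (@qv_homogeneous g r2 s2) (@qv_homogeneous d r3 s3).
  rewrite /= !smul_sc -!qv_scale -!qv_add => /(congr1 qvec); rewrite !qvK.
  by [].
split=> [a b x y /homogeneous_qv[r [s ->]] /homogeneous_qv[r' [s' ->]]|].
  rewrite !smul_sc -qv_scale; congr qv.
  by case: a b => [] []; apply: V4_eq; rewrite /= /ev0 /ev1 /od0 /od1 ?expr1 ?expr0; ring.
move=> a b g d x y z t /homogeneous_qv[r0 [s0 ->]] /homogeneous_qv[r1 [s1 ->]].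
move=> /homogeneous_qv[r2 [s2 ->]] /homogeneous_qv[r3 [s3 ->]].
rewrite !smul_sc -!qv_scale -!qv_add; congr qv; exact: J.
Qed.

(** Supercommutativity determines the products listed in the other order, and makes the square of an
    odd basis vector equal to its opposite, hence zero. *)
Lemma jordan_tab c : jordan c -> c = sc (tab_of c).
Proof.
move=> [sup _]; have cs i j k : co c i j k = (-1) ^+ (par i * par j) * co c j i k.
  have bh l : homogeneous (par l) (bvec R l : V).
    by move=> l' ne; rewrite !mxE andbT; case: eqP => // e; rewrite e eqxx in ne.
  have E u v : smul c (bvec R u) (bvec R v) k 0 = co c u v k.
    rewrite smul_coord (bigD1 u) //= (bigD1 v) //= !mxE !eqxx !mulr1.
    rewrite big1 ?addr0; last by move=> l ne; rewrite !mxE (negPf ne) mulr0.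
    rewrite big1 ?addr0 // => l ne; rewrite big1 // => l' _.
    by rewrite !mxE (negPf ne) mulr0 mul0r.
  by rewrite -!E (sup _ _ _ _ (bh i) (bh j)) mxE.
have self k (l : 'I_(2 + 2)) : par l -> co c l l k = 0.
  move=> pl; have /eqP := cs l l k; rewrite pl expr1 mulN1r -subr_eq0 opprK -mulr2n.
  by rewrite mulrn_eq0 /= => /eqP.
apply/ffunP => t; rewrite -coE ffunE mul_bas; case: (val t) => [[i j] k] /= {t}.
have o4 n (n4 n4' : (n < 2 + 2)%N) : Ordinal n4 = Ordinal n4' by apply: val_inj.
have [P|P] := boolP (par i (+) par j == par k); last first.
  rewrite co_odd //; move: P; case: i j k => -[|[|[|[|//]]]] i4 [[|[|[|[|//]]]] j4] [[|[|[|[|//]]]] k4] //= _;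
  by rewrite ?(mulr0, addr0).
case: i P => -[|[|[|[|//]]]] i4; case: j => -[|[|[|[|//]]]] j4;
  case: k => -[|[|[|[|//]]]] k4 //= _; rewrite ?(mulr0, mulr1, addr0, add0r).
all: first [by congr (co c _ _ _); apply: val_inj
  | by rewrite cs /= ?expr0 ?expr1 ?mul1r ?mulN1r ?mulNr; try congr (- _); congr (co c _ _ _); apply: val_inj
  | by rewrite [Ordinal j4](_ : _ = Ordinal i4) ?self //; apply: val_inj].
Qed.

Lemma JS_sc c : JS R 2 2 c <-> exists2 w, c = sc w & qjordan w.
Proof.
split=> [J|[w -> J]]; last exact/jordan_sc.
by have E := jordan_tab J; exists (tab_of c) => //; apply/jordan_sc; rewrite -E.
Qed.

End Coordinates.

Section Orbits.
Variable R : realType.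
Local Notation C := R[i].
Local Notation V := 'cV[C]_(2 + 2).
Implicit Types (c : sconst R 2 2) (w : tab C) (G H : mat C) (x y : vec C).

Definition mx2 G : 'M[C]_2 := \matrix_(i, j)
  if i == 0 then (if j == 0 then m00 G else m01 G) else (if j == 0 then m10 G else m11 G).
Definition bmx G H : 'M[C]_(2 + 2) := block_mx (mx2 G) 0 0 (mx2 H).

Lemma mx2_surj (g : 'M[C]_2) : exists G, g = mx2 G.
Proof.
exists (M2 (g 0 0) (g 0 1) (g 1 0) (g 1 1)); apply/matrixP => -[[|[|//]] i2] [[|[|//]] j2];
  by rewrite mxE /=; congr (g _ _); apply: val_inj.
Qed.

Lemma mx2_unit G : (mx2 G \in unitmx) = (mdet G != 0).
Proof.
rewrite unitmxE (expand_det_row _ ord0) !big_ord_recl big_ord0 /cofactor !det_mx11 !mxE /=.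
by rewrite unitfE; congr (_ != 0); case: G => a b c d /=; ring.
Qed.

Lemma bmx_unit G H : mdet G != 0 -> mdet H != 0 -> bmx G H \in unitmx.
Proof.
by move=> G0 H0; rewrite unitmxE det_ublock unitrM -!unitmxE !mx2_unit G0.
Qed.

Lemma bmx_qv G H x : bmx G H *m qv x = qv (ap G H x).
Proof.
have E y : qv y = col_mx (\col_(i < 2) vco i y) (\col_(i < 2) vco (2 + i) y).
  apply/colP => k; rewrite mxE -[k]splitK; case: (split k) => j /=.
    by rewrite col_mxEu mxE.
  by rewrite col_mxEd mxE.
rewrite !E mul_block_col !mul0mx addr0 add0r; congr col_mx; apply/colP => -[[|[|//]] i2];
  by rewrite !mxE !big_ord_recl big_ord0 !mxE /= addr0; case: x.
Qed.

Lemma invmx_bmx_qv G H x : mdet G != 0 -> mdet H != 0 ->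
  invmx (bmx G H) *m qv x = qv (ap (minv G) (minv H) x).
Proof.
move=> G0 H0; apply: (can_inj (mulKmx (bmx_unit G0 H0))).
by rewrite mulKVmx ?bmx_unit // bmx_qv ap_minv.
Qed.

Lemma Gact_sc G H w : mdet G != 0 -> mdet H != 0 ->
  Gact (bmx G H) (sc w) = sc (tact G H w).
Proof.
move=> G0 H0; apply/ffunP => t; rewrite !ffunE !bvec_qv !invmx_bmx_qv // smul_sc bmx_qv.
by rewrite mxE -mul_conj_tab.
Qed.

Lemma Gorbit_sc w c : Gorbit (sc w) c <-> exists2 w', c = sc w' & iso w' w.
Proof.
split=> [[g0 [g1 [+ + ->]]]|[w' -> /iso_tact[G [H [G0 H0 ->]]]]].
  have [G ->] := mx2_surj g0; have [H ->] := mx2_surj g1.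
  rewrite !mx2_unit => G0 H0; exists (tact G H w); first exact: Gact_sc.
  exact: tact_iso.
by exists (mx2 G), (mx2 H); rewrite !mx2_unit; split=> //; rewrite -Gact_sc.
Qed.

Lemma polyfun_co i j k : polyfun (fun c : affine C (gidx 2 2) => co (c : sconst R 2 2) i j k).
Proof.
rewrite /co; case: insub => [t|]; [exact: polyfun_coord|exact: polyfunC].
Qed.

Lemma polyfun_ext (f g : affine C (gidx 2 2) -> C) : f =1 g -> polyfun f -> polyfun g.
Proof. by move=> /funext ->. Qed.

Definition polyvec (u : affine C (gidx 2 2) -> V) := forall k, polyfun (fun c => u c k 0).

Lemma polyvecC (v : V) : polyvec (fun=> v).
Proof. by move=> k; exact: polyfunC. Qed.

Lemma polyvecD u v : polyvec u -> polyvec v -> polyvec (fun c => u c + v c).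
Proof.
move=> Hu Hv k; apply: (@polyfun_ext (fun c => u c k 0 + v c k 0)).
  by move=> c; rewrite mxE.
exact: polyfunD.
Qed.

Lemma polyvecN u : polyvec u -> polyvec (fun c => - u c).
Proof.
move=> Hu k; apply: (@polyfun_ext (fun c => - u c k 0)); first by move=> c; rewrite mxE.
exact: polyfunN.
Qed.

Lemma polyvecZ a u : polyvec u -> polyvec (fun c => a *: u c).
Proof.
move=> Hu k; apply: (@polyfun_ext (fun c => a * u c k 0)); first by move=> c; rewrite mxE.
by apply: polyfunM => //; exact: polyfunC.
Qed.

Lemma polyvec_smul u v : polyvec u -> polyvec v ->
  polyvec (fun c => smul (c : sconst R 2 2) (u c) (v c)).
Proof.
move=> Hu Hv k; apply: (@polyfun_ext (fun c : affine C (gidx 2 2) =>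
  \sum_i \sum_j co (c : sconst R 2 2) i j k * u c i 0 * v c j 0)).
  by move=> c; rewrite smul_coord.
apply: polyfun_sum => i; apply: polyfun_sum => j; apply: polyfunM => //.
by apply: polyfunM => //; exact: polyfun_co.
Qed.

(** Each coordinate of each identity, for fixed arguments, is polynomial in the structure constants.
    The homogeneous arguments serve as indices of an infinite family of equations, which a Zariski
    closed set allows. *)
Lemma closed_JS : closed (JS R 2 2).
Proof.
have vec0 (u v : V) : (forall k, (u + - v) k 0 = 0) <-> u = v.
  split=> [E|-> k]; last by rewrite subrr mxE.
  by apply/eqP; rewrite -subr_eq0; apply/eqP/colP => k; rewrite E mxE.
pose m (c : sconst R 2 2) := smul c.
pose F1 (q : {q : bool * bool * V * V * 'I_(2 + 2) |
      homogeneous q.1.1.1.1 q.1.1.2 /\ homogeneous q.1.1.1.2 q.1.2}) (c : affine C (gidx 2 2)) :=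
  let: (a, b, x, y, k) := sval q in (m c x y + - ((-1) ^+ (a * b) *: m c y x)) k 0.
pose F2 (q : {q : bool * bool * bool * bool * V * V * V * V * 'I_(2 + 2) |
      let: (a, b, g, d, x, y, z, t, k) := q in
      [/\ homogeneous a x, homogeneous b y, homogeneous g z & homogeneous d t]})
    (c : affine C (gidx 2 2)) :=
  let: (a, b, g, d, x, y, z, t, k) := sval q in
     (m c (m c (m c x y) z) t
     + (-1) ^+ (b * g + b * d + g * d) *: m c (m c (m c x t) z) y
     + (-1) ^+ (a * b + a * g + a * d + g * d) *: m c (m c (m c y t) z) x
     + - (m c (m c x y) (m c z t)
       + (-1) ^+ (d * (b + g)) *: m c (m c x t) (m c y z)
       + (-1) ^+ (b * g) *: m c (m c x z) (m c y t))) k 0.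
rewrite (_ : JS R 2 2 = [set c | forall q, F1 q c = 0] `&` [set c | forall q, F2 q c = 0]).
  apply: closedI; apply: closed_polyfun.
    move=> [[[[[a b] x] y] k] P]; rewrite /F1 /m /= {P}; move: k.
    by apply: polyvecD; [|apply: polyvecN; apply: polyvecZ];
      apply: polyvec_smul; exact: polyvecC.
  move=> [[[[[[[[[a b] g] d] x] y] z] t] k] P]; rewrite /F2 /m /= {P}; move: k {F1 F2 m vec0}.
  change (polyvec (fun c : affine C (gidx 2 2) =>
    smul (c : sconst R 2 2) (smul (c : sconst R 2 2) (smul (c : sconst R 2 2) x y) z) t
    + (-1) ^+ (b * g + b * d + g * d) *: smul (c : sconst R 2 2) (smul (c : sconst R 2 2) (smul (c : sconst R 2 2) x t) z) y
    + (-1) ^+ (a * b + a * g + a * d + g * d) *: smul (c : sconst R 2 2) (smul (c : sconst R 2 2) (smul (c : sconst R 2 2) y t) z) x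
    + - (smul (c : sconst R 2 2) (smul (c : sconst R 2 2) x y) (smul (c : sconst R 2 2) z t)
     + (-1) ^+ (d * (b + g)) *: smul (c : sconst R 2 2) (smul (c : sconst R 2 2) x t) (smul (c : sconst R 2 2) y z)
     + (-1) ^+ (b * g) *: smul (c : sconst R 2 2) (smul (c : sconst R 2 2) x z) (smul (c : sconst R 2 2) y t)))).
  by repeat first [exact: polyvecC | apply: polyvecD | apply: polyvecN | apply: polyvecZ
    | apply: polyvec_smul].
apply/seteqP; split=> c /=.
  move=> [S J]; split=> [[[[[[a b] x] y] k] [/= hx hy]]|[[[[[[[[[a b] g] d] x] y] z] t] k] [hx hy hz ht]]] /=.
    by move: k; apply/vec0; exact: S.
  by move: k; apply/vec0; exact: J.
move=> [S J]; split=> [a b x y hx hy|a b g d x y z t hx hy hz ht].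
  by apply/vec0 => k; exact: (S (exist _ (a, b, x, y, k) (conj hx hy))).
by apply/vec0 => k; exact: (J (exist _ (a, b, g, d, x, y, z, t, k) (And4 hx hy hz ht))).
Qed.

End Orbits.

(** * The separating conditions are Zariski open *)

Section Openness.
Variable R : realType.
Local Notation C := R[i].
Local Notation S := (affine C (gidx 2 2)).
Implicit Types (f g : S -> C).

Lemma polyfunX f n : polyfun f -> polyfun (fun c => f c ^+ n).
Proof.
move=> Hf; elim: n => [|n IH].
  by apply: (@polyfun_ext _ (fun=> 1)) => [c|]; [rewrite expr0|exact: polyfunC].
by apply: (@polyfun_ext _ (fun c => f c * f c ^+ n)) => [c|]; [rewrite exprS|exact: polyfunM].
Qed.

Lemma polyfun_sep ms m f g : polyfun f -> polyfun g ->
  polyfun (fun c => sep ms m (f c) (g c)).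
Proof.
move=> Hf Hg; apply: polyfun_prod => k; apply: polyfunD => //; apply: polyfunN.
by apply: polyfunM => //; exact: polyfunC.
Qed.

Lemma open_neq0 f : polyfun f -> open [set c : sconst R 2 2 | f c != 0].
Proof.
move/open_polyfun; congr open; apply/seteqP; split=> c /=; first by move/eqP.
by move=> ne e; rewrite e eqxx in ne.
Qed.

Lemma open_ex (J : Type) (A : J -> set (sconst R 2 2)) :
  (forall j, open (A j)) -> open [set c | exists j, A j c].
Proof.
move=> oA; rewrite (_ : [set c | _] = \bigcup_j A j); first exact: bigcup_open.
by apply/seteqP; split=> c /= [j]; [exists j|exists j].
Qed.

Ltac polyfun := repeat lazymatch goal with
  | |- polyfun (fun c => @?f c + @?g c) => apply: polyfunD
  | |- polyfun (fun c => - @?f c) => apply: polyfunN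
  | |- polyfun (fun c => @?f c * @?g c) => apply: polyfunM
  | |- _ => first [exact: polyfun_co | exact: polyfunC]
  end.

Lemma polyfun_tau s t s' t' : polyfun (fun c : S => tau (tab_of (c : sconst R 2 2)) s t s' t').
Proof. by rewrite /tau /trA /RA /mtr /ev0 /ev1 /tab_of /=; polyfun. Qed.

Lemma polyfun_trM s t : polyfun (fun c : S => trM (tab_of (c : sconst R 2 2)) s t).
Proof. by rewrite /trM /RM /mtr /tab_of /=; polyfun. Qed.

Lemma polyfun_qM s t s' t' : polyfun (fun c : S => qM (tab_of (c : sconst R 2 2)) s t s' t').
Proof. by rewrite /qM /RM /mtr /mmul /tab_of /=; polyfun. Qed.

Lemma polyfun_nu s t : polyfun (fun c : S => nu (tab_of (c : sconst R 2 2)) s t).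
Proof. by rewrite /nu /tau /trA /RA /mtr /ev0 /ev1 /tab_of /=; polyfun. Qed.

Ltac polyinv := repeat lazymatch goal with
  | |- polyfun (fun c => @?f c + @?g c) => apply: polyfunD
  | |- polyfun (fun c => - @?f c) => apply: polyfunN
  | |- polyfun (fun c => @?f c * @?g c) => apply: polyfunM
  | |- polyfun (fun c => @?f c ^+ _) => apply: polyfunX
  | |- _ => first [exact: polyfun_tau | exact: polyfun_trM | exact: polyfun_qM | exact: polyfunC]
  end.

Lemma polyfun_discA : polyfun (fun c : S => discA (tab_of (c : sconst R 2 2))).
Proof. by rewrite /discA; polyinv. Qed.

Lemma polyfun_numA : polyfun (fun c : S => numA (tab_of (c : sconst R 2 2))).
Proof. by rewrite /numA; polyinv. Qed.

Lemma polyfun_wedge x y : polyfun (fun c : S => wedge (RP (tab_of (c : sconst R 2 2))) x y).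
Proof. by rewrite /wedge /RP /RM /tab_of /=; polyfun. Qed.

Lemma polyfun_wedgel s t x y b : polyfun (fun c : S => let w := tab_of (c : sconst R 2 2) in
  wedge (madd (mscale 3 (mmul (RM w s t) (RP w))) (mscale (- b * trM w s t) (RP w))) x y).
Proof. by rewrite /wedge /madd /mscale /mmul /trM /mtr /RP /RM /tab_of /=; polyfun. Qed.

Lemma polyfun_wedger s t x y b : polyfun (fun c : S => let w := tab_of (c : sconst R 2 2) in
  wedge (madd (mscale 3 (mmul (RP w) (RM w s t))) (mscale (- b * trM w s t) (RP w))) x y).
Proof. by rewrite /wedge /madd /mscale /mmul /trM /mtr /RP /RM /tab_of /=; polyfun. Qed.

Lemma open_stratum_cond j : open [set c : sconst R 2 2 | stratum_cond j (tab_of c)].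
Proof.
have o1 m : open [set c : sconst R 2 2 | cond1 m (tab_of c)].
  apply: open_neq0; apply: polyfunM; first exact: polyfun_discA.
  by apply: polyfun_sep; [exact: polyfun_numA|exact: polyfun_discA].
have o2 m : open [set c : sconst R 2 2 | cond2 m (tab_of c)].
  apply: open_ex => s; apply: open_ex => t; apply: open_neq0.
  apply: polyfunM; first exact: polyfun_nu.
  by apply: polyfun_sep; [exact: polyfun_qM|exact: polyfun_nu].
rewrite /stratum_cond; case: (nth _ _ _) => [m|m|m|m b|m b|m] /=.
- exact: o1.
- rewrite (_ : [set c | _] = [set c | cond1 m (tab_of c)] `&` ([set c : sconst R 2 2 | cp0 (tab_of c) != 0] `|`
     [set c | cp1 (tab_of c) != 0])); last first.
    by apply/seteqP; split=> c /= [Uc /orP ?].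
  by apply: openI => //; apply: openU; apply: open_neq0; exact: polyfun_co.
- exact: o2.
- apply: openI; first exact: o2.
  apply: open_ex => s; apply: open_ex => t; apply: open_ex => x; apply: open_ex => y.
  by apply: open_neq0; exact: polyfun_wedgel.
- apply: openI; first exact: o2.
  apply: open_ex => s; apply: open_ex => t; apply: open_ex => x; apply: open_ex => y.
  by apply: open_neq0; exact: polyfun_wedger.
apply: openI.
  by apply: open_ex => x; apply: open_ex => y; apply: open_neq0; exact: polyfun_wedge.
apply: open_ex => s; apply: open_ex => t; apply: open_neq0; apply: polyfun_sep.
  by apply: polyfunM; [exact: polyfunC|apply: polyfunX; exact: polyfun_trM].
exact: polyfun_tau.
Qed.

End Openness.

(** * Density, relative openness and irreducibility of the strata *)

Section Strata.
Variable R : realType.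
Local Notation C := R[i].
Local Notation S := (affine C (gidx 2 2)).
Implicit Types (c : sconst R 2 2) (w : tab C) (G H : mat C).

Definition strata j : set (sconst R 2 2) := [set c | exists2 w, c = sc w & stratum j w].
Definition stratum_nbhd j : set (sconst R 2 2) := [set c | stratum_cond j (tab_of c)].
Definition all_strata := \bigcup_(j in `I_25) strata j.

Lemma stratum_qjordan j w : stratum j w -> qjordan w.
Proof.
rewrite /stratum; case: ifP => [j24 I|_ [t I]]; apply: iso_jordan (iso_sym I) _.
  exact: qjordan_tabs.
exact: qjordan_tab16.
Qed.

Lemma stratum_sub_cond j w : (j < 25)%N -> stratum j w -> stratum_cond j w.
Proof.
move=> j25; rewrite /stratum; case: ifP => [j24 I|j24 [t I]]; apply/(stratum_cond_iso j I).
  exact: stratum_cond_tabs.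
have -> : j = 24%N by apply/eqP; rewrite eqn_leq -ltnS j25 /= leqNgt j24.
exact: stratum_cond_tab16.
Qed.

Lemma Gact_all_strata G H c : mdet G != 0 -> mdet H != 0 -> all_strata c -> all_strata (Gact (bmx G H) c).
Proof.
move=> G0 H0 [j j25 [w -> Xw]]; exists j => //; exists (tact G H w); first exact: Gact_sc.
by apply: stratum_iso Xw; exact: tact_iso.
Qed.

Lemma polyvec_mulmx (A : 'M[C]_(2 + 2)) (u : S -> 'cV[C]_(2 + 2)) :
  polyvec u -> polyvec (fun c => A *m u c).
Proof.
move=> Hu k; apply: (@polyfun_ext _ (fun c => \sum_j A k j * u c j 0)).
  by move=> c; rewrite mxE.
by apply: polyfun_sum => j; apply: polyfunM => //; exact: polyfunC.
Qed.

Let Z w := closure all_strata (sc w).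

(** A fixed group element acts by a polynomial map preserving the union of the strata, hence
    preserves its closure. *)
Let Z_iso w w' : iso w w' -> Z w' -> Z w.
Proof.
move=> /iso_tact[G [H [G0 H0 ->]]] /closure_polyfun Zw'; apply/closure_polyfun => f Hf f0.
rewrite -Gact_sc //; apply: (Zw' (fun c => f (Gact (bmx G H) c))); last first.
  by move=> c /(Gact_all_strata G0 H0)/f0.
apply: (polyfun_comp _ _ _ Hf); [exact: polyfunC|exact: polyfunD|exact: polyfunM|].
move=> t; apply: (@polyfun_ext _ (fun c : S => (bmx G H *m smul (c : sconst R 2 2)
    (invmx (bmx G H) *m bvec R (val t).1.1) (invmx (bmx G H) *m bvec R (val t).1.2)) (val t).2 0)).
  by move=> c; rewrite ffunE.
by apply: polyvec_mulmx; apply: polyvec_smul; exact: polyvecC.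
Qed.

Lemma horner_mul (W : tab {poly C}) i j k s :
  vco k (mul (tev W s) (bas C i) (bas C j)) = (vco k (mul W (bas {poly C} i) (bas {poly C} j))).[s].
Proof.
rewrite !(bas_map (horner_eval s)) (mul_map (horner_eval s)).
by case: (mul _ _ _) k => ? ? ? ? [|[|[|k]]].
Qed.

Let Z_lim (u : C -> tab C) : tpoly u -> (forall s, s != 0 -> Z (u s)) -> Z (u 0).
Proof.
move=> [W E] Zu; apply: (@closed_curve _ _ _ (fun s => sc (u s) : S) (@closed_closure _ all_strata)) => //.
move=> t; exists (vco (val t).2 (mul W (bas {poly C} (val t).1.1) (bas {poly C} (val t).1.2))) => s.
by rewrite ffunE E horner_mul.
Qed.

Let Z_stratum j w : (j < 25)%N -> stratum j w -> Z w.
Proof. by move=> j25 Xw; apply: subset_closure; exists j => //; exists w. Qed.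

Lemma JS_closure : JS R 2 2 = closure all_strata.
Proof.
apply/seteqP; split=> [c /JS_sc[w -> J]|].
  by have [] := qjordan_good Z_iso Z_lim Z_stratum J.
rewrite [X in _ `<=` X](closure_id _).1; last exact: closed_JS.
by apply: closureS => c [j j25 [w -> /stratum_qjordan J]]; apply/JS_sc; exists w.
Qed.

Lemma strata_open j : (j < 25)%N -> strata j = JS R 2 2 `&` stratum_nbhd j.
Proof.
move=> j25; apply/seteqP; split=> [c [w -> Xw]|c [/JS_sc[w -> J]]].
  by split; [apply/JS_sc; exists w => //; exact: stratum_qjordan Xw|rewrite /stratum_nbhd /= tab_ofK; exact: stratum_sub_cond].
rewrite /stratum_nbhd /= tab_ofK => Uw; exists w => //.
by have [_] := qjordan_good Z_iso Z_lim Z_stratum J; exact.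
Qed.

Lemma strata_disjoint i j : (i < 25)%N -> (j < 25)%N -> strata i `&` strata j !=set0 -> i = j.
Proof.
move=> i25 j25 [_ [[w -> Xi] [w' /sc_inj <- Xj]]].
move: (stratum_sub_cond i25 Xi); move: Xj; rewrite /stratum; case: ifP => [j24 I|j24 [t I]] /(stratum_cond_iso i I).
  exact: stratum_cond_tabs_inj.
move/(stratum_cond_tab16_inj i25) ->; by apply/eqP; rewrite eqn_leq leqNgt j24 -ltnS j25.
Qed.

End Strata.

Section Families.
Variable R : realType.
Local Notation C := R[i].
Local Notation S := (affine C (gidx 2 2)).
Implicit Types (G H : mat C) (W : tab {poly C}).

Definition mev (P : mat {poly C}) s : mat C :=
  M2 (m00 P).[s] (m01 P).[s] (m10 P).[s] (m11 P).[s].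
Definition line G G' : mat {poly C} :=
  let l a b := a%:P + 'X * (b - a)%:P in
  M2 (l (m00 G) (m00 G')) (l (m01 G) (m01 G')) (l (m10 G) (m10 G')) (l (m11 G) (m11 G')).

Lemma line0 G G' : mev (line G G') 0 = G.
Proof. by case: G G' => ? ? ? ? [? ? ? ?]; apply: M2_eq; rewrite /= !hornerE /=; ring. Qed.

Lemma line1 G G' : mev (line G G') 1 = G'.
Proof. by case: G G' => ? ? ? ? [? ? ? ?]; apply: M2_eq; rewrite /= !hornerE /=; ring. Qed.

Lemma mdet_mev P s : mdet (mev P s) = (mdet P).[s].
Proof. by case: P => ? ? ? ?; rewrite /= !hornerE. Qed.

Definition madj (K : comPzRingType) (G : mat K) := let: M2 a b c d := G in M2 d (- b) (- c) a.

(** The inverse of the change of basis enters once for each factor of a product. By Cramer's rule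
    each occurrence costs one denominator [mdet P * mdet Q], hence the exponent 2; [F] is the
    resulting polynomial numerator. *)
Lemma localized_tact P Q W i j k : localized (mdet P * mdet Q)
  (fun s => vco k (mul (tact (mev P s) (mev Q s) (tev W s)) (bas C i) (bas C j))).
Proof.
pose F l := ap (mscale (mdet Q) (madj P)) (mscale (mdet P) (madj Q)) (bas {poly C} l).
exists 2%N, (vco k (ap P Q (mul W (F i) (F j)))) => s; rewrite hornerM -!mdet_mev mulf_eq0 negb_or.
case/andP=> P0 Q0; rewrite mul_conj_tab.
have ap_inv (A B : mat C) x : mdet A != 0 -> mdet B != 0 -> ap (minv A) (minv B) x
    = vscale (mdet A * mdet B)^-1 (ap (mscale (mdet B) (madj A)) (mscale (mdet A) (madj B)) x).
  rewrite (_ : minv A = mscale (mdet A)^-1 (madj A)); last by case: (A).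
  rewrite (_ : minv B = mscale (mdet B)^-1 (madj B)); last by case: (B).
  move: (mdet A) (mdet B) (madj A) (madj B) x => a b [? ? ? ?] [? ? ? ?] [? ? ? ?] a0 b0.
  by apply: V4_eq; rewrite /=; field; rewrite ?a0 ?b0.
have F_ev l : ap (minv (mev P s)) (minv (mev Q s)) (bas C l)
    = vscale (mdet (mev P s) * mdet (mev Q s))^-1 (vmap (horner_eval s) (F l)).
  rewrite ap_inv // !mdet_mev (bas_map (horner_eval s)) /F; congr vscale.
  move: (mdet P) (mdet Q) (bas _ l) => a b [? ? ? ?]; case: (P) (Q) => ? ? ? ? [? ? ? ?].
  by apply: V4_eq; rewrite /= /horner_eval !hornerE.
have mulZ a b w x y : mul w (vscale a x) (vscale b y) = vscale (a * b) (mul w x y) :> vec C.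
  by case: x y => ? ? ? ? [? ? ? ?]; apply: V4_eq; rewrite /= /ev0 /ev1 /od0 /od1; ring.
rewrite !F_ev mulZ (mul_map (horner_eval s)).
have : mdet (mev P s) * mdet (mev Q s) != 0 by rewrite mulf_neq0.
set D := mdet (mev P s) * mdet (mev Q s); move: D => D D0.
case: (mul W (F i) (F j)) => r0 r1 r2 r3.
by case: k => [|[|[|k]]]; rewrite /= /horner_eval hornerD !hornerM; field.
Qed.

(** Two points are given by two pairs of invertible matrices and two parameters. The lines joining
    these in the affine spaces of matrices and of parameters stay in the group except where a
    determinant vanishes, and yield a rational curve between the points. *)
Lemma irreducible_family W :
  irreducible [set c : sconst R 2 2 | exists2 w, c = sc w & exists t, iso w (tev W t)].
Proof.
apply: (@irreducible_curves _ (gidx 2 2)).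
  by exists (sc (tev W 0)), (tev W 0) => //; exists 0; exact: iso_refl.
move=> _ _ [_ -> [t /iso_tact[G [H [G0 H0 ->]]]]] [_ -> [t' /iso_tact[G' [H' [G'0 H'0 ->]]]]].
pose P := line G G'; pose Q := line H H'; pose q := t%:P + 'X * (t' - t)%:P.
pose V := tmap (comp_poly q) W.
have V_ev s : tev V s = tev W q.[s] by apply: Tab_eq; rewrite /= horner_comp.
exists (mdet P * mdet Q), (fun s => sc (tact (mev P s) (mev Q s) (tev V s))).
have q0 : q.[0] = t by rewrite hornerD hornerM hornerX !hornerC mul0r addr0.
have q1 : q.[1] = t' by rewrite hornerD hornerM hornerX !hornerC mul1r addrC subrK.
rewrite !hornerM -!mdet_mev !line0 !line1 !V_ev q0 q1; split.
- by split; [exact: mulf_neq0|].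
- by split; [exact: mulf_neq0|].
- move=> x; rewrite (_ : (fun _ => _) = fun s => vco (val x).2
    (mul (tact (mev P s) (mev Q s) (tev V s)) (bas C (val x).1.1) (bas C (val x).1.2))).
    exact: localized_tact.
  by apply/funext => s; rewrite ffunE.
move=> s; rewrite hornerM -!mdet_mev mulf_eq0 negb_or => /andP[P0 Q0].
exists (tact (mev P s) (mev Q s) (tev V s)) => //; exists q.[s].
by rewrite -V_ev; exact: tact_iso.
Qed.

Lemma irreducible_strata j : irreducible (@strata R j).
Proof.
case: (ltnP j 24) => [j24|j24].
  have := irreducible_family (tmap (@polyC _) (nth (tab16 0) (tabs C) j)); congr irreducible.
  have E t : tev (tmap (@polyC _) (nth (tab16 0) (tabs C) j)) t = nth (tab16 0) (tabs C) j.
    by apply: Tab_eq; rewrite /= hornerC.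
  apply/seteqP; split=> _ [w -> Iw]; exists w => //; rewrite /stratum j24 in Iw *.
    by case: Iw => t; rewrite E.
  by exists 0; rewrite E.
pose p := @polyC C.
have := irreducible_family (Tab 1%:P 0 0 0 0 1%:P (p 2^-1) 0 0 (p 2^-1) (p 2^-1) 0 0 (p 2^-1) 1%:P 'X).
congr irreducible.
have E t : tev (Tab 1%:P 0 0 0 0 1%:P (p 2^-1) 0 0 (p 2^-1) (p 2^-1) 0 0 (p 2^-1) 1%:P 'X) t = tab16 t.
  by apply: Tab_eq; rewrite /= ?hornerX ?hornerC.
rewrite /strata /stratum ltnNge j24; apply/seteqP; split=> _ [w -> [t I]]; exists w => //; exists t.
  by rewrite -E.
by rewrite E.
Qed.

End Families.

(** * Identification of the listed superalgebras with the tables *)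

Section Lists.
Variable R : realType.
Local Notation C := R[i].
Local Notation V := 'cV[C]_(2 + 2).
Implicit Types (w : tab C) (x : vec C).

Definition mono (i j : nat) x : tab C :=
  let f (a b : nat) (y : C) := if (i == a) && (j == b) then y else 0%R in
  Tab (f 0 0 (v0 x)) (f 0 0 (v1 x)) (f 0 1 (v0 x)) (f 0 1 (v1 x))
      (f 1 1 (v0 x)) (f 1 1 (v1 x)) (f 0 2 (v2 x)) (f 0 3 (v2 x))
      (f 0 2 (v3 x)) (f 0 3 (v3 x)) (f 1 2 (v2 x)) (f 1 3 (v2 x))
      (f 1 2 (v3 x)) (f 1 3 (v3 x)) (f 2 3 (v0 x)) (f 2 3 (v1 x)).

Lemma table1E (i j : 'I_(2 + 2)) x : 
  (i <= j)%N -> (i < 2)%N || (i != j) -> table [:: (i, j, qv x)] = sc (mono i j x).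
Proof.
move=> ij ne; apply/ffunP => t; rewrite !ffunE mul_bas; case: (t) => -[[a b] k] P; rewrite /val /= in P *.
rewrite !big_cons !big_nil /= !addr0.
case: i j ij ne => -[|[|[|[|//]]]] i4 [[|[|[|[|//]]]] j4] //= _ _.
all: case: a P => -[|[|[|[|//]]]] a4; case: b => -[|[|[|[|//]]]] b4;
   case: k => -[|[|[|[|//]]]] k4 //= _.
all: by rewrite ?(addr0, add0r) ?mxE ?expr1 ?expr0 ?(mulr0, mulr1, addr0, add0r, mul1r, mulN1r, oppr0).
Qed.

Definition tadd w w' := Tab (ca0 w + ca0 w') (ca1 w + ca1 w') (cb0 w + cb0 w') (cb1 w + cb1 w')
  (cc0 w + cc0 w') (cc1 w + cc1 w') (cx00 w + cx00 w') (cx01 w + cx01 w')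
  (cx10 w + cx10 w') (cx11 w + cx11 w') (cy00 w + cy00 w') (cy01 w + cy01 w')
  (cy10 w + cy10 w') (cy11 w + cy11 w') (cp0 w + cp0 w') (cp1 w + cp1 w').

Lemma table_cons p w s : table s = sc w ->
  table (p :: s) = [ffun t => table [:: p] t + sc w t] :> sconst R 2 2.
Proof.
move=> <-; apply/ffunP => t; rewrite !ffunE; case: (val t) => [[i j] k].
by rewrite ![\sum_(_ <- p :: s | _) _]big_cons ![\sum_(_ <- [:: p] | _) _]big_cons !big_nil;
  case: ifP => _; case: ifP => _; rewrite !mxE; ring.
Qed.

(** No basis vector has index 4, so [mono 4 4] is the zero table. *)
Lemma table_nil : table [::] = sc (mono 4 4 (bas C 0)).
Proof.
apply/ffunP => t; rewrite !ffunE mul_bas; case: (val t) => [[i j] k]; rewrite !big_nil !mxE.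
by case: i j k => -[|[|[|[|//]]]] i4 [[|[|[|[|//]]]] j4] [[|[|[|[|//]]]] k4];
  rewrite /= ?(mulr0, addr0, mul0r, oppr0).
Qed.

Lemma table_sc (i j : 'I_(2 + 2)) x s w : (i <= j)%N -> (i < 2)%N || (i != j) ->
  table s = sc w -> table ((i, j, qv x) :: s) = sc (tadd (mono i j x) w).
Proof.
move=> ij ne E; rewrite (table_cons _ E); apply/ffunP => t; rewrite ffunE table1E // !ffunE !mul_bas.
by case: (val t) => -[k l] m; case: k l m => -[|[|[|[|//]]]] k4 [[|[|[|[|//]]]] l4] [[|[|[|[|//]]]] m4];
  rewrite /=; ring.
Qed.

Lemma rigid_listE : rigid_list R = [seq sc w | w <- tabs C].
Proof.
have hE x : 2^-1 *: qv x = qv (vscale 2^-1 x) :> V by rewrite qv_scale.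
have E l w : (exists2 l', table l = sc l' & l' = w) -> table l = sc w by move=> [? -> ->].
rewrite /rigid_list /tabs /=; congr [:: _; _; _; _; _; _; _; _; _; _; _; _; _; _; _; _; _; _; _; _; _; _; _; _].
all: rewrite /J1 /J2 /J3 /J5 /J6 /J8 /J9 /J10 /J11 /J12 /J13 /J14 /J24 /J32 /J42 /J49 /J50 /J54 /J56 /J57 /J58 /J62 /J64 /J65.
(* The sum of the listed products is accumulated in an existential variable, then compared with the
   expected table entry by entry. *)
all: apply: E; eexists; [rewrite !bvec_qv ?hE; repeat (apply: table_sc => //); exact: table_nil|].
all: by apply: Tab_eq; rewrite /= ?(addr0, add0r, mulr0, mulr1).
Qed.

Lemma J16E (t : C) : J16 t = sc (tab16 t).
Proof.
have hE x : 2^-1 *: qv x = qv (vscale 2^-1 x) :> V by rewrite qv_scale.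
have E l w : (exists2 l', table l = sc l' & l' = w) -> table l = sc w by move=> [? -> ->].
apply: E; eexists.
  rewrite !bvec_qv -!qv_scale -qv_add; repeat (apply: table_sc => //); exact: table_nil.
by apply: Tab_eq; rewrite /= ?(addr0, add0r, mulr0, mulr1).
Qed.

End Lists.

(** * Superderivations *)

Section Superderivations.
Variable R : realType.
Local Notation C := R[i].
Local Notation V := 'cV[C]_(2 + 2).
Implicit Types (c : sconst R 2 2) (w : tab C) (d : nat -> vec C) (D : 'M[C]_(2 + 2)).

Lemma smulDl c x x' y : smul c (x + x') y = smul c x y + smul c x' y.
Proof.
by apply/colP => k; rewrite mxE !smul_coord -big_split; apply: eq_bigr => i _;
  rewrite -big_split; apply: eq_bigr => j _; rewrite !mxE mulrDr mulrDl.
Qed.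

Lemma smulDr c x y y' : smul c x (y + y') = smul c x y + smul c x y'.
Proof.
by apply/colP => k; rewrite mxE !smul_coord -big_split; apply: eq_bigr => i _;
  rewrite -big_split; apply: eq_bigr => j _; rewrite !mxE mulrDr.
Qed.

Lemma smulZl c a x y : smul c (a *: x) y = a *: smul c x y.
Proof.
apply/colP => k; rewrite mxE !smul_coord mulr_sumr; apply: eq_bigr => i _.
by rewrite mulr_sumr; apply: eq_bigr => j _; rewrite !mxE; ring.
Qed.

Lemma smulZr c a x y : smul c x (a *: y) = a *: smul c x y.
Proof.
apply/colP => k; rewrite mxE !smul_coord mulr_sumr; apply: eq_bigr => i _.
by rewrite mulr_sumr; apply: eq_bigr => j _; rewrite !mxE; ring.
Qed.

Lemma bvec_sum (x : V) : x = \sum_i x i 0 *: bvec R i.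
Proof.
apply/colP => k; rewrite summxE (bigD1 k) //= !mxE !eqxx mulr1 big1 ?addr0 // => l ne.
by rewrite !mxE eq_sym (negPf ne) mulr0.
Qed.

Lemma bvec_homogeneous (k : 'I_(2 + 2)) : homogeneous (par k) (bvec R k : V).
Proof. by move=> l ne; rewrite !mxE andbT; case: eqP => // e; rewrite e eqxx in ne. Qed.

(** For a fixed sign the defect [F] of the derivation rule is bilinear, and only basis vectors of
    parity [b] occur in a vector of parity [b]. *)
Lemma superderivationP c a D : superderivation c a D <->
  (forall i k, par k != a (+) par i -> D k i = 0) /\
  forall i j, D *m smul c (bvec R i) (bvec R j) = smul c (D *m bvec R i) (bvec R j)
     + (-1) ^+ (a * par i) *: smul c (bvec R i) (D *m bvec R j).
Proof.
have DE k i : D k i = (D *m bvec R i) k 0.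
  rewrite mxE (bigD1 i) //= mxE !eqxx mulr1 big1 ?addr0 // => l ne.
  by rewrite mxE (negPf ne) mulr0.
split=> [[hD E]|[hD E]]; split.
- by move=> i k ne; rewrite DE; apply: hD ne; exact: bvec_homogeneous.
- by move=> i j; apply: E; exact: bvec_homogeneous.
- move=> b x hx k ne; rewrite mxE big1 // => i _.
  have [e|ne'] := eqVneq (par i) b; first by rewrite hD ?mul0r ?e.
  by rewrite hx ?mulr0.
move=> b x y hx.
pose F u v := D *m smul c u v - (smul c (D *m u) v + (-1) ^+ (a * b) *: smul c u (D *m v)).
apply/eqP; rewrite -subr_eq0 -/(F x y); apply/eqP.
have FDl u u' v : F (u + u') v = F u v + F u' v.
  by rewrite /F mulmxDr !smulDl mulmxDr ?scalerDr [X in _ - X]addrACA opprD addrACA.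
have FDr u v v' : F u (v + v') = F u v + F u v'.
  by rewrite /F mulmxDr !smulDr mulmxDr scalerDr [X in _ - X]addrACA opprD addrACA.
have FZl s u v : F (s *: u) v = s *: F u v.
  by rewrite /F -scalemxAr !smulZl -scalemxAr scalerBr scalerDr !scalerA mulrC.
have FZr s u v : F u (s *: v) = s *: F u v.
  by rewrite /F -scalemxAr !smulZr -scalemxAr scalerBr scalerDr !scalerA mulrC.
rewrite (bvec_sum x) (bvec_sum y).
have F0l v : F 0 v = 0 by rewrite -[0 in LHS](scale0r 0) FZl scale0r.
have F0r u : F u 0 = 0 by rewrite -[0 in LHS](scale0r 0) FZr scale0r.
rewrite (big_morph (F^~ _) (fun u v => FDl u v _) (F0l _)) big1 // => i _.
rewrite FZl (big_morph (F _) (FDr _) (F0r _)) scaler_sumr big1 // => j _.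
have [e|ne] := eqVneq (par i) b; last by rewrite hx // scale0r.
by rewrite FZr /F -e E subrr !scaler0.
Qed.

Definition dmx d : 'M[C]_(2 + 2) := \matrix_(k, i) vco k (d i).

End Superderivations.

Definition dap (K : comPzRingType) (d : nat -> vec K) x :=
  let: V4 a0 a1 a2 a3 := x in
  vadd (vadd (vscale a0 (d 0%N)) (vscale a1 (d 1%N))) (vadd (vscale a2 (d 2%N)) (vscale a3 (d 3%N))).

(* The image of basis vector i under the superderivation d of parity a is d i. *)
Definition sder (K : comPzRingType) (w : tab K) (a : bool) (d : nat -> vec K) :=
  (forall i k, (i < 4)%N -> (k < 4)%N -> bpar k != a (+) bpar i -> vco k (d i) = 0) /\
  forall i j, (i < 4)%N -> (j < 4)%N -> dap d (mul w (bas K i) (bas K j)) =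
    vadd (mul w (d i) (bas K j)) (vscale (sgn K (a && bpar i)) (mul w (bas K i) (d j))).

Section Tables.
Variable R : realType.
Local Notation C := R[i].
Local Notation V := 'cV[C]_(2 + 2).
Implicit Types (c : sconst R 2 2) (w : tab C) (d : nat -> vec C) (D : 'M[C]_(2 + 2)).

Lemma dmx_qv d x : dmx d *m qv x = qv (dap d x).
Proof.
apply/colP => k; rewrite mxE mxE !big_ord_recl big_ord0 !mxE /= addr0.
case: x => ? ? ? ?; rewrite /dap /=.
case: (d 0%N) (d 1%N) (d 2%N) (d 3%N) => ? ? ? ? [? ? ? ?] [? ? ? ?] [? ? ? ?].
by case: k => -[|[|[|[|//]]]] k4 /=; ring.
Qed.

Lemma bpar_par (k : 'I_(2 + 2)) : bpar k = par k.
Proof. by case: k => -[|[|[|[|//]]]]. Qed.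

Lemma dap_bas d i : (i < 4)%N -> dap d (bas C i) = d i.
Proof.
rewrite /dap; case: i => [|[|[|[|//]]]] _ /=;
  case: (d 0%N) (d 1%N) (d 2%N) (d 3%N) => ? ? ? ? [? ? ? ?] [? ? ? ?] [? ? ? ?];
  by apply: V4_eq; rewrite /=; ring.
Qed.

Lemma superderivation_sc w a d : superderivation (sc w) a (dmx d) <-> sder w a d.
Proof.
have sg (i : 'I_(2 + 2)) : sgn C (a && bpar i) = (-1) ^+ (a * par i).
  by rewrite bpar_par; case: (a) (par i) => [] [].
rewrite superderivationP /sder; split=> -[hD E]; split.
- move=> i k i4 k4 ne; have := hD (Ordinal i4) (Ordinal k4); rewrite mxE => ->//.
  by rewrite -!bpar_par.
- move=> i j i4 j4; have := E (Ordinal i4) (Ordinal j4).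
  rewrite !bvec_qv !dmx_qv !smul_sc dmx_qv -qv_scale -qv_add => /(congr1 (@qvec R)); rewrite !qvK /=.
  by rewrite !dap_bas // (sg (Ordinal i4)).
- by move=> i k ne; rewrite mxE hD // !bpar_par.
move=> i j; rewrite !bvec_qv !dmx_qv !smul_sc dmx_qv -qv_scale -qv_add E // !dap_bas //.
by rewrite sg.
Qed.

Lemma dmx_surj D : exists d, D = dmx d.
Proof.
exists (fun j => if insub j is Some i then qvec (col i D) else V4 0 0 0 0).
apply/matrixP => k i; rewrite mxE valK.
have := qvecK (col i D) => /colP/(_ k); by rewrite !mxE.
Qed.

Lemma superderivation_tact G H w a D : mdet G != 0 -> mdet H != 0 ->
  superderivation (sc w) a D ->
  superderivation (sc (tact G H w)) a (bmx G H *m D *m invmx (bmx G H)).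
Proof.
move=> G0 H0 [hD E]; have u := bmx_unit G0 H0; set g := bmx G H in u *.
have hom F F' b x : homogeneous b x -> homogeneous b (bmx F F' *m x : V).
  move=> /homogeneous_qv[r [s ->]]; rewrite bmx_qv.
  by case: b => -[[|[|[|[|//]]]] k4] //= _; rewrite mxE /=; ring.
have ginv x b : homogeneous b x -> homogeneous b (invmx g *m x).
  move=> hx; have -> : x = qv (qvec x) by rewrite qvecK.
  by rewrite /g invmx_bmx_qv // -bmx_qv; apply: hom; rewrite qvecK.
have mE x y : smul (sc (tact G H w)) x y = g *m smul (sc w) (invmx g *m x) (invmx g *m y).
  rewrite -[x]qvecK -[y]qvecK !invmx_bmx_qv // !smul_sc bmx_qv; congr qv.
  exact: mul_conj_tab.
split=> [b x /ginv/hD/hom|b x y /ginv/E]; first by rewrite -!mulmxA; apply.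
move=> {}E; rewrite !mE -!mulmxA !(mulKmx u) E mulmxDr -scalemxAr.
by [].
Qed.

Lemma dim_conj n (g : 'M[C]_n) (A B : {vspace 'M[C]_n}) : g \in unitmx ->
  (forall M, M \in A -> g *m M *m invmx g \in B) -> (\dim A <= \dim B)%N.
Proof.
move=> u sub; pose f : 'End('M[C]_n) := linfun (mulmxr (invmx g) \o mulmx g).
have fE M : f M = g *m M *m invmx g by rewrite lfunE.
have f_ker : (A :&: lker f = 0)%VS.
  apply/eqP; rewrite -subv0; apply/subvP => M; rewrite memv_cap memv_ker fE => /andP[_ /eqP e].
  rewrite memv0; apply/eqP; rewrite -[M](mulKmx u) -[g *m M](mulmxKV u) e.
  by rewrite mul0mx mulmx0.
rewrite -(limg_dim_eq f_ker); apply: dimvS; apply/subvP => _ /memv_imgP[M MA ->].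
by rewrite fE sub.
Qed.

Lemma Der_super c a D : superderivation c a D -> D \in Der c.
Proof. by move=> sD; have /span_ofP := subvv (Der c); apply; exists a. Qed.

Lemma dim_Der_iso w w' : iso w w' -> (\dim (Der (sc w')) <= \dim (Der (sc w)))%N.
Proof.
move=> /iso_tact[G [H [G0 H0 ->]]]; apply: (dim_conj (bmx_unit G0 H0)).
pose f : 'End('M[C]_(2 + 2)) := linfun (mulmxr (invmx (bmx G H)) \o mulmx (bmx G H)).
have fE M : f M = bmx G H *m M *m invmx (bmx G H) by rewrite lfunE.
suff /subvP sub : (Der (sc w') <= f @^-1: Der (sc (tact G H w')))%VS.
  by move=> M /sub; rewrite -memv_preim fE.
apply/span_ofP => M [a sM]; rewrite -memv_preim fE.
by apply: (@Der_super _ a); exact: superderivation_tact.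
Qed.

End Tables.

(* Three independent superderivations of each table of dtabs, by parity and
   nonzero entries (row, column, value); the first entry is a pivot. *)
Definition dders : seq (seq (bool * seq (nat * nat * int))) :=
  let E k i (x : nat) := (k, i, Posz x) in let N k i (x : nat) := (k, i, - Posz x) in
  ([:: [:: (false, [:: E 2 2 1]); (false, [:: E 2 3 1]); (false, [:: E 3 2 1])];
       [:: (false, [:: E 2 2 1]); (false, [:: E 3 3 1]); (true, [:: E 1 3 1])];
       [:: (false, [:: E 2 2 1]); (false, [:: E 3 3 1]); (true, [:: E 3 1 1])];
       [:: (false, [:: E 2 2 1]); (false, [:: E 3 3 1]); (true, [:: E 3 1 1])];
       [:: (false, [:: E 2 3 1]); (false, [:: E 3 2 1]); (false, [:: E 3 3 1; N 2 2 1])];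
       [:: (false, [:: E 2 3 1]); (false, [:: E 3 2 1]); (false, [:: E 3 3 1; N 2 2 1])];
       [:: (false, [:: E 2 2 1]); (false, [:: E 3 3 1]); (true, [:: E 3 1 1; N 3 0 1])];
       [:: (false, [:: E 2 2 1]); (false, [:: E 3 3 1]); (true, [:: E 1 2 1])];
       [:: (false, [:: E 2 2 1]); (false, [:: E 3 3 1]); (true, [:: E 3 1 1; N 3 0 1])];
       [:: (false, [:: E 2 2 1]); (false, [:: E 3 3 1]); (true, [:: E 2 1 1])];
       [:: (false, [:: E 2 2 1]); (false, [:: E 3 3 1]); (true, [:: E 2 1 1])];
       [:: (false, [:: E 2 2 1]); (false, [:: E 3 3 1]); (true, [:: E 0 3 1])];
       [:: (false, [:: E 3 2 1]); (false, [:: E 3 3 1; E 1 1 1]); (true, [:: E 1 2 1])];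
       [:: (false, [:: E 3 2 1]); (false, [:: E 3 3 1; E 1 1 1]); (true, [:: E 3 0 1; N 1 2 2])];
       [:: (false, [:: E 3 2 1]); (false, [:: E 3 3 1; E 1 1 1]); (true, [:: E 3 0 1; E 1 2 2])];
       [:: (false, [:: E 3 2 1]); (false, [:: E 3 3 1; E 1 1 1]); (true, [:: E 1 2 1])];
       [:: (false, [:: E 1 0 1]); (false, [:: E 1 1 1]); (false, [:: E 2 2 1])];
       [:: (false, [:: E 2 2 1; E 1 1 1]); (false, [:: E 2 3 2; E 1 0 1]); (true, [:: E 1 3 1])];
       [:: (false, [:: E 3 2 2; N 1 0 1]); (false, [:: E 3 3 1; E 1 1 1]); (true, [:: E 3 0 1; E 1 2 2])];
       [:: (false, [:: E 1 0 1]); (false, [:: E 1 1 1]); (false, [:: E 2 2 1])];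
       [:: (false, [:: E 1 0 1]); (false, [:: E 1 1 1]); (false, [:: E 2 2 1])];
       [:: (false, [:: E 2 2 1; E 1 1 1]); (false, [:: E 2 3 2; E 1 0 1]); (true, [:: E 1 2 1; E 0 3 2])];
       [:: (false, [:: E 3 2 2; N 1 0 1]); (false, [:: E 3 3 1; E 1 1 1]); (true, [:: E 1 2 1])];
       [:: (false, [:: E 1 0 1]); (false, [:: E 1 1 1]); (false, [:: E 2 2 1])]])%N.

Definition entry (l : seq (nat * nat * int)) (k i : nat) : int :=
  foldr (fun p x => if (p.1.1 == k) && (p.1.2 == i) then p.2 + x else x) 0 l.
Definition ecol l i : vec int :=
  V4 (entry l 0%N i) (entry l 1%N i) (entry l 2%N i) (entry l 3%N i).
Definition pivot (D : bool * seq (nat * nat * int)) := (head (0%N, 0%N, 0) D.2).1.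

Definition sder_check (W : tab int) (D : bool * seq (nat * nat * int)) :=
  all (fun i => all (fun k => (bpar k == D.1 (+) bpar i) || (entry D.2 k i == 0)) (iota 0 4)) (iota 0 4) &&
  all (fun i => all (fun j => veq (dap (ecol D.2) (mul W (bas _ i) (bas _ j)))
    (vadd (mul W (ecol D.2 i) (bas _ j))
       (vscale (sgn _ (D.1 && bpar i)) (mul W (bas _ i) (ecol D.2 j))))) (iota 0 4)) (iota 0 4).

Definition pivot_check (Ds : seq (bool * seq (nat * nat * int))) :=
  all (fun D => ((pivot D).1 < 4)%N && ((pivot D).2 < 4)%N) Ds &&
  all (fun k => all (fun l =>
     (entry (nth (false, [::]) Ds k).2 (pivot (nth (false, [::]) Ds l)).1
                        (pivot (nth (false, [::]) Ds l)).2 == 0) (+) (k == l)) (iota 0 (size Ds)))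
    (iota 0 (size Ds)).

Lemma dders_check : all (fun i => all (sder_check (nth (dBss 0 0 0 0 0 0) dtabs i)) (nth [::] dders i)
  && pivot_check (nth [::] dders i) && (size (nth [::] dders i) == 3)) (iota 0 24).
Proof. by vm_compute. Qed.

(** * Dimensions of the spaces of superderivations *)

Section Dimensions.
Variable R : realType.
Local Notation C := R[i].
Local Notation f := (intr : int -> C).

(** The derivation rule is linear in the table, so the doubled integral table has the same
    superderivations. *)
Lemma sder_checkP W D w : sder_check W D -> tmap f W = tmap (fun c => 2%:R * c) w ->
  sder w D.1 (fun i => vmap f (ecol D.2 i)).
Proof.
case: D => a l /andP[/allP par_l /allP der_l] E; split.
  move=> i k i4 k4 ne; have := par_l i; rewrite mem_iota i4 => /(_ isT)/allP/(_ k).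
  rewrite mem_iota k4 (negPf ne) => /(_ isT)/eqP e.
  by move: k4 e; case: k {ne} => [|[|[|[|//]]]] _ /= ->.
move=> i j i4 j4; have := der_l i; rewrite mem_iota i4 => /(_ isT)/allP/(_ j).
rewrite mem_iota j4 => /(_ isT).
have dap_map (d : nat -> vec int) x : vmap f (dap d x) = dap (fun i => vmap f (d i)) (vmap f x).
  rewrite /dap; case: x => ? ? ? ?; rewrite /=.
  case: (d 0%N) (d 1%N) (d 2%N) (d 3%N) => ? ? ? ? [? ? ? ?] [? ? ? ?] [? ? ? ?].
  by apply: V4_eq; rewrite !(rmorphD, rmorphM).
set x := dap _ _; set y := vadd _ _ => xy; have {xy} : x = y.
  by move: xy; case: x y => ? ? ? ? [? ? ? ?] /and4P[/eqP/= -> /eqP/= -> /eqP/= -> /eqP/= ->].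
move/(congr1 (vmap f)); rewrite /x /y dap_map -vadd_map -vscale_map -!mul_map -!bas_map E.
have mulE u v : mul (tmap (fun c => 2%:R * c) w) u v = vscale 2%:R (mul w u v).
  by case: u v => ? ? ? ? [? ? ? ?]; apply: V4_eq; rewrite /= /ev0 /ev1 /od0 /od1 /=; ring.
have dapZ (d : nat -> vec C) u : dap d (vscale 2%:R u) = vscale 2%:R (dap d u).
  rewrite /dap; case: u => ? ? ? ?; rewrite /=.
  case: (d 0%N) (d 1%N) (d 2%N) (d 3%N) => ? ? ? ? [? ? ? ?] [? ? ? ?] [? ? ? ?].
  by apply: V4_eq; rewrite /=; ring.
have vaddZ (u v : vec C) s : vadd (vscale 2%:R u) (vscale s (vscale 2%:R v))
    = vscale 2%:R (vadd u (vscale s v)).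
  by case: u v => ? ? ? ? [? ? ? ?]; apply: V4_eq; rewrite /=; ring.
have inj2 (u v : vec C) : vscale 2%:R u = vscale 2%:R v -> u = v.
  have n0 : 2%:R != 0 :> C by rewrite pnatr_eq0.
  by case: u v => ? ? ? ? [? ? ? ?] [] /(mulfI n0)-> /(mulfI n0)-> /(mulfI n0)-> /(mulfI n0)->.
by rewrite !mulE dapZ vaddZ => /inj2.
Qed.

(** Reading a linear relation at the entry ([r l], [s l]) isolates the coefficient of [X l]. *)
Lemma dim_pivots p n (A : {vspace 'M[C]_p}) (X : 'I_n -> 'M[C]_p) (r s : 'I_n -> 'I_p) :
  (forall k, X k \in A) -> (forall k, X k (r k) (s k) != 0) ->
  (forall k l, k != l -> X k (r l) (s l) = 0) -> (n <= \dim A)%N.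
Proof.
move=> XA X1 X0; pose T := [tuple X k | k < n].
have fT : free T.
  apply/freeP => a a0 l; have /matrixP/(_ (r l) (s l)) := a0.
  rewrite summxE (bigD1 l) //= big1 ?addr0 => [|k ne]; last first.
    by rewrite !mxE nth_mktuple X0 ?mulr0.
  by rewrite !mxE nth_mktuple => /eqP; rewrite mulf_eq0 (negPf (X1 l)) orbF => /eqP.
have <- : \dim <<T>> = n by move: fT; rewrite /free size_tuple => /eqP.
apply: dimvS; apply/span_subvP => _ /mapP[k _ ->]; exact: XA.
Qed.

Lemma dim_Der_tabs i : (i < 24)%N -> (3 <= \dim (Der (sc (nth (tab16 0) (tabs C) i))))%N.
Proof.
move=> i24; have /allP/(_ i) := dders_check; rewrite mem_iota i24 => /(_ isT).
case/andP=> /andP[/allP ders /andP[/allP piv4 /allP piv]] /eqP sz.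
set Ds := nth [::] dders i in ders piv4 piv sz; pose D k := nth (false, [::]) Ds k.
have D_in (k : 'I_3) : D k \in Ds by rewrite mem_nth // sz.
have p4 (k : 'I_3) : ((pivot (D k)).1 < 4)%N && ((pivot (D k)).2 < 4)%N by exact/piv4/D_in.
pose r (k : 'I_3) : 'I_(2 + 2) := Ordinal (andP (p4 k)).1.
pose s (k : 'I_3) : 'I_(2 + 2) := Ordinal (andP (p4 k)).2.
pose X (k : 'I_3) := dmx (fun i => vmap f (ecol (D k).2 i)).
have XE k u v : X k u v = f (entry (D k).2 u v).
  by rewrite mxE; case: u => -[|[|[|[|//]]]].
have piv_kl (k l : 'I_3) : (entry (D k).2 (r l) (s l) == 0) = (k != l).
  have := piv k; rewrite mem_iota sz ltn_ord => /(_ isT)/allP/(_ l).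
  by rewrite mem_iota ltn_ord => /(_ isT); rewrite -/(D k) -/(D l) -val_eqE /=; case: (_ == 0); case: (_ == _).
apply: (@dim_pivots _ _ _ X r s).
- move=> k; apply: (@Der_super _ _ (D k).1); apply/superderivation_sc.
  by apply: (@sder_checkP (nth (dBss 0 0 0 0 0 0) dtabs i)); [exact/ders/D_in|exact: dtabsE].
- by move=> k; rewrite XE intr_eq0 piv_kl eqxx.
by move=> k l ne; rewrite XE; apply/eqP; rewrite intr_eq0 piv_kl.
Qed.

End Dimensions.

Section Exact.
Variable R : realType.
Local Notation C := R[i].
Implicit Types (w : tab C) (d : nat -> vec C).

Definition dev (a b c e f g h k : C) (i : nat) : vec C :=
  match i with 0 => V4 a b 0 0 | 1 => V4 c e 0 0 | 2 => V4 0 0 f g | _ => V4 0 0 h k end.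
Definition dod (a b c e f g h k : C) (i : nat) : vec C :=
  match i with 0 => V4 0 0 a b | 1 => V4 0 0 c e | 2 => V4 f g 0 0 | _ => V4 h k 0 0 end.

Lemma dmx_ext d d' : (forall i, (i < 4)%N -> d i = d' i) -> dmx d = dmx d'.
Proof. by move=> E; apply/matrixP => k i; rewrite !mxE E. Qed.

Lemma sder_ext w a d d' : (forall i, (i < 4)%N -> d i = d' i) -> sder w a d -> sder w a d'.
Proof.
move=> E /superderivation_sc sd; apply/superderivation_sc.
by rewrite -(dmx_ext E).
Qed.

Lemma sder_even w d : sder w false d -> exists a b c e f g h k,
  sder w false (dev a b c e f g h k) /\ dmx d = dmx (dev a b c e f g h k).
Proof.
move=> sd; have [par_d _] := sd.
exists (v0 (d 0%N)), (v1 (d 0%N)), (v0 (d 1%N)), (v1 (d 1%N)),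
  (v2 (d 2%N)), (v3 (d 2%N)), (v2 (d 3%N)), (v3 (d 3%N)).
set d' := dev _ _ _ _ _ _ _ _.
have E i : (i < 4)%N -> d i = d' i.
  have P i' k' := par_d i' k'.
  case: i => [|[|[|[|//]]]] _; rewrite /d' /=.
  - by move: (P 0 2 isT isT isT) (P 0 3 isT isT isT)%N; case: (d 0%N) => ? ? ? ? /= -> ->.
  - by move: (P 1 2 isT isT isT) (P 1 3 isT isT isT)%N; case: (d 1%N) => ? ? ? ? /= -> ->.
  - by move: (P 2 0 isT isT isT) (P 2 1 isT isT isT)%N; case: (d 2%N) => ? ? ? ? /= -> ->.
  - by move: (P 3 0 isT isT isT) (P 3 1 isT isT isT)%N; case: (d 3%N) => ? ? ? ? /= -> ->.
by split; [exact: sder_ext sd|exact: dmx_ext].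
Qed.

Lemma sder_odd w d : sder w true d -> exists a b c e f g h k,
  sder w true (dod a b c e f g h k) /\ dmx d = dmx (dod a b c e f g h k).
Proof.
move=> sd; have [par_d _] := sd.
exists (v2 (d 0%N)), (v3 (d 0%N)), (v2 (d 1%N)), (v3 (d 1%N)),
  (v0 (d 2%N)), (v1 (d 2%N)), (v0 (d 3%N)), (v1 (d 3%N)).
set d' := dod _ _ _ _ _ _ _ _.
have E i : (i < 4)%N -> d i = d' i.
  have P i' k' := par_d i' k'.
  case: i => [|[|[|[|//]]]] _; rewrite /d' /=.
  - by move: (P 0 0 isT isT isT) (P 0 1 isT isT isT)%N; case: (d 0%N) => ? ? ? ? /= -> ->.
  - by move: (P 1 0 isT isT isT) (P 1 1 isT isT isT)%N; case: (d 1%N) => ? ? ? ? /= -> ->.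
  - by move: (P 2 2 isT isT isT) (P 2 3 isT isT isT)%N; case: (d 2%N) => ? ? ? ? /= -> ->.
  - by move: (P 3 2 isT isT isT) (P 3 3 isT isT isT)%N; case: (d 3%N) => ? ? ? ? /= -> ->.
by split; [exact: sder_ext sd|exact: dmx_ext].
Qed.

Lemma dim_Der_le w n (X : 'I_n -> 'M[C]_(2 + 2)) :
  (forall a d, sder w a d -> exists u : 'I_n -> C, dmx d = \sum_k u k *: X k) ->
  (\dim (Der (sc w)) <= n)%N.
Proof.
move=> H; pose T := [tuple X k | k < n].
have : (Der (sc w) <= <<T>>)%VS.
  apply/span_ofP => D [a]; have [d ->] := dmx_surj D.
  move/superderivation_sc/H=> [u ->]; apply: memv_suml => k _; apply: memvZ.
  by apply: memv_span; apply/mapP; exists k; rewrite ?mem_enum.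
by move/dimvS/leq_trans; apply; rewrite (leq_trans (dim_span _)) // size_tuple.
Qed.

Tactic Notation "drel" constr(E) constr(q) uconstr(c) :=
  match q with
  | (?i, ?j, ?m) =>
    refine (eq0_of_eq (c := c) (congr1 (vco m) (E i j isT isT)) _);
    rewrite /= /ev0 /ev1 /od0 /od1 /=; field
  end.

Lemma dim_Der_J2 : \dim (Der (sc (Bss 0 0 0 1 0 0 : tab C))) = 3%N.
Proof.
apply/eqP; rewrite eqn_leq (@dim_Der_tabs R 1) // andbT.
pose X (k : 'I_3) := dmx (if (k < 2)%N then dev 0 0 0 0 (k == 0%N :> nat)%:R 0 0 (k == 1%N :> nat)%:R
                   else dod 0 0 0 0 0 0 0 1).
apply: (@dim_Der_le _ _ X) => -[] d.
  move=> /sder_odd[a [b [c [e [f [g [h [k [[_ E] ->]]]]]]]]].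
  exists (fun i => if (i == 2%N :> nat) then k else 0).
  have a0 : a = 0 by drel E (0, 0, 2)%N 1.
  have b0 : b = 0 by drel E (0, 0, 3)%N 1.
  have c0 : c = 0 by drel E (1, 1, 2)%N 1.
  have e0 : e = 0 by drel E (1, 1, 3)%N (-1).
  have f0 : f = 0 by drel E (0, 2, 0)%N (-1).
  have g0 : g = 0 by drel E (1, 2, 1)%N (-1).
  have h0 : h = 0 by drel E (1, 3, 0)%N 1.
  rewrite a0 b0 c0 e0 f0 g0 h0 !big_ord_recl big_ord0 /=.
  apply/matrixP => r s; rewrite !mxE /=.
  by case: r s => -[|[|[|[|//]]]] r4 [[|[|[|[|//]]]] s4]; rewrite /=; ring.
move=> /sder_even[a [b [c [e [f [g [h [k [[_ E] ->]]]]]]]]].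
exists (fun i => if (i == 0%N :> nat) then f else if (i == 1%N :> nat) then k else 0).
have a0 : a = 0 by drel E (0, 0, 0)%N (-1).
have b0 : b = 0 by drel E (0, 0, 1)%N 1.
have c0 : c = 0 by drel E (1, 1, 0)%N 1.
have e0 : e = 0 by drel E (1, 1, 1)%N (-1).
have h0 : h = 0 by drel E (1, 3, 2)%N 1.
have g0 : g = 0 by drel E (1, 2, 3)%N (-1).
rewrite a0 b0 c0 e0 g0 h0 !big_ord_recl big_ord0 /=.
apply/matrixP => r s; rewrite !mxE /=.
by case: r s => -[|[|[|[|//]]]] r4 [[|[|[|[|//]]]] s4]; rewrite /=; ring.
Qed.

Lemma dim_Der_J16 t : \dim (Der (sc (tab16 t : tab C))) = 5%N.
Proof.
(* An even superderivation kills both idempotents, hence also f_0 f_1, so its odd block has trace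
   zero: three parameters. An odd one kills the unit, the sum of the idempotents, and is determined
   by the image of the first idempotent: two more. *)
pose de f g h := dev 0 0 0 0 f g h (- f).
pose dd a b := dod a b (- a) (- b) (2 * b) (- (2 * b * t)) (- (2 * a)) (2 * a * t).
pose X (k : 'I_5) := if (k < 3)%N
  then dmx (de (k == 0%N :> nat)%:R (k == 1%N :> nat)%:R (k == 2%N :> nat)%:R)
  else dmx (dd (k == 3%N :> nat)%:R (k == 4%N :> nat)%:R).
apply/eqP; rewrite eqn_leq; apply/andP; split.
  apply: (@dim_Der_le _ _ X) => -[] d.
    move=> /sder_odd[a [b [c [e [f [g [h [k [[_ E] ->]]]]]]]]].
    exists (fun i => if (i == 3%N :> nat) then a else if (i == 4%N :> nat) then b else 0).
    have -> : c = - a by apply/subr0_eq; drel E (0, 1, 2)%N (-2).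
    have -> : e = - b by apply/subr0_eq; drel E (0, 1, 3)%N (-2).
    have -> : f = 2 * b by apply/subr0_eq; drel E (0, 2, 0)%N (-2).
    have -> : g = - (2 * b * t) by apply/subr0_eq; drel E (0, 2, 1)%N 2.
    have -> : h = - (2 * a) by apply/subr0_eq; drel E (0, 3, 0)%N (-2).
    have -> : k = 2 * a * t by apply/subr0_eq; drel E (0, 3, 1)%N 2.
    rewrite !big_ord_recl big_ord0 /X /=; apply/matrixP => r s; rewrite !mxE /=.
    by case: r s => -[|[|[|[|//]]]] r4 [[|[|[|[|//]]]] s4]; rewrite /=; ring.
  move=> /sder_even[a [b [c [e [f [g [h [k [[_ E] ->]]]]]]]]].
  exists (fun i => if (i == 0%N :> nat) then f else if (i == 1%N :> nat) then g else
                   if (i == 2%N :> nat) then h else 0).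
  have -> : a = 0 by drel E (0, 0, 0)%N (-1).
  have -> : b = 0 by drel E (0, 0, 1)%N 1.
  have -> : c = 0 by drel E (1, 1, 0)%N 1.
  have -> : e = 0 by drel E (1, 1, 1)%N (-1).
  have -> : k = - f.
    have a0 : a + t * c = 0.
      have -> : a = 0 by drel E (0, 0, 0)%N (-1).
      have -> : c = 0 by drel E (1, 1, 0)%N 1.
      by ring.
    apply/subr0_eq; have : k - - f - (a + t * c) = 0 by drel E (2, 3, 0)%N (-1).
    by rewrite a0 subr0.
  rewrite !big_ord_recl big_ord0 /X /=; apply/matrixP => r s; rewrite !mxE /=.
  by case: r s => -[|[|[|[|//]]]] r4 [[|[|[|[|//]]]] s4]; rewrite /=; ring.
have sde f g h : sder (tab16 t) false (de f g h).
  split=> [[|[|[|[|//]]]] [|[|[|[|//]]]] //|i j i4 j4].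
  case: i j i4 j4 => [|[|[|[|//]]]] [|[|[|[|//]]]] _ _;
    by apply: V4_eq; rewrite /= /ev0 /ev1 /od0 /od1 /=; field.
have sdd a b : sder (tab16 t) true (dd a b).
  split=> [[|[|[|[|//]]]] [|[|[|[|//]]]] //|i j i4 j4].
  case: i j i4 j4 => [|[|[|[|//]]]] [|[|[|[|//]]]] _ _;
    by apply: V4_eq; rewrite /= /ev0 /ev1 /od0 /od1 /=; field.
pose r (k : 'I_5) : 'I_(2 + 2) := Ordinal (ltn_pmod (nth 0 [:: 2; 3; 2; 2; 3] k) (isT : 0 < 4))%N.
pose s (k : 'I_5) : 'I_(2 + 2) := Ordinal (ltn_pmod (nth 0 [:: 2; 2; 3; 0; 0] k) (isT : 0 < 4))%N.
apply: (@dim_pivots _ _ _ _ X r s).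
- move=> k; rewrite /X; case: ifP => _; [apply: (@Der_super _ _ false)|apply: (@Der_super _ _ true)].
    exact/superderivation_sc/sde.
  exact/superderivation_sc/sdd.
- by case=> -[|[|[|[|[|//]]]]] k5; rewrite /X /= mxE /= oner_neq0.
case=> -[|[|[|[|[|//]]]]] k5 [[|[|[|[|[|//]]]]] l5] // _; rewrite /X /= mxE /=; by rewrite ?oppr0.
Qed.

End Exact.

Local Open Scope card_scope.
Local Open Scope ring_scope.

(** * Components and their dimensions *)

Section Final.
Variable R : realType.
Local Notation C := R[i].
Implicit Types (c : sconst R 2 2) (w : tab C).
Local Notation N i := (nth (tab16 0) (tabs C) i).
Local Notation strata := (@strata R).

Lemma Gorbit_refl c : Gorbit c c.
Proof.
exists 1%:M, 1%:M; rewrite !unitmx1; split=> //.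
rewrite -scalar_mx_block -[LHS]smulK; apply/ffunP => t.
by rewrite !ffunE invmx1 !mul1mx.
Qed.

Lemma strata_orbit i : (i < 24)%N -> strata i = Gorbit (sc (N i)).
Proof.
move=> i24; apply/seteqP; split=> c; rewrite Gorbit_sc /Defs.sconst => -[w e I]; exists w => //;
  by move: I; rewrite /stratum i24.
Qed.

Lemma strata_J16 : strata 24 = \bigcup_t Gorbit (J16 t).
Proof.
apply/seteqP; split=> [c [w -> [t I]]|c [t _]].
  by exists t => //; rewrite J16E; apply/Gorbit_sc; exists w.
by rewrite J16E => /Gorbit_sc[w -> I]; exists w => //; exists t.
Qed.

Lemma componentP Z : irreducible_component (JS R 2 2) Z <->
  exists2 i, (i < 25)%N & Z = closure (strata i).
Proof.
apply: (@componentsP _ 25 _ strata (@stratum_nbhd R)); first exact: JS_closure.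
- by move=> i _; exact: irreducible_strata.
- by move=> i _; exact: open_stratum_cond.
- by move=> i; exact: strata_open.
by move=> i j i25 j25; exact: strata_disjoint.
Qed.

Lemma closure_strata_inj i j : (i < 25)%N -> (j < 25)%N -> closure (strata i) = closure (strata j) -> i = j.
Proof.
move=> i25 j25 e.
apply: (@closure_component_inj _ 25 (JS R 2 2) strata (@stratum_nbhd R) _ _ _ _ i j i25 j25).
- by move=> k _; exact: irreducible_strata.
- by move=> k _; exact: open_stratum_cond.
- by move=> k; exact: strata_open.
- by move=> k l k25 l25; exact: strata_disjoint.
by move: e => ->.
Qed.

Lemma closure_strata_JS i : (i < 25)%N -> closure (strata i) `<=` JS R 2 2.
Proof.
by move=> i25; rewrite JS_closure; apply: closureS => c Xc; exists i.
Qed.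

Lemma orbit_meets_nbhd i c c' : (i < 25)%N -> JS R 2 2 c -> Gorbit c c' -> stratum_nbhd i c' -> strata i c.
Proof.
move=> i25 Jc; rewrite strata_open //; have [w e _] := (JS_sc c).1 Jc; move: Jc; rewrite {}e => Jc.
move=> /Gorbit_sc[w' -> I] Uc; split; first exact: Jc.
by move: Uc; rewrite /stratum_nbhd /= !tab_ofK => /(stratum_cond_iso i I).
Qed.

(** The orbit is dense in the closure of the stratum, so it meets the open neighbourhood of the
    stratum; as the condition is invariant, [c] itself satisfies it. *)
Lemma closure_orbit_strata i c : (i < 25)%N -> closure (strata i) = closure (Gorbit c) -> strata i c.
Proof.
move=> i25 e; have Jc : JS R 2 2 c.
  by apply: (closure_strata_JS i25); rewrite e; exact/subset_closure/Gorbit_refl.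
have [[y Xy] _] := @irreducible_strata R i; have Uy : stratum_nbhd i y by move: Xy; rewrite strata_open // => -[].
have : closure (Gorbit c) y by rewrite -e; exact: subset_closure.
case/(_ (stratum_nbhd i)) => [|c' [Gc' Uc']]; last exact: orbit_meets_nbhd Uc'.
by apply: open_nbhs_nbhs; split=> //; exact: open_stratum_cond.
Qed.

(** At least three independent superderivations, and 16 - 3 = 13. *)
Lemma orbit_dim_rigid i c : (i < 24)%N -> strata i c -> (orbit_dim c <= 13)%N.
Proof.
move=> i24 [w ->]; rewrite /stratum i24 => /dim_Der_iso d3.
exact: (leq_sub2l 16 (leq_trans (dim_Der_tabs R i24) d3)).
Qed.

Lemma orbit_dim_J16 c : strata 24 c -> orbit_dim c = 11%N.
Proof.
move=> [w -> [t I]]; rewrite /orbit_dim.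
have -> // : \dim (Der (sc w)) = 5%N.
apply: etrans (dim_Der_J16 t); apply: anti_leq; apply/andP; split; last exact: dim_Der_iso I.
exact: dim_Der_iso (iso_sym I).
Qed.

(* A one-parameter family with the same closure meets the open stratum 24 for all
   but finitely many values of the parameter. *)
Lemma family_dim_J16 p d : closure (strata 24) = closure (\bigcup_t Gorbit (poly_family p t)) ->
  finite_set [set t | (orbit_dim (poly_family p t)).+1 <> d] -> d = 12%N.
Proof.
move=> e /finite_seqP[s fin_s].
have Jp t : JS R 2 2 (poly_family p t).
  apply: (@closure_strata_JS 24) => //; rewrite e; apply: subset_closure.
  by exists t => //; exact: Gorbit_refl.
have [[y Xy] _] := @irreducible_strata R 24; have Uy : stratum_nbhd 24 y by move: Xy; rewrite strata_open // => -[].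
have : closure (\bigcup_t Gorbit (poly_family p t)) y by rewrite -e; exact: subset_closure.
case/(_ (stratum_nbhd 24)) => [|c' [[t0 _ Gc'] Uc']].
  by apply: open_nbhs_nbhs; split=> //; exact: open_stratum_cond.
have : stratum_nbhd 24 (poly_family p t0).
  by have := orbit_meets_nbhd (isT : 24 < 25)%N (Jp t0) Gc' Uc'; rewrite strata_open // => -[].
move=> Ut0; have cU : closed (~` (stratum_nbhd 24 : set (sconst R 2 2))) by apply: open_closedC; exact: open_stratum_cond.
have [f [Hf f0 ft0]] := closed_separate cU (fun n => n Ut0).
have [] := @polyfun_localized _ _ f 1 (poly_family p) Hf.
  move=> i; exists 0%N, (p i) => u _; by rewrite expr0 mulr1 ffunE.
move=> n [q Eq]; have {}Eq u : f (poly_family p u) = q.[u].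
  by rewrite -Eq ?hornerC ?oner_eq0 // expr1n mulr1.
have q0 : q != 0 by apply: contra_notN ft0 => /eqP q0; rewrite Eq q0 horner0.
have [t rt] : exists t, (q * \prod_(a <- s) ('X - a%:P)).[t] != 0.
  apply: contrapT => /forallNP n0; have := @poly_eq0_cofinite _ 1 (q * \prod_(a <- s) ('X - a%:P)).
  rewrite oner_neq0 => /(_ isT) r0; have /eqP : q * \prod_(a <- s) ('X - a%:P) = 0.
    by apply: r0 => u _; apply/eqP/negPn/negP/n0.
  by rewrite mulf_eq0 (negPf q0) (negPf (monic_neq0 (monic_prod_XsubC _ _ _))).
move: rt; rewrite hornerM mulf_eq0 negb_or -Eq => /andP[ft /negP rt].
have Ut : stratum_nbhd 24 (poly_family p t).
  by apply: contrapT => /f0 e0; rewrite e0 eqxx in ft.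
have Xt : strata 24 (poly_family p t) by rewrite strata_open.
have : ~ [set t | (orbit_dim (poly_family p t)).+1 <> d] t.
  rewrite fin_s /= => ts; apply: rt; have := root_prod_XsubC s t; rewrite ts.
  by move/rootP => ->.
by move=> /contrapT <-; rewrite (orbit_dim_J16 Xt).
Qed.

Lemma component_dim_le i e : (i < 25)%N -> component_dim (closure (strata i)) e -> (e <= 13)%N.
Proof.
move=> i25; have [i24|i24] := ltnP i 24.
  case=> [[c /(closure_orbit_strata i25) Xc <-]|[n _]]; first exact: orbit_dim_rigid Xc.
  by case: n; exists (sc (N i)); rewrite strata_orbit.
have -> : i = 24%N by apply/eqP; rewrite eqn_leq i24 -ltnS i25.
case=> [[c /(@closure_orbit_strata 24 _ isT) Xc <-]|[_ [p E fin]]].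
  by rewrite (orbit_dim_J16 Xc).
by rewrite (family_dim_J16 E fin).
Qed.

Lemma component_dim_ex i : (i < 25)%N -> exists e, component_dim (closure (strata i)) e.
Proof.
move=> i25; have [i24|i24] := ltnP i 24.
  by exists (orbit_dim (sc (N i))); left; exists (sc (N i)); rewrite ?strata_orbit.
have -> : i = 24%N by apply/eqP; rewrite eqn_leq i24 -ltnS i25.
(* The definition of [component_dim] gives priority to a dense orbit; both possibilities are
   handled, and in the absence of one the family gives 11 + 1 = 12. *)
have [[c e]|n] := pselect (exists c, closure (strata 24) = closure (Gorbit c)).
  by exists (orbit_dim c); left; exists c.
exists 12%N; right; split=> //.
pose p := @polyC C.
pose W := Tab 1%:P 0 0 0 0 1%:P (p 2^-1) 0 0 (p 2^-1) (p 2^-1) 0 0 (p 2^-1) 1%:P 'X.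
have WE t : tev W t = tab16 t by apply: Tab_eq; rewrite /= ?hornerX ?hornerC.
pose P (i : gidx 2 2) := vco (val i).2 (mul W (bas {poly C} (val i).1.1) (bas {poly C} (val i).1.2)).
have PE t : poly_family P t = sc (tab16 t).
  by apply/ffunP => j; rewrite !ffunE -horner_mul WE.
exists P.
  rewrite strata_J16; congr closure; apply: eq_bigcupr => t _.
  by rewrite J16E PE.
rewrite (_ : [set _ | _] = set0) ?finite_set0 //.
apply/seteqP; split=> t //=; apply; rewrite PE (@orbit_dim_J16 (sc (tab16 t))) //.
by exists (tab16 t) => //; exists t; exact: iso_refl.
Qed.

End Final.

Theorem theoremB (R : realType) :
  [/\ variety_dim (JS R 2 2) 13,
      [set Z | irreducible_component (JS R 2 2) Z] #= `I_25,
      [set Z | irreducible_component (JS R 2 2) Z] =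
        [set closure (Gorbit c) | c in [set` rigid_list R]]
        `|` [set closure (\bigcup_t Gorbit (J16 t))],
      forall c, c \in rigid_list R -> rigid c &
      JS R 2 2 =
        closure ((\bigcup_(c in [set` rigid_list R]) Gorbit c)
                 `|` \bigcup_t Gorbit (J16 t))].
Proof.
pose N i := nth (tab16 0) (tabs R[i]) i.
have memP c : c \in rigid_list R <-> exists2 i, (i < 24)%N & c = sc (N i).
  have NE i : (i < 24)%N -> nth (sc (tab16 0)) (rigid_list R) i = sc (N i).
    by move=> i24; rewrite rigid_listE (nth_map (tab16 0)).
  split=> [/(nthP (sc (tab16 0)))[i i24 <-]|[i i24 ->]]; first by exists i; rewrite ?NE.
  by rewrite -NE // mem_nth.
have split25 i : (i < 25)%N -> (i < 24)%N \/ i = 24%N.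
  by rewrite ltnS leq_eqVlt => /orP[/eqP|]; [right|left].
split.
- split=> [Z /componentP[i i25 ->]||Z e /componentP[i i25 ->]].
  + exact: component_dim_ex.
  (* The maximum is attained at [J2], whose superderivations have dimension exactly 3. *)
  + exists (closure (strata 1)); first by apply/componentP; exists 1%N.
    left; exists (sc (N 1%N)); first by rewrite strata_orbit.
    by rewrite /orbit_dim (dim_Der_J2 R).
  + exact: component_dim_le.
- rewrite (_ : [set Z | _] = (fun i => closure (@strata R i)) @` `I_25).
    by apply: inj_card_eq => i j; rewrite !inE; exact: closure_strata_inj.
  by apply/seteqP; split=> Z /= => [/componentP[i ? ->]|[i i25 <-]];
    [exists i|apply/componentP; exists i].
- apply/seteqP; split=> Z /=.
    move/componentP=> [i /split25[i24|->] ->]; last by right; rewrite strata_J16.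
    by left; exists (sc (N i)); [apply/memP; exists i|rewrite strata_orbit].
  case=> [[c /memP[i i24 ->] <-]|->]; apply/componentP.
    by exists i; [exact: ltn_trans i24 _|rewrite strata_orbit].
  by exists 24%N => //; rewrite strata_J16.
- move=> c /memP[i i24 ->]; exists (stratum_nbhd i); first exact: open_stratum_cond.
  by rewrite -strata_orbit // strata_open // (ltn_trans i24).
rewrite JS_closure; congr closure; apply/seteqP; split=> c.
  move=> [i /split25[i24|->]]; last by rewrite strata_J16; right.
  by rewrite strata_orbit // => Gc; left; exists (sc (N i)) => //; apply/memP; exists i.
case=> [[c' /memP[i i24 ->] Gc]|Gc]; last by exists 24%N; rewrite ?strata_J16.
by exists i; [exact: ltn_trans i24 _|rewrite strata_orbit].
Qed.
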